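(* Let $E$ be a solid TIBF of bounded type on $\mathbb{R}^d$ and let $\mathcal{W}=(w_n)_{n\in\mathbb{N}}$ be a weight function system on $\mathbb{R}^d$ satisfying $(\mathrm{wM})$: for every $n\in\mathbb{N}$ there exist $m\ge n$ and $C>0$ such that $w_n(x+y)\le C w_m(x)$ for all $x\in\mathbb{R}^d$ and $|y|\le1$. Suppose that $(\chi^0,\chi^1)\in\mathcal{D}\times\mathcal{D}$ has the moment-wise decomposition factorization property (MDFP). Then for any $f\in\mathcal{D}'$ the following are equivalent: (i) $f\in\mathcal{O}_C'(\mathcal{D},E_{\mathcal{W}})$; (ii) for every $\phi\in\mathcal{D}$ and $n\in\mathbb{N}$ there exists $r>0$ such that the set $\{2^{-rj}[f*\phi_j]\,w_n: j\in\mathbb{N}\}$ is bounded in $E$; (iii) for every $n\in\mathbb{N}$ there exists $r>0$ such that the set $\{2^{-rj}[f*\chi^\ell_j]\,w_n: j\in\mathbb{N},\ \ell=0,1\}$ is bounded in $E$.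
   Context: $\mathbb{N}=\{0,1,2,\dots\}$; $\mathcal{D}$ is the space of compactly supported smooth functions on $\mathbb{R}^d$, $\mathcal{D}'$ the space of distributions; $T_xf(t)=f(t-x)$. For $\phi\in\mathcal{D}$ and $j\in\mathbb{N}$, $\phi_j:=2^{jd}\phi(2^j\,\cdot\,)$ (and $\chi^\ell_j=2^{jd}\chi^\ell(2^j\,\cdot\,)$). Solid TIBF of bounded type: a Banach space $(E,\|\cdot\|_E)$ is a translation-invariant Banach function space (TIBF) of bounded type on $\mathbb{R}^d$ if $E$ is non-trivial, $E\subseteq L^1_{\mathrm{loc}}(\mathbb{R}^d)$ continuously, and: (A.1) $T_xE\subseteq E$ for all $x\in\mathbb{R}^d$; (A.2) there is $C_0>0$ with $\|T_xf\|_E\le C_0\|f\|_E$ for all $x\in\mathbb{R}^d$, $f\in E$; (A.3) $E$ is a Banach module over $L^1(\mathbb{R}^d)$ under convolution ($\|f*\varphi\|_E\le\|f\|_E\|\varphi\|_{L^1}$). It is solid if $f\in E$, $g\in L^1_{\mathrm{loc}}(\mathbb{R}^d)$ and $|g|\le|f|$ a.e. imply $g\in E$ and $\|g\|_E\le\|f\|_E$. A weight function is a locally bounded measurable function $\mathbb{R}^d\to[1,\infty)$; a weight function system is a sequence $\mathcal{W}=(w_n)_{n\in\mathbb{N}}$ of weight functions with $w_n\le w_{n+1}$ for all $n$. $E_{\mathcal{W}}:=\{f\in L^1_{\mathrm{loc}}(\mathbb{R}^d): fw_n\in E\text{ for all }n\in\mathbb{N}\}$, and $\mathcal{O}_C'(\mathcal{D},E_{\mathcal{W}}):=\{f\in\mathcal{D}':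 f*\varphi\in E_{\mathcal{W}}\text{ for all }\varphi\in\mathcal{D}\}$. MDFP: for compact $K\subset\mathbb{R}^d$, $\mathcal{D}(K)$ is the space of smooth functions supported in $K$, and for $L\in\mathbb{N}$, $\mathcal{D}_L(K):=\{\varphi\in\mathcal{D}(K):\int x^\alpha\varphi(x)\,dx=0\text{ for all }|\alpha|<L\}$. A pair $(\chi^0,\chi^1)\in\mathcal{D}\times\mathcal{D}$ has the MDFP if for some compact $K\subset\mathbb{R}^d$ there exist non-trivial functions $(\varphi^\ell_L,\psi^\ell_L)\in\mathcal{D}(K)\times\mathcal{D}_L(K)$, $\ell\in\{0,1\}$, $L\in\mathbb{N}$, such that for every $L$: $2^d\varphi^0_L(2\,\cdot\,)-\varphi^0_L=\Delta\psi^0_L$; $\int\varphi^0_L(x)\,dx=1$; $\varphi^0_L=\chi^0*\varphi^0_L+\chi^1*\varphi^1_L$ and $\psi^0_L=\chi^0*\psi^0_L+\chi^1*\psi^1_L$. *)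

(* Defs.v *)
From HB Require Import structures.
From mathcomp Require Import all_boot all_order all_algebra.
From mathcomp Require Import complex.
From mathcomp Require Import all_classical all_reals all_analysis.

Set Implicit Arguments.
Unset Strict Implicit.
Unset Printing Implicit Defensive.
Import Order.TTheory GRing.Theory Num.Theory.
Import numFieldNormedType.Exports.

Local Open Scope classical_set_scope.
Local Open Scope ring_scope.
Local Open Scope complex_scope.

(* Borel sigma-algebra of R^d, generated by the coordinates (as the library
   does for n.-tuple). *)
Section rV_measurable.
Context {R : realType} {d : nat}.

Let coord : 'I_d -> 'rV[R]_d -> R := fun i x => x 0 i.

Let rV_set0 : g_sigma_preimage coord set0.
Proof. exact: sigma_algebra0. Qed.

Let rV_setC A : g_sigma_preimage coord A -> g_sigma_preimage coord (~` A).
Proof. exact: sigma_algebraC. Qed.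

Let rV_bigcup (F : _^nat) : (forall i, g_sigma_preimage coord (F i)) ->
  g_sigma_preimage coord (\bigcup_i (F i)).
Proof. exact: sigma_algebra_bigcup. Qed.

HB.instance Definition _ := @isMeasurable.Build
  (measure_tuple_display default_measure_display) 'rV[R]_d
  (g_sigma_preimage coord) rV_set0 rV_setC rV_bigcup.

Lemma measurable_coord (i : 'I_d) :
  measurable_fun [set: 'rV[R]_d] (fun x : 'rV[R]_d => x 0 i).
Proof.
move=> _ Y mY; rewrite setTI; apply: sub_sigma_algebra => /=.
rewrite -bigcup_seq/=; exists i => /=; first by rewrite mem_index_enum.
by exists Y => //; rewrite setTI.
Qed.

Lemma measurable_fun_coordP d1 (T1 : measurableType d1) (f : T1 -> 'rV[R]_d) :
  (forall i, measurable_fun [set: T1] (fun x => f x 0 i)) ->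
  measurable_fun [set: T1] f.
Proof.
move=> mf.
have sub : g_sigma_preimage (fun i => coord i \o f) `<=` measurable.
  apply: smallest_sub; first exact: sigma_algebra_measurable.
  rewrite -bigcup_seq; apply: bigcup_sub => i _.
  by move=> A [B mB <-]; exact: mf.
move: sub; rewrite g_sigma_preimage_comp => sub _ A mA.
by apply: sub; exists A.
Qed.

End rV_measurable.


Section lebesgue_rV.
Context {R : realType}.

Definition rV_cons d (p : R * 'rV[R]_d) : 'rV[R]_d.+1 := row_mx p.1%:M p.2.

Definition rV_uncons d (x : 'rV[R]_d.+1) : R * 'rV[R]_d :=
  (x 0 0, \row_j x 0 (lift ord0 j)).

Lemma rV_consE0 d (p : R * 'rV[R]_d) : rV_cons p 0 0 = p.1.
Proof.
have := row_mxEl (p.1%:M : 'M[R]_1) p.2 0 0; rewrite [RHS]mxE eqxx mulr1n => <-.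
by congr (row_mx _ _ _ _); exact: val_inj.
Qed.

Lemma rV_consES d (p : R * 'rV[R]_d) j : rV_cons p 0 (lift ord0 j) = p.2 0 j.
Proof.
rewrite -(row_mxEr (p.1%:M : 'M[R]_1) p.2 0 j).
by congr (row_mx _ _ _ _); exact: val_inj.
Qed.

Lemma rV_consK d : cancel (@rV_cons d) (@rV_uncons d).
Proof.
move=> [a v]; rewrite /rV_uncons rV_consE0; congr pair.
by apply/rowP => j; rewrite mxE rV_consES.
Qed.

Lemma measurable_rV_cons d : measurable_fun [set: R * 'rV[R]_d] (@rV_cons d).
Proof.
apply: measurable_fun_coordP => i.
case: (unliftP ord0 i) => [j|] ->.
  under eq_fun do rewrite rV_consES.
  exact: (measurableT_comp (measurable_coord j) measurable_snd).
under eq_fun do rewrite rV_consE0.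
exact: measurable_fst.
Qed.

Lemma measurable_rV_uncons d : measurable_fun [set: 'rV[R]_d.+1] (@rV_uncons d).
Proof.
apply/measurable_fun_pairP; split; first exact: measurable_coord.
apply: measurable_fun_coordP => i /=.
under eq_fun do rewrite mxE.
exact: measurable_coord.
Qed.

Section step.
Context {d : nat} (mu : {sigma_finite_measure set 'rV[R]_d -> \bar R}).

Definition lebesgue_step :=
  pushforward (lebesgue_measure \x mu)%E (@rV_cons d).

Let step0 : lebesgue_step set0 = 0%E.
Proof. by rewrite /lebesgue_step /pushforward preimage_set0 measure0. Qed.

Let step_ge0 A : (0 <= lebesgue_step A)%E.
Proof. by rewrite /lebesgue_step /pushforward; exact: measure_ge0. Qed.

Let step_sigma_additive : semi_sigma_additive lebesgue_step.
Proof.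
pose mfc := measurable_rV_cons (d := d).
exact: (@measure_semi_sigma_additive _ _ _
  (measure_function_pushforward__canonical__measure_function_Measure
    (lebesgue_measure \x mu)%E mfc)).
Qed.

HB.instance Definition _ := isMeasure.Build _ _ _ lebesgue_step
  step0 step_ge0 step_sigma_additive.

Let sigma_finite_step : sigma_finite setT lebesgue_step.
Proof.
have [F FT Foo] : sigma_finite setT (lebesgue_measure \x mu)%E.
  have /sigma_finiteP[F [FT ndF Foo]] := sigma_finiteT (@lebesgue_measure R).
  have /sigma_finiteP[G [GT ndG Goo]] := sigma_finiteT mu.
  exists (fun n => F n `*` G n).
    rewrite -setXTT FT GT predeqE => -[x y]; split.
      move=> [/= [n _ Fnx] [k _ Gky]]; exists (maxn n k) => //; split.
      - by move: x Fnx; exact/subsetPset/ndF/leq_maxl.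
      - by move: y Gky; exact/subsetPset/ndG/leq_maxr.
    by move=> [n _ []/= ? ?]; split; exists n.
  move=> k; have [? ?] := Foo k; have [? ?] := Goo k.
  split; first exact: measurableX.
  by rewrite product_measure1E// lte_mul_pinfty// ge0_fin_numE.
have mB k : measurable (@rV_uncons d @^-1` F k).
  rewrite -[X in measurable X]setTI; apply: measurable_rV_uncons => //.
  by case: (Foo k).
exists (fun k => @rV_uncons d @^-1` F k).
  by rewrite -preimage_bigcup -FT preimage_setT.
move=> k; split => //; rewrite /lebesgue_step /pushforward -comp_preimage.
rewrite (_ : _ \o _ = id); first by case: (Foo k).
by apply/funext => p /=; rewrite rV_consK.
Qed.

HB.instance Definition _ :=
  Measure_isSigmaFinite.Build _ _ _ lebesgue_step sigma_finite_step.

End step.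

End lebesgue_rV.

(* d-dimensional Lebesgue measure, by iterated products with the Lebesgue
   measure of R; see lebesgue_rV_box for the characterisation on boxes. *)
Fixpoint lebesgue_rV {R : realType} (d : nat) :
    {sigma_finite_measure set 'rV[R]_d -> \bar R} :=
  if d is d'.+1 then lebesgue_step (@lebesgue_rV R d')
  else dirac (0 : 'rV[R]_0).

Lemma lebesgue_rV_box {R : realType} d (A : 'I_d -> set R) :
  (forall i, measurable (A i)) ->
  lebesgue_rV d [set x : 'rV[R]_d | forall i, A i (x 0 i)] =
  (\prod_(i < d) lebesgue_measure (A i))%E.
Proof.
elim: d A => [|d IH] A mA.
  by rewrite big_ord0 /= diracE mem_set// => -[].
rewrite big_ord_recl /= /lebesgue_step /pushforward.
rewrite -(IH (fun i => A (lift ord0 i))) => [|i]; last exact: mA.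
rewrite -(@product_measure1E _ _ _ _ R lebesgue_measure (lebesgue_rV d))//;
  last first.
  rewrite (_ : mkset _ =
    \bigcap_i [set x : 'rV[R]_d | A (lift ord0 i) (x 0 i)]).
    apply: fin_bigcap_measurable => // i _.
    by rewrite -[X in measurable X]setTI; exact: measurable_coord.
  by apply/seteqP; split=> x /= xA i; [move=> _|]; apply: xA.
  exact: (mA ord0).
congr product_measure1; apply/seteqP; split=> -[a v] /=.
  move=> H; split=> [|i]; first by have := H 0; rewrite rV_consE0.
  by have := H (lift ord0 i); rewrite rV_consES.
move=> [H0 HS] i; case: (unliftP ord0 i) => [j|] ->.
  by rewrite rV_consES; exact: HS.
by rewrite rV_consE0.
Qed.

Section function_spaces.
Context {R : realType} {d : nat}.
Local Notation Rd := 'rV[R]_d.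
Local Notation C := R[i].
Local Notation leb := (@lebesgue_rV R d).
Local Notation normc := Normc.normc.
Implicit Types f g phi psi : Rd -> C.

Definition Cintegral f : C :=
  (\int[leb]_x complex.Re (f x)) +i* (\int[leb]_x complex.Im (f x)).

Definition Cmeasurable f :=
  measurable_fun [set: Rd] (fun x => complex.Re (f x)) /\
  measurable_fun [set: Rd] (fun x => complex.Im (f x)).

(* The elements of L^1_loc and L^1 are classes of almost everywhere equal
   Lebesgue measurable functions; each class contains a Borel function, and
   only these representatives are considered here. *)
Definition L1loc f := Cmeasurable f /\
  forall K, compact K -> (\int[leb]_(x in K) (normc (f x))%:E < +oo)%E.

Definition L1 f := Cmeasurable f /\ (\int[leb]_x (normc (f x))%:E < +oo)%E.

Definition L1norm f : R := \int[leb]_x normc (f x).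

Definition translate (h : Rd) f : Rd -> C := fun x => f (x - h).

(* Cintegral returns a junk value where y |-> f y * g (x - y) is not integrable.
   For f in a solid TIBF_bounded space and g in L^1 this happens only for x in
   a null set: for bounded g of compact support it never happens, and
   monotone convergence in E, hence in L^1_loc, gives the general case. *)
Definition convolution f g : Rd -> C :=
  fun x => Cintegral (fun y => f y * g (x - y)).

(* pderiv [:: i1; ...; ik] u is the iterated partial derivative
   d_i1 ... d_ik u. *)
Definition pderiv (s : seq 'I_d) (u : Rd -> R) : Rd -> R :=
  foldr (fun i v => 'D_(delta_mx 0 i) v) u s.

Definition smooth_real (u : Rd -> R) := forall s,
  continuous (pderiv s u) /\
  forall i x, derivable (pderiv s u) x (delta_mx 0 i).

Definition smooth f :=
  smooth_real (fun x => complex.Re (f x)) /\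
  smooth_real (fun x => complex.Im (f x)).

Definition Cpderiv (s : seq 'I_d) f : Rd -> C := fun x =>
  pderiv s (fun y => complex.Re (f y)) x +i*
  pderiv s (fun y => complex.Im (f y)) x.

Definition laplacian f : Rd -> C := fun x => \sum_i Cpderiv [:: i; i] f x.

Definition supp f : set Rd := closure [set x | f x != 0].

Definition test_fun f := smooth f /\ compact (supp f).

Definition test_fun_on (K : set Rd) f := smooth f /\ supp f `<=` K.

Definition vanishing_moments (L : nat) f :=
  forall alpha : {ffun 'I_d -> nat}, (\sum_i alpha i < L)%N ->
  Cintegral (fun x => (\prod_i x 0 i ^+ alpha i)%:C * f x) = 0.

Definition dilate phi (j : nat) : Rd -> C :=
  fun x => 2 ^+ (j * d) * phi (2 ^+ j *: x).

(* F is a total function, but only its values on test functions are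
   constrained or used.  Continuity on D is continuity on
   each D(K), K compact, with B standing for the seminorm
   max_(|s| <= k) sup_x |d^s phi(x)|. *)
Record is_distribution (F : (Rd -> C) -> C) : Prop := {
  distribution_linear : forall (a : C) phi psi, test_fun phi -> test_fun psi ->
    F (fun x => a * phi x + psi x) = a * F phi + F psi ;
  distribution_continuous : forall K, compact K ->
    exists (M : R) (k : nat), forall phi (B : R), test_fun_on K phi ->
      (forall s x, (size s <= k)%N -> normc (Cpderiv s phi x) <= B) ->
      normc (F phi) <= M * B }.

Definition dconv (F : (Rd -> C) -> C) phi : Rd -> C :=
  fun x => F (fun y => phi (x - y)).

(* A Banach space E inside L^1_loc is given by the abstract Banach space E and
   the embedding rep : E -> L^1_loc, which picks a representative of each
   class.  A function f belongs to E when its class is in the range of rep. *)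
Definition memE (E : completeNormedModType C) (rep : E -> Rd -> C) f :=
  exists u : E, rep u = f %[ae leb].

Record TIBF_bounded (E : completeNormedModType C) (rep : E -> Rd -> C)
    : Prop := {
  TIBF_L1loc : forall u, L1loc (rep u) ;
  TIBF_linear : forall (a : C) u v,
    rep (a *: u + v) = (fun x => a * rep u x + rep v x) %[ae leb] ;
  TIBF_injective : forall u, rep u = cst 0 %[ae leb] -> u = 0 ;
  TIBF_nontrivial : exists u : E, u != 0 ;
  TIBF_continuous : forall K, compact K -> exists M : R, forall u,
    (\int[leb]_(x in K) normc (rep u x))%:C <= M%:C * `|u| ;
  TIBF_translate : forall h u, memE rep (translate h (rep u)) ;
  TIBF_bounded_translate : exists2 C0 : R, 0 < C0 & forall h u v,
    rep v = translate h (rep u) %[ae leb] -> `|v| <= C0%:C * `|u| ;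
  TIBF_module : forall u phi, L1 phi ->
    exists2 v, rep v = convolution (rep u) phi %[ae leb] &
      `|v| <= `|u| * (L1norm phi)%:C }.

Definition solid (E : completeNormedModType C) (rep : E -> Rd -> C) :=
  forall u g, L1loc g ->
    (\forall x \ae leb, normc (g x) <= normc (rep u x)) ->
    exists2 v, rep v = g %[ae leb] & `|v| <= `|u|.

Definition bounded_in_E (E : completeNormedModType C) (rep : E -> Rd -> C)
    (A : set (Rd -> C)) :=
  exists M : R, forall f, A f -> exists2 u, rep u = f %[ae leb] & `|u| <= M%:C.

Definition euclidean_norm (x : Rd) : R := Num.sqrt (\sum_i x 0 i ^+ 2).

(* Lebesgue measurability is expressed as almost everywhere equality with a
   Borel function. *)
Record weight (w : Rd -> R) : Prop := {
  weight_ge1 : forall x, 1 <= w x ;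
  weight_locally_bounded : forall K, compact K ->
    exists M, forall x, K x -> w x <= M ;
  weight_measurable :
    exists2 v : Rd -> R, measurable_fun [set: Rd] v & w = v %[ae leb] }.

Record weight_system (w : nat -> Rd -> R) : Prop := {
  weight_system_weight : forall n, weight (w n) ;
  weight_system_nondecreasing : forall n x, w n x <= w n.+1 x }.

Definition wM (w : nat -> Rd -> R) := forall n, exists m (c : R),
  [/\ (n <= m)%N, 0 < c &
    forall x y, euclidean_norm y <= 1 -> w n (x + y) <= c * w m x].

Definition weighted f (v : Rd -> R) : Rd -> C := fun x => f x * (v x)%:C.

Definition EW (E : completeNormedModType C) (rep : E -> Rd -> C)
    (w : nat -> Rd -> R) f :=
  L1loc f /\ forall n, memE rep (weighted f (w n)).

Definition OC' (E : completeNormedModType C) (rep : E -> Rd -> C)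
    (w : nat -> Rd -> R) (F : (Rd -> C) -> C) :=
  is_distribution F /\ forall phi, test_fun phi -> EW rep w (dconv F phi).

Definition nontrivial f := exists x, f x != 0.

Definition MDFP (chi0 chi1 : Rd -> C) :=
  exists2 K : set Rd, compact K &
  exists phi0 phi1 psi0 psi1 : nat -> Rd -> C, forall L : nat,
  [/\ [/\ nontrivial (phi0 L), nontrivial (phi1 L),
          nontrivial (psi0 L) & nontrivial (psi1 L)],
      [/\ test_fun_on K (phi0 L), test_fun_on K (phi1 L),
          test_fun_on K (psi0 L) & test_fun_on K (psi1 L)],
      vanishing_moments L (psi0 L) /\ vanishing_moments L (psi1 L),
      (forall x, 2 ^+ d * phi0 L (2 *: x) - phi0 L x = laplacian (psi0 L) x) /\
      Cintegral (phi0 L) = 1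
    & (forall x, phi0 L x =
        convolution chi0 (phi0 L) x + convolution chi1 (phi1 L) x) /\
      (forall x, psi0 L x =
        convolution chi0 (psi0 L) x + convolution chi1 (psi1 L) x)].

End function_spaces.

(* Main.v *)
(* With phi_L^0 of integral 1, the functions phi^0_J * phi tend to phi in D, and
   MDFP turns the telescoping differences into
     f * (phi^0_(j+1) - phi^0_j) * phi
       = 2^(-2j) sum_l (f * chi^l_j) * (psi^l_j * Delta phi),
   where |psi^l_j * Delta phi| <= C 2^(-jL) by the vanishing moments, while
   (f * chi^l_j) w_m grows at most like 2^(rj) by (iii).  Since all supports lie
   in a compact set which does not depend on L, (wM) fixes m before L is chosen;
   with L > r the series converges absolutely in E, whence (iii) => (i).
   Conversely, phi |-> (f * phi) w_n has a closed graph from D(K) to E, so it is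
   bounded by finitely many derivatives, which grow like powers of 2^j along
   the dilations phi_j; this gives (i) => (ii). *)
Require Import Defs.
From mathcomp Require Import all_boot all_order all_algebra.
From mathcomp Require Import complex ring lra.
From mathcomp Require Import all_classical all_reals all_analysis.
From mathcomp Require Import measurable_realfun.
Import Order.TTheory GRing.Theory Num.Theory.
Import numFieldNormedType.Exports.
Set Implicit Arguments.
Unset Strict Implicit.
Unset Printing Implicit Defensive.
Local Open Scope classical_set_scope.
Local Open Scope ring_scope.
Local Open Scope complex_scope.

(** * Mean value theorem and Taylor expansion *)

(** The weights are merely measurable and [rep] is determined only up to null sets, so no integral
    is ever formed in E: every bound in E comes from a pointwise bound. If theta has support in a
    fixed ball B, then (wM) gives |(g * theta) w_n| <= 2 c sup|theta| ((|g| w_m) * 1_B), and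
    solidity together with the module property over L^1 does the rest. Only the supremum of theta
    enters, which is why supremum bounds for psi_j * Delta phi are enough. Limits in E are always
    limits of geometric series and are identified pointwise; this is also the form in which the
    graph of phi |-> (f * phi) w_n is closed. The closed graph theorem itself is proved with
    seminorm bounds on one fixed D(K), and it reaches all phi_j at once because dilation by 2^j with
    j >= 0 does not enlarge supports. On the analytic side a single quadrature rule, whose nodes do
    not depend on the integrand and whose error has a rate for Lipschitz functions, gives both the
    smoothness of convolutions and the exchange of a distribution with an integral. *)

Section line.
Context {R : realType} {V : normedModType R}.
Implicit Types (u : V -> R) (v x : V).

Lemma is_derive_line u v x (s : R) : derivable u (x + s *: v) v ->
  is_derive s 1 (fun t => u (x + t *: v)) ('D_v u (x + s *: v)).
Proof.
have E : (fun h : R => h^-1 *: (((fun t => u (x + t *: v)) \o shift s) (h *: 1)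
             - u (x + s *: v)))
    = (fun h => h^-1 *: ((u \o shift (x + s *: v)) (h *: v) - u (x + s *: v))).
  apply/funext => h /=; congr (_ *: (u _ - _)).
  by rewrite [h *: 1]mulr1 scalerDl addrCA.
by move=> du; split; rewrite /derivable /derive E.
Qed.

Lemma line_MVT u v x (t : R) : (forall y, derivable u y v) ->
  exists2 xi : R, `|xi| <= `|t| &
    u (x + t *: v) - u x = 'D_v u (x + xi *: v) * t.
Proof.
move=> du; have dl s := is_derive_line (du (x + s *: v)).
have cw a b : {within `[a, b], continuous (fun t => u (x + t *: v))}.
  apply: derivable_within_continuous => s _.
  by case: (dl s).
have [t0|/ltW t0] := leP 0 t.
  have [xi xiI E] := MVT_segment t0 (fun s _ => dl s) (cw _ _).
  exists xi; first by move: xiI; rewrite in_itv/= => /andP[? ?]; rewrite !ger0_norm.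
  by move: E; rewrite scale0r addr0 subr0.
have [xi xiI E] := MVT_segment t0 (fun s _ => dl s) (cw _ _).
exists xi.
  by move: xiI; rewrite in_itv/= => /andP[? ?]; rewrite !ler0_norm// lerN2.
apply: oppr_inj; rewrite opprB -mulrN -[- t]add0r -E.
by rewrite scale0r addr0.
Qed.

End line.

Section taylor_line.
Context {R : realType} {V : normedModType R}.
Implicit Types (u : V -> R) (v x : V).

Lemma iter_deriveS u v m :
  iter m (fun w => 'D_v w) ('D_v u) = iter m.+1 (fun w => 'D_v w) u.
Proof. by rewrite iterSr. Qed.

Definition taylor_poly L u v x : {poly R} :=
  \poly_(m < L) (iter m (fun w => 'D_v w) u x / (m`!)%:R).

Lemma deriv_taylor_poly L u v x :
  (taylor_poly L.+1 u v x)^`() = taylor_poly L ('D_v u) v x.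
Proof.
apply/polyP => m; rewrite coef_deriv !coef_poly ltnS.
case: ifP => _; last by rewrite mul0rn.
rewrite iter_deriveS -[LHS]mulr_natr -mulrA; congr (_ * _).
by rewrite factS natrM invfM mulrAC mulVf ?mul1r// pnatr_eq0.
Qed.

(** Induction on [L]: the error vanishes at t = 0, and its derivative in t is the error of order [L]
    for ['D_v u]. The mean value theorem bounds it by B |xi|^L |t|; the factor 1/L! of the sharp
    remainder is lost, which is harmless here. *)
Lemma taylor_line L u v (B : R) :
  (forall m x, derivable (iter m (fun w => 'D_v w) u) x v) ->
  (forall x, `|iter L (fun w => 'D_v w) u x| <= B) ->
  forall x t, `|u (x + t *: v) - (taylor_poly L u v x).[t]| <= B * `|t| ^+ L.
Proof.
elim: L u => [|L IH] u du uB x t.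
  rewrite /taylor_poly poly_def big_ord0 horner0 subr0 expr0 mulr1.
  exact: uB.
have dg (s : R) : is_derive s (1 : R) (fun t : R => u (x + t *: v) - (taylor_poly L.+1 u v x).[t])
   ('D_v u (x + s *: v) - (taylor_poly L ('D_v u) v x).[s]).
  apply: is_deriveB; first exact/is_derive_line/(du 0%N).
  rewrite -deriv_taylor_poly derivE derive1E; apply: derivableP.
  exact: derivable_horner.
have dg' (s : R) : derivable (fun t : R => u (x + t *: v) - (taylor_poly L.+1 u v x).[t]) s (1 : R).
  by case: (dg s).
have [xi xit] := line_MVT (0 : R) t dg'.
rewrite !add0r scale0r addr0 [t *: 1]mulr1 [xi *: 1]mulr1.
have -> : u x - (taylor_poly L.+1 u v x).[0] = 0.
  rewrite horner_coef0 coef_poly/= divr1; exact: subrr.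
rewrite subr0 => ->.
have /(_ xi) [_ ->] := dg.
rewrite normrM exprSr mulrA ler_wpM2r//.
apply: le_trans (IH _ _ _ _ _) _.
- by move=> m y; rewrite iter_deriveS.
- by move=> y; rewrite iter_deriveS.
by rewrite ler_wpM2l ?lerXn2r// (le_trans _ (uB 0)).
Qed.

End taylor_line.

(** * Smooth real functions: calculus, bounds and uniform limits *)

Section smooth_real.
Context {R : realType} {d : nat}.
Local Notation Rd := 'rV[R]_d.
Local Notation e i := (delta_mx 0 i : Rd).
Implicit Types (u v : Rd -> R) (s : seq 'I_d) (x y h : Rd).

Lemma pderiv_cat s s' u : pderiv (s ++ s') u = pderiv s (pderiv s' u).
Proof. exact: foldr_cat. Qed.

Lemma smooth_pderiv s u : smooth_real u -> smooth_real (pderiv s u).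
Proof. by move=> su s'; rewrite -pderiv_cat; exact: su. Qed.

Lemma smooth_derivable u i x : smooth_real u -> derivable u x (e i).
Proof. by move=> su; have [_] := su [::]; exact. Qed.

(** Smoothness is proved by guessing the whole family [P] of iterated derivatives at once: a single
    differentiation step remains to be checked, and the formulas for all [pderiv s] come with it. *)
Lemma smooth_realW u (P : seq 'I_d -> Rd -> R) : P [::] = u ->
  (forall s, continuous (P s)) ->
  (forall s i x, is_derive x (e i) (P s) (P (i :: s) x)) ->
  smooth_real u /\ forall s, pderiv s u = P s.
Proof.
move=> P0 cP dP; have E s : pderiv s u = P s.
  elim: s => //= i s ->; apply/funext => x.
  by case: (dP s i x).
by split=> // s; rewrite E; split=> // i x; case: (dP s i x).
Qed.

Lemma smooth_linear (a : R) u v : smooth_real u -> smooth_real v ->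
  smooth_real (fun x => a * u x + v x) /\
  forall s, pderiv s (fun x => a * u x + v x) =
            (fun x => a * pderiv s u x + pderiv s v x).
Proof.
move=> su sv.
apply: (smooth_realW (P := fun s x => a * pderiv s u x + pderiv s v x)) => // s.
  by move=> x; exact: (cvgD (cvgMl_tmp ((su s).1 x)) ((sv s).1 x)).
move=> i x; apply: is_deriveD; last exact/derivableP/(sv s).2.
by apply: is_deriveZ; exact/derivableP/(su s).2.
Qed.

Lemma smooth0 : smooth_real (fun _ : Rd => 0) /\
  forall s, pderiv s (fun _ : Rd => 0) = (fun=> 0).
Proof.
apply: (smooth_realW (P := fun s x => 0)) => // s; first exact: cst_continuous.
Qed.

Lemma is_derive_affine u (c : R) (b x v : Rd) : derivable u (c *: x + b) v ->
  is_derive x v (fun x => u (c *: x + b)) (c * 'D_v u (c *: x + b)).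
Proof.
move=> du; have dl := is_derive_line (x := c *: x + b) (s := 0) (v := v) (u := u).
rewrite scale0r addr0 in dl; have {}dl := dl du.
pose g t := u ((c *: x + b) + t *: v).
have dc : is_derive (0 : R) (1 : R) (fun t : R => g (c * t)) ('D_v u (c *: x + b) * c).
  have E : 'D_v u (c *: x + b) * c = c *: 'D_v u (c *: x + b) by rewrite mulrC.
  have dc0 : is_derive (0 : R) (1 : R) (fun t : R => c * t) (c *: (1 : R)).
    exact: is_deriveZ.
  have dl' : is_derive (c * 0) (1 : R) g ('D_v u (c *: x + b)) by rewrite mulr0.
  by have := is_derive1_comp dl' dc0; rewrite /comp [c *: 1]mulr1.
have EF : (fun h : R => h^-1 *: (u (c *: (h *: v + x) + b) - u (c *: x + b)))
   = (fun h : R => h^-1 *: (g (c * (h *: (1 : R) + 0)) - g (c * 0))).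
  apply/funext => h /=; rewrite addr0 [h *: 1]mulr1 /g mulr0 scale0r addr0.
  by congr (_ *: (u _ - _)); rewrite scalerDr scalerA -addrA addrC.
case: dc => dc1 dc2; split; first by rewrite /derivable /= EF.
by rewrite mulrC -dc2 /derive /= EF.
Qed.

Lemma smooth_affine (c : R) (b : Rd) u : smooth_real u ->
  smooth_real (fun x => u (c *: x + b)) /\
  forall s, pderiv s (fun x => u (c *: x + b)) =
            (fun x => c ^+ size s * pderiv s u (c *: x + b)).
Proof.
move=> su.
apply: (smooth_realW (P := fun s x => c ^+ size s * pderiv s u (c *: x + b))).
- by apply/funext => x; rewrite expr0 mul1r.
- move=> s x; have ca : (fun y : Rd => c *: y + b) y @[y --> x] --> c *: x + b.
    exact: (cvgD (cvgZl_tmp cvg_id) (cvg_cst _)).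
  exact: (cvgMl_tmp (cvg_comp _ _ ca ((su s).1 _))).
move=> s i x; have -> : c ^+ size (i :: s) * pderiv (i :: s) u (c *: x + b) =
   c ^+ size s *: (c * 'D_(e i) (pderiv s u) (c *: x + b)).
  by rewrite /= exprSr -mulrA.
by apply: is_deriveZ; apply: is_derive_affine; exact: (su s).2.
Qed.

Definition supportedR (N : R) u := forall x, N < `|x| -> u x = 0.

Lemma supported_pderiv N s u : supportedR N u -> supportedR N (pderiv s u).
Proof.
move=> uN; elim: s => //= i s IH x Nx.
(* The set where N < |x| is open, so the function agrees with 0 near x. *)
rewrite (@near_eq_derive _ _ _ _ (cst 0)) ?derive_cst//.
near=> y; apply: IH; near: y.
exact: (cvgr_gt _ (@norm_continuous _ _ x) _ Nx).
Unshelve. all: by end_near. Qed.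

Lemma compact_ball (N : R) : compact [set x : Rd | `|x| <= N].
Proof.
apply: bounded_closed_compact.
  by exists N; split => [|M NM x /le_trans]; [exact: num_real|apply; exact: ltW].
apply: (@preimage_closed _ _ (fun x : Rd => `|x|) [set r | r <= N]).
  by move=> x _; exact: norm_continuous.
exact: closed_le.
Qed.

Lemma supported_bounded N u : continuous u -> supportedR N u ->
  exists B, forall x, `|u x| <= B.
Proof.
move=> cu uN; pose K : set Rd := [set x | `|x| <= N].
have cK : compact K by exact: (@compact_ball N).
have [[x0 Kx0]|K0] := pselect (exists x, K x); last first.
  exists 0 => x; rewrite uN ?normr0// ltNge; apply/negP => xN; apply: K0.
  by exists x.
have cN : continuous (fun x => `|u x|) by move=> x; exact: cvg_norm (cu x).
have [c Kc cmax] := EVT_max_rV (ex_intro _ x0 Kx0) cK (continuous_subspaceT cN).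
exists `|u c| => x; have [xN|Nx] := leP `|x| N; last by rewrite uN// normr0.
by apply: cmax; rewrite inE.
Qed.


(** Each derivative is continuous with bounded support; induction on [k] makes the bound uniform
    over the finitely many words of length at most [k]. The innermost derivative, which is the last
    letter, is split off because it can be absorbed into [u]. *)
Lemma pderiv_bounded N k u : smooth_real u -> supportedR N u ->
  exists B, forall s x, (size s <= k)%N -> `|pderiv s u x| <= B.
Proof.
elim: k u => [|k IH] u su uN.
  have [B uB] := supported_bounded (su [::]).1 uN.
  by exists B => -[|]//= x _; exact: uB.
have [B0 uB0] := supported_bounded (su [::]).1 uN.
have /choice[B uB] : forall i, exists B, forall s x, (size s <= k)%N ->
    `|pderiv s (pderiv [:: i] u) x| <= B.
  by move=> i; apply: IH; [exact: smooth_pderiv|exact: supported_pderiv].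
have B0_ge0 : 0 <= B0 by exact: le_trans (uB0 0).
have B_ge0 i : 0 <= B i by exact: le_trans (uB i [::] 0 _).
exists (B0 + \sum_i B i) => s x; case: (lastP s) => [|s' i].
  by move=> _; rewrite (le_trans (uB0 x))// lerDl sumr_ge0.
rewrite size_rcons ltnS -cats1 pderiv_cat => ks.
rewrite (le_trans (uB i s' x ks))// (bigD1 i)//= addrCA lerDl addr_ge0//.
by rewrite sumr_ge0.
Qed.

(* Consecutive head parts differ along a coordinate axis, where the mean value
   theorem applies. *)
Definition head_part k h : Rd := \row_i (if (i < k)%N then h 0 i else 0).

Lemma head_part0 h : head_part 0 h = 0.
Proof. by apply/rowP => i; rewrite !mxE. Qed.

Lemma head_part_all h : head_part d h = h.
Proof. by apply/rowP => i; rewrite !mxE ltn_ord. Qed.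

Lemma head_partS (k : 'I_d) h : head_part k.+1 h = head_part k h + h 0 k *: e k.
Proof.
apply/rowP => i; rewrite !mxE eqxx/= ltnS leq_eqVlt -val_eqE/=.
have [/val_inj ->|ik] := eqVneq (i : nat) k; last by rewrite mulr0 addr0.
by rewrite ltnn mulr1 add0r.
Qed.

Lemma coord_le_norm x i : `|x 0 i| <= `|x|.
Proof.
rewrite [`|x|]mx_normrE.
exact: (@le_bigmax _ _ _ 0 (fun i : 'I_1 * 'I_d => `|x i.1 i.2|) (0, i)).
Qed.

Lemma norm_le_coord x (B : R) : 0 <= B -> (forall i, `|x 0 i| <= B) -> `|x| <= B.
Proof.
move=> B0 xB; rewrite [`|x|]mx_normrE; apply/bigmax_leP; split=> // -[i j] _ /=.
by rewrite ord1.
Qed.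

(** The points are joined by d segments parallel to the axes, each of length at most |x - y| in the
    supremum norm; hence the factor [d%:R]. *)
Lemma smooth_lipschitz u (B : R) : smooth_real u ->
  (forall i x, `|pderiv [:: i] u x| <= B) ->
  forall x y, `|u x - u y| <= d%:R * B * `|x - y|.
Proof.
move=> su uB x y; set h := x - y.
have step (k : 'I_d) : `|u (y + head_part k.+1 h) - u (y + head_part k h)| <= B * `|h|.
  rewrite head_partS addrA.
  have [xi _ ->] := line_MVT (y + head_part k h) (h 0 k)
                      (fun z => @smooth_derivable u k z su).
  rewrite normrM ler_pM//; first exact: uB.
  exact: coord_le_norm.
have /(_ d (leqnn d)) : forall k, (k <= d)%N ->
    `|u (y + head_part k h) - u y| <= k%:R * (B * `|h|).
  elim=> [|k IH] kd; first by rewrite head_part0 addr0 subrr normr0 mul0r.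
  rewrite (le_trans (ler_distD (u (y + head_part k h)) _ _))//.
  rewrite -natr1 mulrDl mul1r addrC lerD//; first exact/IH/ltnW.
  exact: (step (Ordinal kd)).
by rewrite head_part_all /h [y + _]addrC subrK mulrA.
Qed.

(** A difference quotient of [pderiv s (U m)] is a value of [pderiv (i :: s) (U m)] at an
    intermediate point, hence close to [P (i :: s) x] by uniform convergence and continuity of the
    limit. *)
Lemma smooth_limit (U : nat -> Rd -> R) (P : seq 'I_d -> Rd -> R) :
  (forall m, smooth_real (U m)) ->
  (forall s (eps : R), 0 < eps -> exists m0, forall m x, (m0 <= m)%N ->
     `|pderiv s (U m) x - P s x| <= eps) ->
  smooth_real (P [::]) /\ forall s, pderiv s (P [::]) = P s.
Proof.
move=> sU UP.
have cP s : continuous (P s).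
  move=> x; apply/(@cvgrPdist_le _ _ _ (nbhs x) _) => /= eps eps0.
  have e3 : 0 < eps / 3 by rewrite divr_gt0.
  have [m0 /(_ m0 _ (leqnn _)) H] := UP s _ e3.
  have := (sU m0 s).1 x; move/cvgrPdist_le => /(_ _ e3); apply: filterS => y /= xy.
  have := H x; have := H y; move: xy; rewrite !ler_distl; lra.
apply: smooth_realW => // s i x.
have main : h^-1 *: (P s (h *: e i + x) - P s x) @[h --> (0:R)^'] --> P (i :: s) x.
  apply/cvgrPdist_le => /= eps eps0.
  have e4 : 0 < eps / 4 by rewrite divr_gt0.
  have : (fun t : R => P (i :: s) (x + t *: e i)) t @[t --> (0:R)] --> P (i :: s) x.
    have : (fun t : R => x + t *: e i) t @[t --> (0:R)] --> x + 0 *: e i.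
      exact: (cvgD (cvg_cst _) (cvgZr_tmp cvg_id)).
    rewrite scale0r addr0 => cx.
    exact: (cvg_comp _ _ cx (cP (i :: s) x)).
  move/cvgrPdist_le => /(_ _ e4) /nbhs_ballP[del /= del0 Hdel].
  exists del => //= h; rewrite /ball_/= sub0r normrN => hdel h0.
  have hq m : (forall y, `|pderiv (i :: s) (U m) y - P (i :: s) y| <= eps / 4) ->
      `|P (i :: s) x - h^-1 * (pderiv s (U m) (x + h *: e i) - pderiv s (U m) x)|
      <= eps / 2.
    move=> Hm.
    have [xi xih ->] := line_MVT x h (fun y => (sU m s).2 i y).
    rewrite mulrCA mulVf// mulr1.
    have := Hm (x + xi *: e i).
    have /Hdel : ball (0:R) del xi by rewrite /ball/= sub0r normrN (le_lt_trans xih).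
    rewrite /= !ler_distl; lra.
  have h_gt0 : 0 < `|h| by rewrite normr_gt0.
  have e8 : 0 < eps / 4 * `|h| by rewrite mulr_gt0.
  (* Here [m] may depend on [h]: replacing [pderiv s (U m)] by [P s] must cost at most eps/4 |h|, so
     as to survive the division by [h]. *)
  have [m1 H1] := UP (i :: s) _ e4; have [m2 H2] := UP s _ e8.
  pose m := maxn m1 m2.
  have := hq m (fun y => H1 m y (leq_maxl _ _)).
  have Ha := H2 m (x + h *: e i) (leq_maxr _ _); have Hb := H2 m x (leq_maxr _ _).
  rewrite [h *: _ + x]addrC.
  set a := pderiv s (U m) _ in Ha *; set b := pderiv s (U m) _ in Hb *.
  set a' := P s _ in Ha *; set b' := P s x in Hb *.
  have -> : h^-1 *: (a' - b') = h^-1 * (a - b) - h^-1 * (a - a') + h^-1 * (b - b').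
    by rewrite /GRing.scale/=; ring.
  have Hc c c' : `|c - c'| <= eps / 4 * `|h| -> `|h^-1 * (c - c')| <= eps / 4.
    by move=> cc; rewrite normrM normfV mulrC ler_pdivrMr.
  move: (Hc _ _ Ha) (Hc _ _ Hb); rewrite !ler_norml; lra.
by split; [apply/cvg_ex; exists (P (i :: s) x)|exact: cvg_lim].
Qed.

End smooth_real.

(** * Taylor's formula in several variables *)

Section taylor.
Context {R : realType} {d : nat}.
Local Notation Rd := 'rV[R]_d.
Local Notation e i := (delta_mx 0 i : Rd).
Implicit Types (u v : Rd -> R) (s : seq 'I_d) (x y h : Rd).

Definition monomial (al : {ffun 'I_d -> nat}) h : R := \prod_i h 0 i ^+ al i.

(** Polynomials of degree below [L], built as sums of monomials because this is the form that
    vanishing moments annihilate term by term. Uniqueness of the coefficients never matters. *)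
Inductive poly_lt (L : nat) : (Rd -> R) -> Prop :=
| poly_lt0 : poly_lt L (fun=> 0)
| poly_ltS (c : R) (al : {ffun 'I_d -> nat}) p : (\sum_i al i < L)%N -> poly_lt L p ->
    poly_lt L (fun h => c * monomial al h + p h).

Lemma poly_ltD L p q : poly_lt L p -> poly_lt L q -> poly_lt L (fun h => p h + q h).
Proof.
move=> + Lq; elim=> [|c al {}p al_lt _ IH].
  by rewrite (_ : (fun h => _) = q)//; apply/funext => h; rewrite add0r.
rewrite (_ : (fun h => _) = (fun h => c * monomial al h + (p h + q h))).
  exact: poly_ltS.
by apply/funext => h; rewrite addrA.
Qed.

Lemma poly_ltM L (k : 'I_d) m (c : R) p : (m <= L)%N -> poly_lt (L - m) p ->
  poly_lt L (fun h => c * h 0 k ^+ m * p h).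
Proof.
move=> mL; elim=> [|c' al {}p al_lt _ IH].
  by rewrite (_ : (fun h => _) = (fun=> 0)); [exact: poly_lt0|
     apply/funext => h; rewrite mulr0].
pose al' := [ffun i => (al i + (i == k) * m)%N].
rewrite (_ : (fun h => _) =
  (fun h => (c * c') * monomial al' h + c * h 0 k ^+ m * p h)).
  apply: poly_ltS => //.
  under eq_bigr do rewrite ffunE.
  rewrite big_split/= [X in (_ + X)%N](bigD1 k)//= eqxx mul1n.
  rewrite [X in (_ + (_ + X))%N]big1 => [|i /negbTE->]; last by rewrite mul0n.
  by rewrite addn0 addnC -ltn_subRL.
apply/funext => h; rewrite mulrDr; congr (_ + _).
have -> : monomial al' h = monomial al h * h 0 k ^+ m.
  rewrite /monomial (bigD1 k)//= [in RHS](bigD1 k)//= ffunE eqxx mul1n exprD.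
  rewrite -!mulrA; congr (_ * _); rewrite mulrC; congr (_ * _).
  by apply: eq_bigr => i /negbTE ik; rewrite ffunE ik mul0n addn0.
ring.
Qed.

Lemma iter_derive_pderiv (k : 'I_d) m u :
  iter m (fun w => 'D_(e k) w) u = pderiv (nseq m k) u.
Proof. by elim: m => //= m ->. Qed.

Definition smooth_bounded u :=
  smooth_real u /\ forall s, exists B, forall x, `|pderiv s u x| <= B.

Lemma smooth_bounded_pderiv s u : smooth_bounded u -> smooth_bounded (pderiv s u).
Proof.
move=> [su uB]; split; first exact: smooth_pderiv.
by move=> s'; rewrite -pderiv_cat.
Qed.

(** Induction on the number of active coordinates: the last one is expanded by [taylor_line] at the
    base point [x + head_part k h], and its m-th coefficient, a derivative of u at that point, is
    expanded by induction to order L - m. In the constant, [B] is the remainder of the first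
    expansion and the [C m] are those of the coefficients; it does not depend on x. *)
Lemma taylor_head k L u : (k <= d)%N -> smooth_bounded u ->
  exists C : R, forall x, exists2 p, poly_lt L p &
    forall h, `|u (x + head_part k h) - p h| <= C * `|h| ^+ L.
Proof.
elim: k L u => [|k IH] L u kd [su uB].
  case: L => [|L].
    have [B HB] := uB [::]; exists B => x; exists (fun=> 0); first exact: poly_lt0.
    by move=> h; rewrite subr0 mulr1; exact: HB.
  exists 0 => x; exists (fun h => u x * monomial [ffun=> 0%N] h + 0).
    apply: poly_ltS; last exact: poly_lt0.
    by rewrite big1// => i _; rewrite ffunE.
  move=> h; rewrite head_part0 addr0 mul0r addr0.
  rewrite /monomial big1 => [|i _]; last by rewrite ffunE expr0.
  by rewrite mulr1 subrr normr0.
pose k' := Ordinal kd.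
have [B HB] := uB (nseq L k').
have /choice[C HC] : forall m, exists C : R, forall x,
    exists2 p, poly_lt (L - m) p & forall h,
     `|pderiv (nseq m k') u (x + head_part k h) - p h| <= C * `|h| ^+ (L - m).
  by move=> m; apply: IH; [exact: ltnW|exact: smooth_bounded_pderiv].
exists (B + \sum_(m < L) `|C m|) => x.
have /choice[p Hp] : forall m, exists p, poly_lt (L - m) p /\ forall h,
     `|pderiv (nseq m k') u (x + head_part k h) - p h| <= C m * `|h| ^+ (L - m).
  by move=> m; have [p] := HC m x; exists p.
pose q n h := \sum_(m < n) ((m`!)%:R^-1 * h 0 k' ^+ m * p m h).
exists (q L).
  suff H n : (n <= L)%N -> poly_lt L (q n) by exact: H.
  elim: n => [|n IHn] nL.
    rewrite (_ : q _ = (fun=> 0)); first exact: poly_lt0.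
    by apply/funext => h; rewrite /q big_ord0.
  rewrite (_ : q n.+1 = (fun h => q n h + ((n`!)%:R^-1 * h 0 k' ^+ n * p n h))).
    apply: poly_ltD; first exact/IHn/ltnW.
    by apply: poly_ltM; [exact: ltnW|case: (Hp n)].
  by apply/funext => h; rewrite /q big_ord_recr.
move=> h; rewrite (head_partS k') addrA.
rewrite (le_trans (ler_distD
  ((taylor_poly L u (e k') (x + head_part k h)).[h 0 k']) _ _))// mulrDl lerD//.
  have hk : `|h 0 k'| ^+ L <= `|h| ^+ L by rewrite lerXn2r ?nnegrE//; exact: coord_le_norm.
  apply: le_trans (taylor_line _ _ _ _) _.
  - by move=> m y; rewrite iter_derive_pderiv; exact: (su _).2.
  - by move=> y; rewrite iter_derive_pderiv; exact: HB.
  by rewrite ler_wpM2l// (le_trans _ (HB 0)).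
rewrite horner_poly /q -sumrB (le_trans (ler_norm_sum _ _ _))// mulr_suml ler_sum// => m _.
have -> : iter m (fun w => 'D_(e k') w) u (x + head_part k h) / (m`!)%:R * h 0 k' ^+ m
    - (m`!)%:R^-1 * h 0 k' ^+ m * p m h = (m`!)%:R^-1 * (h 0 k' ^+ m *
     (pderiv (nseq m k') u (x + head_part k h) - p m h)).
  by rewrite iter_derive_pderiv; ring.
have f1 : `|(m`!)%:R^-1 : R| <= 1.
  by rewrite normfV normr_nat invf_le1 ?ltr0n ?fact_gt0// ler1n fact_gt0.
rewrite normrM (le_trans (ler_pM _ _ f1 (lexx _)))// mul1r.
rewrite normrM normrX.
apply: (@le_trans _ _ (`|h| ^+ m * (`|C m| * `|h| ^+ (L - m)))).
  apply: ler_pM; [by rewrite exprn_ge0|exact: normr_ge0| |].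
    by rewrite lerXn2r ?nnegrE//; exact: coord_le_norm.
  by rewrite (le_trans ((Hp m).2 h))// ler_wpM2r ?exprn_ge0// ler_norm.
by rewrite mulrCA -exprD subnKC// ltnW.
Qed.


Lemma taylor L u : smooth_bounded u ->
  exists C : R, forall x, exists2 p, poly_lt L p &
    forall h, `|u (x + h) - p h| <= C * `|h| ^+ L.
Proof.
move=> su; have [C HC] := taylor_head L (leqnn d) su; exists C => x.
have [p Lp Hp] := HC x; exists p => // h.
by have := Hp h; rewrite head_part_all.
Qed.

End taylor.

(** * Lebesgue measure on R^d *)

Section measurable_rV.
Context {R : realType} {d : nat}.
Local Notation Rd := 'rV[R]_d.
Local Notation leb := (@lebesgue_rV R d).

Lemma measurable_rV_box (A : 'I_d -> set R) : (forall i, measurable (A i)) ->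
  measurable [set x : Rd | forall i, A i (x 0 i)].
Proof.
move=> mA; rewrite (_ : mkset _ = \bigcap_i [set x : Rd | A i (x 0 i)]).
  apply: fin_bigcap_measurable => // i _.
  by rewrite -[X in measurable X]setTI; exact: measurable_coord.
by apply/seteqP; split=> x /= xA i; [move=> _|]; apply: xA.
Qed.

(** Second countability: U is the union of the countably many boxes with rational centre [q.1] and
    radius [q.2.+1%:R^-1] that it contains. A box whose centre is within one radius of x lies within
    two radii of x, whence the choice of [n]. *)
Lemma open_measurable_rV (U : set Rd) : open U -> measurable U.
Proof.
move=> oU.
pose B (q : 'rV[rat]_d * nat) : set Rd :=
  [set x | forall i, `]ratr (q.1 0 i) - q.2.+1%:R^-1, ratr (q.1 0 i) + q.2.+1%:R^-1[%classic (x 0 i)].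
pose F q : set Rd := if pselect (B q `<=` U) then B q else set0.
have -> : U = \bigcup_q F q.
  apply/seteqP; split=> [x Ux|x [q _]]; last first.
    by rewrite /F; case: pselect => // BU; exact: BU.
  have /nbhs_ballP[eps /= eps0 Beps] : nbhs x U by exact: open_nbhs_nbhs.
  have [n n_eps] : exists n : nat, 2 * n.+1%:R^-1 < eps.
    have e2 : 0 < eps / 2 by rewrite divr_gt0.
    have [n _ /(_ n (leqnn _))] := near_infty_natSinv_lt (PosNum e2).
    by exists n; rewrite mulrC -ltr_pdivlMr.
  have n0 : 0 < n.+1%:R^-1 :> R by rewrite invr_gt0.
  have /choice[q Hq] : forall i, exists q : rat, `|x 0 i - ratr q| < n.+1%:R^-1.
    move=> i.
    have /rat_in_itvoo[q] : x 0 i - n.+1%:R^-1 < x 0 i + n.+1%:R^-1.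
      by rewrite ltrBlDr -addrA ltrDl addr_gt0.
    by rewrite in_itv/= => xq; exists q; rewrite distrC ltr_distl.
  exists (\row_i q i, n) => //; rewrite /F; case: pselect => [_ i|].
    by rewrite /= in_itv/= mxE; move: (Hq i); rewrite ltr_distl.
  move=> []; move=> y Hy; apply: Beps; rewrite -ball_normE /=.
  apply: le_lt_trans n_eps; apply: norm_le_coord; first by rewrite mulr_ge0// ltW.
  move=> i; rewrite !mxE.
  have := Hy i; rewrite /= in_itv/= mxE; have := Hq i; rewrite ltr_distl ler_norml.
  by move: (n.+1%:R^-1) => a; lra.
apply: countable_bigcupT_measurable; first by apply: countableP.
move=> q; rewrite /F; case: pselect => [qU|qU]; last exact: measurable0.
apply: (measurable_rV_box (A := fun i => `]ratr (q.1 0 i) - q.2.+1%:R^-1,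
   ratr (q.1 0 i) + q.2.+1%:R^-1[%classic)) => i.
exact: measurable_itv.
Qed.

Lemma continuous_measurable_rV (f : Rd -> R) : continuous f -> measurable_fun setT f.
Proof.
move=> cf; apply: (measurability _ (RGenOInfty.measurableE R)).
move=> _ [_ [a ->] <-]; rewrite setTI; apply: open_measurable_rV.
by apply: open_comp => // x _; exact: cf.
Qed.

(** Half-open, so that it is the disjoint union of half-open grid cells without overlaps on the
    faces. *)
Definition rV_box (N : nat) : set Rd :=
  [set x | forall i, `[- N%:R, N%:R[%classic (x 0 i)].

Lemma measurable_rV_boxN N : measurable (rV_box N).
Proof.
apply: (measurable_rV_box (A := fun=> `[- N%:R, N%:R[%classic)) => i.
exact: measurable_itv.
Qed.

Lemma rV_box_lty N : (leb (rV_box N) < +oo)%E.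
Proof.
rewrite /rV_box (lebesgue_rV_box (A := fun=> `[- N%:R, N%:R[%classic)); last first.
  by move=> i; exact: measurable_itv.
rewrite ltey_eq; apply/orP; left; apply: (big_ind (fun x : \bar R => x \is a fin_num)) => //.
  by move=> x y; exact: fin_numM.
by move=> i _; rewrite lebesgue_measure_itv/=; case: ifP.
Qed.

Lemma rV_box_norm N (x : Rd) : rV_box N x -> `|x| <= N%:R.
Proof.
move=> Nx; apply: norm_le_coord => // i.
by have := Nx i; rewrite /= in_itv/= ler_norml; lra.
Qed.

Lemma norm_rV_box N (x : Rd) : `|x| < N%:R -> rV_box N x.
Proof.
move=> xN i; rewrite /= in_itv/=; have := le_lt_trans (coord_le_norm x i) xN.
by rewrite ltr_norml; lra.
Qed.

Definition box_vol N : R := fine (leb (rV_box N)).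

Lemma box_vol_ge0 N : 0 <= box_vol N.
Proof. exact: fine_ge0. Qed.

(** On each cell of a grid of mesh 1/(m+1) the integrand differs from its value at a corner by at
    most [del]. Weights and nodes are chosen before [H]; one family of nodes can therefore serve a
    function and all its derivatives simultaneously. *)
Lemma quadrature (N m : nat) : exists (I : finType) (c : I -> R) (z : I -> Rd),
  [/\ forall i, 0 <= c i, \sum_i c i = box_vol N, forall i, `|z i| <= N%:R &
   forall (H : Rd -> R) (del : R), measurable_fun setT H ->
     (forall x, N%:R <= `|x| -> H x = 0) ->
     (forall x y, `|x| <= N%:R -> `|y| <= N%:R -> `|x - y| <= m.+1%:R^-1 ->
        `|H x - H y| <= del) ->
     leb.-integrable setT (EFin \o H) /\
     `|\int[leb]_x H x - \sum_i c i * H (z i)| <= box_vol N * del].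
Proof.
(* Each axis of the box, of length 2N, is cut into 2N(m+1) intervals of length 1/(m+1); [cr] lists
   their left end points, and a cell is a choice of one interval per axis. *)
pose M := (2 * N * m.+1)%N; pose I := {ffun 'I_d -> 'I_M}.
have m0 : 0 < m.+1%:R :> R by [].
have m0i : 0 < m.+1%:R^-1 :> R by rewrite invr_gt0.
pose cr (k : nat) : R := k%:R / m.+1%:R - N%:R.
have crS k : cr k.+1 = cr k + m.+1%:R^-1 by rewrite /cr -natr1; ring.
pose A (g : I) : set Rd := [set x | forall i, `[cr (g i), cr (g i).+1[%classic (x 0 i)].
have mA g : measurable (A g).
  apply: (measurable_rV_box (A := fun i => `[cr (g i), cr (g i).+1[%classic)) => i.
  exact: measurable_itv.
pose z (g : I) : Rd := \row_i cr (g i).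
have Az g x : A g x -> `|x - z g| <= m.+1%:R^-1.
  move=> Ax; apply: norm_le_coord; first exact: ltW.
  move=> i; have := Ax i; rewrite /= in_itv/= crS !mxE ler_norml.
  by move: (m.+1%:R^-1) m0i => a; lra.
have crM : cr M = N%:R.
  by rewrite /cr /M !natrM mulfK ?pnatr_eq0//; ring.
have cr_ge k : - N%:R <= cr k by rewrite /cr lerDr divr_ge0.
have cr_mono k l : (k <= l)%N -> cr k <= cr l.
  by move=> kl; rewrite /cr lerD2r ler_pM2r// ler_nat.
have zN g : `|z g| <= N%:R.
  apply: norm_le_coord => // i; rewrite mxE ler_norml cr_ge/= -crM.
  exact/cr_mono/ltnW.
have tA : trivIset setT A.
  move=> g g' _ _ [x [Ax Ag'x]]; apply/ffunP => i; apply/val_inj/eqP.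
  have := Ax i; have := Ag'x i; rewrite /= !in_itv/= => /andP[a1 a2] /andP[b1 b2].
  have cr_lt k l : cr k < cr l -> (k < l)%N by rewrite ltNge; apply: contraNltn; exact: cr_mono.
  have := cr_lt _ _ (le_lt_trans a1 b2); have := cr_lt _ _ (le_lt_trans b1 a2).
  by rewrite !ltnS => ? ?; rewrite eqn_leq; apply/andP.
have AB : rV_box N = \big[setU/set0]_(g <- enum {: I}) A g.
  rewrite -bigcup_seq; apply/seteqP; split=> x.
    move=> Nx.
    have /choice[k Hk] : forall i, exists k : 'I_M, cr k <= x 0 i < cr k.+1.
      move=> i; pose t := (x 0 i + N%:R) * m.+1%:R.
      have := Nx i; rewrite /= in_itv/= => /andP[x1 x2].
      have t0 : 0 <= t by rewrite mulr_ge0// -lerBlDr sub0r.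
      have := truncn_itv t0; set k := Num.truncn t => /andP[k1 k2].
      have kM : (k < M)%N.
        rewrite -(ltr_nat R) (le_lt_trans k1)// /t /M !natrM ltr_pM2r//; lra.
      exists (Ordinal kM); rewrite /cr/= lerBlDr ler_pdivrMr// k1/=.
      by rewrite ltrBrDr ltr_pdivlMr.
    exists [ffun i => k i]; first by rewrite /= mem_enum.
    by move=> i; rewrite /= in_itv/= ffunE.
  move=> [g _ Ax] i; have := Ax i; rewrite /= !in_itv/= => /andP[x1 x2].
  rewrite (le_trans (cr_ge _) x1)/= (lt_le_trans x2)// -crM.
  exact: cr_mono.
have splitI (f : Rd -> R) : measurable_fun setT f ->
    (\int[leb]_(x in rV_box N) (f x)%:E = \sum_g \int[leb]_(x in A g) (f x)%:E)%E.
  move=> mf; rewrite AB integral_bigsetU_EFin ?enum_uniq//.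
  - by rewrite big_enum.
  - exact: sub_trivIset tA.
  - by apply/measurable_EFinP; exact: measurable_funTS.
have leA g : (leb (A g) < +oo)%E.
  apply: le_lt_trans (rV_box_lty N); apply: le_measure; rewrite ?inE//.
    exact: measurable_rV_boxN.
  by rewrite AB -bigcup_seq => x Ax; exists g => //=; rewrite mem_enum.
pose c g := fine (leb (A g)).
have cE g : leb (A g) = (c g)%:E by rewrite fineK// ge0_fin_numE.
have c_ge0 g : 0 <= c g by exact: fine_ge0.
have sumc : \sum_g c g = box_vol N.
  rewrite /box_vol -[leb (rV_box N)]mul1e -integral_cst; last exact: measurable_rV_boxN.
  rewrite (splitI (cst 1)); last by [].
  rewrite (eq_bigr (fun g => (c g)%:E)) ?sumEFin// => g _.
  by rewrite -cE -[RHS]mul1e -integral_cst.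
exists I, c, z; split => // H del mH H0 Hdel.
have HA g x : A g x -> `|H x - H (z g)| <= del.
  move=> Ax; apply: Hdel => //; last exact: Az.
  by apply: rV_box_norm; rewrite AB -bigcup_seq; exists g => //=; rewrite mem_enum.
have iA g : leb.-integrable (A g) (EFin \o H).
  apply: measurable_bounded_integrable => //; [exact: leA|exact: measurable_funTS|].
  exists (`|H (z g)| + del); split; first exact: num_real.
  move=> y Hy x Ax /=; apply: le_trans (ltW Hy); rewrite addrC -lerBlDr.
  exact: le_trans (lerB_dist _ _) (HA _ _ Ax).
have iE g : (\int[leb]_(x in A g) (H x)%:E)%E = (\int[leb]_(x in A g) H x)%:E.
  by rewrite fineK//; exact: integrable_fin_num.
(* A point outside the half-open box may have norm exactly N; this is why [H] is assumed to vanish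
   already for N <= |x|. *)
have HB : EFin \o H = (EFin \o H) \_ (rV_box N).
  apply/funext => x; rewrite patchE; case: ifPn => //= /negP xN.
  rewrite H0// leNgt; apply/negP => /norm_rV_box Nx; apply: xN.
  by rewrite inE.
have iD : leb.-integrable setT (EFin \o H).
  rewrite HB; apply/(integrable_mkcond _ (measurable_rV_boxN N)).
  apply/integrableP; split; first exact/measurable_EFinP/measurable_funTS.
  rewrite (splitI (fun x => `|H x|)); last exact: measurableT_comp.
  apply: lte_sum_pinfty => g _.
  by have /integrableP[_] := iA g.
split => //.
have -> : \int[leb]_x H x = \sum_g \int[leb]_(x in A g) H x.
  rewrite /Rintegral [X in fine X](_ : _ = (\int[leb]_(x in rV_box N) (H x)%:E)%E); last first.
    by rewrite [RHS]integral_mkcond -HB.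
  by rewrite splitI//; under eq_bigr do rewrite iE; rewrite sumEFin.
rewrite -sumrB (le_trans (ler_norm_sum _ _ _))// -sumc mulr_suml ler_sum// => g _.
have ic : leb.-integrable (A g) (EFin \o cst (H (z g))).
  by apply: measurable_bounded_integrable => //; [exact: leA|exact: bounded_cst].
have -> : c g * H (z g) = \int[leb]_(x in A g) H (z g).
  by rewrite Rintegral_cst// mulrC.
rewrite -RintegralB//.
have iB : leb.-integrable (A g) (EFin \o (fun x => H x - H (z g))).
  exact: (integrableB (mA g) (iA g) ic).
apply: (le_trans (le_normr_Rintegral _ iB)) => //.
rewrite mulrC -Rintegral_cst//; apply: le_Rintegral => //.
- exact: integrable_norm iB.
- by apply: measurable_bounded_integrable => //; [exact: leA|exact: bounded_cst].
- by move=> x; exact: HA.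
Qed.


End measurable_rV.

(** * Affine substitutions in integrals *)

Section affine.
Context {R : realType}.
Local Notation mu1 := (@lebesgue_measure R).

(** Uniqueness of Lebesgue measure: the push-forward scaled by |c| has the right value on half-open
    intervals. For c < 0 the preimage is closed on the other side, hence the two cases. *)
Lemma lebesgue_affine (c b : R) (A : set R) : c != 0 -> measurable A ->
  mu1 A = (`|c|%:E * mu1 ((fun a : R => c * a + b)%R @^-1` A))%E.
Proof.
move=> c0 mA.
have mphi : measurable_fun setT (fun a => c * a + b : measurableTypeR R).
  by apply: measurable_funD => //; apply: measurable_funM.
pose P : {measure set (measurableTypeR R) -> \bar R} :=
  measure_function_pushforward__canonical__measure_function_Measure mu1 mphi.
pose nu := mscale (NngNum (normr_ge0 c)) P.
rewrite (@lebesgue_measure_unique R nu)//.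
move=> X /ocitvP[->|[[x y] /= xy ->]]; first by rewrite !measure0.
rewrite /nu /mscale/= /pushforward lebesgue_measure_itv/= lte_fin xy.
have [c_lt0|c_gt0|] := ltgtP c 0; last by move/eqP; rewrite (negbTE c0).
  rewrite (_ : _ @^-1` _ = `[(y - b) / c, (x - b) / c[%classic); last first.
    apply/seteqP; split=> a; rewrite /= !in_itv/= ler_ndivrMr// ltr_ndivlMr//; lra.
  rewrite lebesgue_measure_itv/= lte_fin ltr_nM2r ?invr_lt0// ltrD2r xy -EFinB -EFinM.
  by congr _%:E; rewrite ler0_norm ?ltW//; field.
rewrite (_ : _ @^-1` _ = `](x - b) / c, (y - b) / c]%classic); last first.
  apply/seteqP; split=> a; rewrite /= !in_itv/= ltr_pdivrMr// ler_pdivlMr//; lra.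
rewrite lebesgue_measure_itv/= lte_fin ltr_pM2r ?invr_gt0// ltrD2r xy -EFinB -EFinM.
by congr _%:E; rewrite ger0_norm ?ltW//; field.
Qed.

Lemma integral_affine1 (c b : R) (f : R -> \bar R) : c != 0 ->
  measurable_fun setT f -> (forall x, 0 <= f x)%E ->
  (`|c|%:E * \int[mu1]_x f (c * x + b)%R = \int[mu1]_x f x)%E.
Proof.
move=> c0 mf f0.
have mphi : measurable_fun setT (fun a => c * a + b : measurableTypeR R).
  by apply: measurable_funD => //; apply: measurable_funM.
pose P : {measure set (measurableTypeR R) -> \bar R} :=
  measure_function_pushforward__canonical__measure_function_Measure mu1 mphi.
rewrite [RHS](eq_measure_integral (mscale (NngNum (normr_ge0 c)) P)); last first.
  by move=> A mA _; exact: lebesgue_affine.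
rewrite ge0_integral_mscale//=; congr (_ * _)%E.
by rewrite ge0_integral_pushforward.
Qed.

Lemma integral_rV_cons d (f : 'rV[R]_d.+1 -> \bar R) :
  measurable_fun setT f -> (forall x, 0 <= f x)%E ->
  (\int[lebesgue_rV d.+1]_x f x =
   \int[mu1]_a \int[lebesgue_rV d]_v f (rV_cons (a, v)))%E.
Proof.
move=> mf f0; rewrite /= /lebesgue_step.
rewrite ge0_integral_pushforward//; last exact: measurable_rV_cons.
rewrite preimage_setT fubini_tonelli1//; last by move=> x; exact: f0.
exact: (measurableT_comp mf (@measurable_rV_cons R d)).
Qed.

Lemma measurable_affine d (c : R) (b : 'rV[R]_d) :
  measurable_fun setT (fun x : 'rV[R]_d => c *: x + b).
Proof.
apply: measurable_fun_coordP => i; under eq_fun do rewrite !mxE.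
by apply: measurable_funD => //; apply: measurable_funM => //; exact: measurable_coord.
Qed.

(** Tonelli splits off the first coordinate, to which the one-dimensional substitution applies; each
    coordinate contributes one factor |c|. *)
Lemma integral_affine d (c : R) (b : 'rV[R]_d) (f : 'rV[R]_d -> \bar R) : c != 0 ->
  measurable_fun setT f -> (forall x, 0 <= f x)%E ->
  ((`|c| ^+ d)%:E * \int[lebesgue_rV d]_x f (c *: x + b)%R =
   \int[lebesgue_rV d]_x f x)%E.
Proof.
move=> c0; elim: d b f => [|d IH] b f mf f0.
  rewrite expr0 mul1e; congr integral; apply/funext => x; congr f.
  by apply/rowP => -[].
have mfa : measurable_fun setT (fun x : 'rV[R]_d.+1 => f (c *: x + b)).
  exact: (measurableT_comp mf (measurable_affine c b)).
rewrite !integral_rV_cons//.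
pose b' := (rV_uncons b).2; pose G a := (\int[lebesgue_rV d]_v f (rV_cons (a, v)))%E.
have mfc : measurable_fun setT (f \o @rV_cons R d).
  exact: (measurableT_comp mf (@measurable_rV_cons R d)).
have mG : measurable_fun setT G.
  have H := @measurable_fun_fubini_tonelli_F _ _ _ _ _ (lebesgue_rV d) _ mfc (fun p => f0 _). exact: H.
have G0 a : (0 <= G a)%E by exact: integral_ge0.
have EG a : ((`|c| ^+ d)%:E * \int[lebesgue_rV d]_v f (c *: rV_cons (a, v) + b)%R)%E
    = G (c * a + b 0 0).
  have mfa' a' : measurable_fun setT (fun v => f (rV_cons (a', v))).
    have H := measurableT_comp mfc (pair1_measurable (a' : measurableTypeR R)); exact: H.
  rewrite /G -(IH b' _ (mfa' _))//.
  congr (_ * _)%E; apply: eq_integral => v _; congr f.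
  apply/rowP => i; rewrite [LHS]mxE [X in X + _ = _]mxE.
  case: (unliftP ord0 i) => [j|] ->; first by rewrite !rV_consES !mxE.
  by rewrite (rV_consE0 (a, v)) rV_consE0.
rewrite -/(G _) -(integral_affine1 (b 0 0) c0 mG G0).
rewrite exprS EFinM -muleA; congr (_ * _)%E.
rewrite -ge0_integralZl//; last 2 first.
- have := @measurable_fun_fubini_tonelli_F _ _ _ _ _ (lebesgue_rV d) _
    (measurableT_comp mfa (@measurable_rV_cons R d)) (fun p => f0 _).
  exact.
- by move=> a _; apply: integral_ge0.
by apply: eq_integral => a _; exact: EG.
Qed.

Lemma Rintegral_affine d (c : R) (b : 'rV[R]_d) (f : 'rV[R]_d -> R) : c != 0 ->
  measurable_fun setT f ->
  `|c| ^+ d * \int[lebesgue_rV d]_x f (c *: x + b) = \int[lebesgue_rV d]_x f x.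
Proof.
move=> c0 mf; pose g x := f (c *: x + b).
have k0 : 0 < `|c| ^+ d by rewrite exprn_gt0// normr_gt0.
have mfE : measurable_fun setT (EFin \o f) by exact/measurable_EFinP.
have pE : (\int[lebesgue_rV d]_x (EFin \o f)^\+ x =
    (`|c| ^+ d)%:E * \int[lebesgue_rV d]_x (EFin \o g)^\+ x)%E.
  rewrite -(integral_affine b c0 (measurable_funepos mfE) (@funepos_ge0 _ _ _)).
  by congr (_ * _)%E; apply: eq_integral => x _; rewrite !funeposE.
have nE : (\int[lebesgue_rV d]_x (EFin \o f)^\- x =
    (`|c| ^+ d)%:E * \int[lebesgue_rV d]_x (EFin \o g)^\- x)%E.
  rewrite -(integral_affine b c0 (measurable_funeneg mfE) (@funeneg_ge0 _ _ _)).
  by congr (_ * _)%E; apply: eq_integral => x _; rewrite !funenegE.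
rewrite -/(Rintegral _ _ g) /Rintegral [X in _ * fine X]integralE [in RHS]integralE.
rewrite pE nE.
move: (\int[lebesgue_rV d]_x _^\+ x)%E (\int[lebesgue_rV d]_x _^\- x)%E => P N.
have ky : ((`|c| ^+ d)%:E * +oo = +oo)%E by rewrite gt0_muley// lte_fin.
have kNy : ((`|c| ^+ d)%:E * -oo = -oo)%E by rewrite gt0_muleNy// lte_fin.
(* If the positive or the negative part has infinite integral, both sides are the default value 0 of
   [fine]; the identity thus covers non-integrable functions. *)
by move: P N => [p| |] [q| |]; rewrite ?ky ?kNy //= ?mulr0// mulrBr.
Qed.

End affine.

(** * Integrals of complex functions *)

Section complex_functions.
Context {R : realType} {d : nat}.
Local Notation Rd := 'rV[R]_d.
Local Notation C := R[i].
Local Notation leb := (@lebesgue_rV R d).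
Local Notation normc := Normc.normc.
Local Notation Re := complex.Re.
Local Notation Im := complex.Im.
Implicit Types (f g phi psi : Rd -> C) (a z : C) (x y : Rd) (s : seq 'I_d).

Lemma complex_eq z z' : Re z = Re z' -> Im z = Im z' -> z = z'.
Proof. by case: z z' => [p q] [p' q'] /= -> ->. Qed.

Lemma ReD z z' : Re (z + z') = Re z + Re z'. Proof. by case: z z' => [? ?] [? ?]. Qed.
Lemma ImD z z' : Im (z + z') = Im z + Im z'. Proof. by case: z z' => [? ?] [? ?]. Qed.
Lemma ReN z : Re (- z) = - Re z. Proof. by case: z. Qed.
Lemma ImN z : Im (- z) = - Im z. Proof. by case: z. Qed.
Lemma ReM z z' : Re (z * z') = Re z * Re z' - Im z * Im z'.
Proof. by case: z z' => [? ?] [? ?]. Qed.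
Lemma ImM z z' : Im (z * z') = Re z * Im z' + Im z * Re z'.
Proof. by case: z z' => [? ?] [? ?]. Qed.

Lemma ReMr (r : R) z : Re (r%:C * z) = r * Re z.
Proof. by rewrite ReM mul0r subr0. Qed.
Lemma ImMr (r : R) z : Im (r%:C * z) = r * Im z.
Proof. by rewrite ImM mul0r addr0. Qed.

Lemma Re_sum (I : Type) (r : seq I) (F : I -> C) :
  Re (\sum_(i <- r) F i) = \sum_(i <- r) Re (F i).
Proof. by elim: r => [|i r IH]; rewrite ?big_nil ?big_cons// ReD IH. Qed.

Lemma Im_sum (I : Type) (r : seq I) (F : I -> C) :
  Im (\sum_(i <- r) F i) = \sum_(i <- r) Im (F i).
Proof. by elim: r => [|i r IH]; rewrite ?big_nil ?big_cons// ImD IH. Qed.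

Lemma normc_ge0 z : 0 <= normc z.
Proof. by case: z => p q; exact: sqrtr_ge0. Qed.

Lemma Re_le_normc z : `|Re z| <= normc z.
Proof. by case: z => p q /=; rewrite -sqrtr_sqr ler_wsqrtr// lerDl sqr_ge0. Qed.

Lemma Im_le_normc z : `|Im z| <= normc z.
Proof. by case: z => p q /=; rewrite -sqrtr_sqr ler_wsqrtr// lerDr sqr_ge0. Qed.

Lemma normcR (r : R) : normc r%:C = `|r|.
Proof. by rewrite /= expr0n/= addr0 sqrtr_sqr. Qed.

Lemma normc_le z : normc z <= `|Re z| + `|Im z|.
Proof.
rewrite {1}[z]complexE (le_trans (le_normcD _ _))// Normc.normcM !normcR.
have -> : normc ('i : C) = 1 by rewrite /= expr0n expr1n add0r sqrtr1.
by rewrite mul1r.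
Qed.

Lemma normc_distD z1 z2 z3 : normc (z1 - z3) <= normc (z1 - z2) + normc (z2 - z3).
Proof. by rewrite -[z1 - z3](subrKA z2) le_normcD. Qed.

Lemma normc_sum (I : Type) (r : seq I) (F : I -> C) :
  normc (\sum_(i <- r) F i) <= \sum_(i <- r) normc (F i).
Proof.
elim: r => [|i r IH]; first by rewrite !big_nil Normc.normc0.
by rewrite !big_cons (le_trans (le_normcD _ _))// lerD2l.
Qed.

Definition Cintegrable f :=
  leb.-integrable setT (EFin \o (fun x => Re (f x))) /\
  leb.-integrable setT (EFin \o (fun x => Im (f x))).

Lemma Cintegral_linear a f g : Cintegrable f -> Cintegrable g ->
  Cintegrable (fun x => a * f x + g x) /\
  Cintegral (fun x => a * f x + g x) = a * Cintegral f + Cintegral g.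
Proof.
move=> [fr fi] [gr gi].
have Z (u : Rd -> R) c : leb.-integrable setT (EFin \o u) ->
    leb.-integrable setT (EFin \o (fun x => c * u x)).
  by move=> iu; have := integrableZl measurableT c iu.
have A (u v : Rd -> R) : leb.-integrable setT (EFin \o u) ->
    leb.-integrable setT (EFin \o v) -> leb.-integrable setT (EFin \o (fun x => u x + v x)).
  by move=> iu iv; have := integrableD measurableT iu iv.
have B (u v : Rd -> R) : leb.-integrable setT (EFin \o u) ->
    leb.-integrable setT (EFin \o v) -> leb.-integrable setT (EFin \o (fun x => u x - v x)).
  by move=> iu iv; have := integrableB measurableT iu iv.
have ER : (fun x => Re (a * f x + g x)) =
   (fun x => Re a * Re (f x) - Im a * Im (f x) + Re (g x)).
  by apply/funext => x; rewrite ReD ReM.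
have EI : (fun x => Im (a * f x + g x)) =
   (fun x => Re a * Im (f x) + Im a * Re (f x) + Im (g x)).
  by apply/funext => x; rewrite ImD ImM.
have i1 := B _ _ (Z _ (Re a) fr) (Z _ (Im a) fi).
have i2 := A _ _ (Z _ (Re a) fi) (Z _ (Im a) fr).
split; first by split; rewrite ?ER ?EI; exact: A.
apply: complex_eq; rewrite ?ReD ?ReM ?ImD ?ImM/= ?ER ?EI.
  by rewrite RintegralD// RintegralB ?RintegralZl//; exact: Z.
by rewrite RintegralD// RintegralD ?RintegralZl//; exact: Z.
Qed.

Lemma Cquadrature (N m : nat) : exists S : seq (R * Rd),
  [/\ forall p, p \in S -> 0 <= p.1 /\ `|p.2| <= N%:R,
      \sum_(p <- S) p.1 = box_vol (R := R) (d := d) N &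
   forall f (del : R), Cmeasurable f -> (forall x, N%:R <= `|x| -> f x = 0) ->
     (forall x y, `|x| <= N%:R -> `|y| <= N%:R -> `|x - y| <= m.+1%:R^-1 ->
        normc (f x - f y) <= del) ->
     Cintegrable f /\
     normc (Cintegral f - \sum_(p <- S) p.1%:C * f p.2)
       <= 2 * box_vol (R := R) (d := d) N * del].
Proof.
have [I [c [z [c0 sumc zN Q]]]] := @quadrature R d N m.
have ES (V : nmodType) (G : R * Rd -> V) :
    \sum_(p <- [seq (c i, z i) | i <- enum I]) G p = \sum_i G (c i, z i).
  by rewrite big_map big_enum.
exists [seq (c i, z i) | i <- enum I]; split.
- by move=> _ /mapP[i _ ->] /=; split.
- by rewrite ES.
move=> f del [mr mi] f0 fdel.
have [||ir qr] := Q (fun x => Re (f x)) del mr.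
- by move=> x /f0 ->.
- by move=> x y xN yN xy; rewrite -ReN -ReD (le_trans (Re_le_normc _))// fdel.
have [||ii qi] := Q (fun x => Im (f x)) del mi.
- by move=> x /f0 ->.
- by move=> x y xN yN xy; rewrite -ImN -ImD (le_trans (Im_le_normc _))// fdel.
split=> //; rewrite (le_trans (normc_le _))// -mulrA mulr_natl mulr2n.
rewrite ReD ReN ImD ImN Re_sum Im_sum !ES.
rewrite (eq_bigr (fun i => c i * Re (f (z i)))) => [|i _]; last exact: ReMr.
rewrite [X in _ + `|_ - X|](eq_bigr (fun i => c i * Im (f (z i)))) => [|i _].
  exact: lerD.
exact: ImMr.
Qed.

End complex_functions.

(** * Locally Lipschitz functions and Riemann sums of convolutions *)

Section lipschitz.
Context {R : realType} {d : nat}.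
Local Notation Rd := 'rV[R]_d.
Local Notation C := R[i].
Local Notation normc := Normc.normc.
Local Notation Re := complex.Re.
Local Notation Im := complex.Im.
Implicit Types (f g phi psi : Rd -> C) (a z : C) (x y : Rd) (s : seq 'I_d).

(* Local Lipschitz functions contain the test functions and the regularisations
   f * phi, and their Riemann sums converge at a rate, so that no other notion of
   regularity is needed for the integrals below. *)
Definition lip_on (X G l : R) g := [/\ 0 <= G, 0 <= l,
  forall x, `|x| <= X -> normc (g x) <= G &
  forall x y, `|x| <= X -> `|y| <= X -> normc (g x - g y) <= l * `|x - y|].

Definition loc_lip g := forall X, exists G l, lip_on X G l g.

(** Replaces supports in a compact set: every compact set lies in such a ball, and integer radii
    simply add under convolution. *)
Definition csupp (N : nat) g := forall x, N%:R < `|x| -> g x = 0.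

Lemma lip_on_mul X G G' l l' f g : lip_on X G l f -> lip_on X G' l' g ->
  lip_on X (G * G') (G * l' + l * G') (fun x => f x * g x).
Proof.
move=> [G0 l0 fG fl] [G'0 l'0 gG gl]; split.
- exact: mulr_ge0.
- by rewrite addr_ge0// mulr_ge0.
- by move=> x xX; rewrite Normc.normcM ler_pM ?normc_ge0 ?fG ?gG.
move=> x y xX yX; rewrite (le_trans (normc_distD _ (f x * g y) _))//.
rewrite -mulrBr -mulrBl !Normc.normcM mulrDl.
rewrite -mulrA [l * G' * _]mulrAC lerD// ler_pM ?normc_ge0 ?fG ?gG ?fl ?gl//.
Qed.

Lemma lip_on_affine X G l (c : R) (b : Rd) g : lip_on (`|c| * X + `|b|) G l g ->
  lip_on X G (l * `|c|) (fun x => g (c *: x + b)).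
Proof.
move=> [G0 l0 gG gl].
have H x : `|x| <= X -> `|c *: x + b| <= `|c| * X + `|b|.
  by move=> xX; rewrite (le_trans (ler_normD _ _))// lerD2r normrZ ler_wpM2l.
split=> //; first by rewrite mulr_ge0.
  by move=> x /H; exact: gG.
move=> x y /H xX /H yX; rewrite (le_trans (gl _ _ xX yX))//.
by rewrite opprD addrACA subrr addr0 -scalerBr normrZ mulrA.
Qed.

Lemma lip_on_lin X G G' l l' a f g : lip_on X G l f -> lip_on X G' l' g ->
  lip_on X (normc a * G + G') (normc a * l + l') (fun x => a * f x + g x).
Proof.
move=> [G0 l0 fG fl] [G'0 l'0 gG gl]; split.
- by rewrite addr_ge0// mulr_ge0// normc_ge0.
- by rewrite addr_ge0// mulr_ge0// normc_ge0.
- move=> x xX; rewrite (le_trans (le_normcD _ _))// Normc.normcM.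
  by rewrite lerD ?gG// ler_wpM2l ?normc_ge0 ?fG.
move=> x y xX yX.
have -> : a * f x + g x - (a * f y + g y) = a * (f x - f y) + (g x - g y) by ring.
rewrite (le_trans (le_normcD _ _))// Normc.normcM mulrDl -mulrA.
by rewrite lerD ?gl// ler_wpM2l ?normc_ge0 ?fl.
Qed.

Lemma loc_lip_mul f g : loc_lip f -> loc_lip g -> loc_lip (fun x => f x * g x).
Proof.
move=> Lf Lg X; have [G [l Hf]] := Lf X; have [G' [l' Hg]] := Lg X.
by do 2 eexists; exact: lip_on_mul Hf Hg.
Qed.

Lemma loc_lip_lin a f g : loc_lip f -> loc_lip g -> loc_lip (fun x => a * f x + g x).
Proof.
move=> Lf Lg X; have [G [l Hf]] := Lf X; have [G' [l' Hg]] := Lg X.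
by do 2 eexists; exact: lip_on_lin Hf Hg.
Qed.

Lemma loc_lip_affine (c : R) (b : Rd) g : loc_lip g ->
  loc_lip (fun x => g (c *: x + b)).
Proof.
move=> Lg X; have [G [l Hg]] := Lg (`|c| * X + `|b|).
by do 2 eexists; exact: lip_on_affine Hg.
Qed.

Lemma reflectE (T : Type) x (u : Rd -> T) :
  (fun y => u (x - y)) = (fun y => u (-1 *: y + x)).
Proof. by apply/funext => y; rewrite scaleN1r addrC. Qed.

Lemma loc_lip_reflect x g : loc_lip g -> loc_lip (fun y => g (x - y)).
Proof. by rewrite reflectE; exact: loc_lip_affine. Qed.

Lemma loc_lip_cst z : loc_lip (fun=> z).
Proof.
move=> X; exists (normc z), 0; split=> //; first exact: normc_ge0.
by move=> x y _ _; rewrite subrr Normc.normc0 mul0r.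
Qed.

Lemma loc_lip_continuous g : loc_lip g ->
  continuous (fun x => Re (g x)) /\ continuous (fun x => Im (g x)).
Proof.
move=> Lg.
have main (p : C -> R) : (forall z z', `|p z - p z'| <= normc (z - z')) ->
    continuous (fun x => p (g x)).
  move=> Hp x; have [G [l [_ l0 _ gl]]] := Lg (`|x| + 1).
  apply/(@cvgrPdist_le _ _ _ (nbhs x) _) => /= eps eps0.
  have l1 : 0 < l + 1 by rewrite ltr_wpDl.
  pose e := Num.min 1 (eps / (l + 1)).
  have e0 : 0 < e by rewrite lt_min ltr01 divr_gt0.
  apply/nbhs_ballP; exists e => //= y; rewrite -ball_normE /= lt_min => /andP[xy1 xy2].
  have yX : `|y| <= `|x| + 1.
    rewrite -[y](subrK x) (le_trans (ler_normD _ _))// addrC lerD2l distrC.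
    exact: ltW.
  rewrite (le_trans (Hp _ _))// (le_trans (gl _ _ _ yX)) ?lerDl//.
  move: xy2; rewrite ltr_pdivlMr// => /ltW; apply: le_trans.
  by rewrite mulrC ler_wpM2l// lerDl.
by split; apply: main => z z'; rewrite -?ReN -?ImN -?ReD -?ImD;
  [exact: Re_le_normc|exact: Im_le_normc].
Qed.

Lemma loc_lip_measurable g : loc_lip g -> Cmeasurable g.
Proof. by move=> /loc_lip_continuous[? ?]; split; exact: continuous_measurable_rV. Qed.

Local Notation vol N := (@box_vol R d N).

Lemma Cintegrable_csupp N f : loc_lip f -> csupp N f ->
  Cintegrable f /\ forall B, (forall x, normc (f x) <= B) ->
     normc (Cintegral f) <= 5 * vol N.+1 * B.
Proof.
(* Radius [N.+1], as [csupp N] allows nonzero values on |x| = N while the quadrature of radius N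
   does not. *)
move=> Lf Nf; have [S [S0 SV HS]] := @Cquadrature R d N.+1 0.
have f0 x : N.+1%:R <= `|x| -> f x = 0.
  by move=> Nx; apply: Nf; apply: lt_le_trans Nx; rewrite ltr_nat.
have mf := loc_lip_measurable Lf.
have main B : (forall x, normc (f x) <= B) ->
     Cintegrable f /\ normc (Cintegral f) <= 5 * vol N.+1 * B.
  (* A function bounded by B oscillates by at most 2B, so mesh 1 already gives an error of at most 4
     vol B; the Riemann sum adds vol B, whence the constant 5. *)
  move=> fB; have [|If Hf] := HS f (2 * B) mf f0.
    move=> x y _ _ _; rewrite (le_trans (le_normcD _ _))// normcN.
    by rewrite mulr_natl mulr2n lerD.
  split=> //; rewrite -[Cintegral f](subrK (\sum_(p <- S) p.1%:C * f p.2)).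
  rewrite (le_trans (le_normcD _ _))//.
  have H : normc (\sum_(p <- S) p.1%:C * f p.2) <= vol N.+1 * B.
    rewrite (le_trans (normc_sum _ _))// -SV mulr_suml big_seq [leRHS]big_seq.
    apply: ler_sum => p /S0[p0 _]; rewrite Normc.normcM normcR ger0_norm//.
    by rewrite ler_wpM2l.
  rewrite (le_trans (lerD Hf H))//; lra.
split; last by move=> B /main[].
have [G [l [G0 _ fG _]]] := Lf N%:R.
have [] // := main G.
by move=> x; have [/fG//|/Nf->] := leP `|x| N%:R; rewrite Normc.normc0.
Qed.

(** The integrand y |-> f(y) g(x - y) has Lipschitz constant A l + la G on the ball of radius N + 1,
    where x - y stays in the ball of radius X + N + 1. The nodes depend on neither f, g nor x. *)
Lemma conv_approx (N m : nat) : exists S : seq (R * Rd),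
  [/\ forall p, p \in S -> 0 <= p.1 /\ `|p.2| <= N.+1%:R,
      \sum_(p <- S) p.1 = vol N.+1 &
   forall f g A la X G l x, loc_lip f -> csupp N f -> lip_on N.+1%:R A la f ->
     loc_lip g -> lip_on (X + N.+1%:R) G l g -> `|x| <= X ->
     normc (convolution f g x - \sum_(p <- S) p.1%:C * (f p.2 * g (x - p.2)))
       <= 2 * vol N.+1 * ((A * l + la * G) / m.+1%:R)].
Proof.
have [S [S0 SV HS]] := @Cquadrature R d N.+1 m.
exists S; split=> // f g A la X G l x Lf Nf fA Lg gG xX.
have Lgx := loc_lip_reflect x Lg.
have gx : lip_on N.+1%:R G (l * `|-1|) (fun y => g (x - y)).
  rewrite reflectE; apply: lip_on_affine; rewrite normrN1 mul1r addrC.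
  have [G0 l0 H1 H2] := gG.
  have mono (z : Rd) : `|z| <= `|x| + N.+1%:R -> `|z| <= X + N.+1%:R.
    by move=> /le_trans; apply; rewrite lerD2r.
  by split=> // [z /mono|z z' /mono ? /mono]; [exact: H1|exact: H2].
rewrite normrN1 mulr1 in gx.
have [fg0 fgl fgB fgL] := lip_on_mul fA gx.
have [|||_ H] := HS (fun y => f y * g (x - y)) ((A * l + la * G) / m.+1%:R).
- exact/loc_lip_measurable/loc_lip_mul.
- by move=> y Ny; rewrite Nf ?mul0r// (lt_le_trans _ Ny)// ltr_nat.
- by move=> y y' yN y'N yy'; rewrite (le_trans (fgL _ _ yN y'N))// ler_wpM2l.
exact: H.
Qed.

Lemma Cintegral_affine (c : R) (b : Rd) f : c != 0 -> Cmeasurable f ->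
  (`|c| ^+ d)%:C * Cintegral (fun x => f (c *: x + b)) = Cintegral f.
Proof.
move=> c0 [mr mi]; apply: complex_eq.
  by rewrite ReMr/= (Rintegral_affine b c0 mr).
by rewrite ImMr/= (Rintegral_affine b c0 mi).
Qed.

(** The substitution y -> x - y, valid for the default values of divergent integrals as well. *)
Lemma convolutionC f g : loc_lip f -> loc_lip g -> convolution f g = convolution g f.
Proof.
move=> Lf Lg; apply/funext => x; rewrite /convolution.
have Lgx := loc_lip_reflect x Lf.
rewrite -[RHS](Cintegral_affine (c := -1) x) ?oppr_eq0 ?oner_eq0//; last first.
  exact/loc_lip_measurable/loc_lip_mul.
rewrite normrN1 expr1n mul1r; congr Cintegral; apply/funext => y.
by rewrite scaleN1r [- y + x]addrC subKr mulrC.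
Qed.

End lipschitz.

(** * Test functions and convolution *)

Section smooth_complex.
Context {R : realType} {d : nat}.
Local Notation Rd := 'rV[R]_d.
Local Notation C := R[i].
Local Notation normc := Normc.normc.
Local Notation Re := complex.Re.
Local Notation Im := complex.Im.
Implicit Types (f g phi psi : Rd -> C) (a z : C) (x y : Rd) (s : seq 'I_d).

Lemma Csmooth_linear a f g : smooth f -> smooth g ->
  smooth (fun x => a * f x + g x) /\
  forall s, Cpderiv s (fun x => a * f x + g x) =
            (fun x => a * Cpderiv s f x + Cpderiv s g x).
Proof.
move=> [fr fi] [gr gi].
have ER : (fun x => Re (a * f x + g x)) =
   (fun x => Re a * Re (f x) + (- Im a * Im (f x) + Re (g x))).
  by apply/funext => x; rewrite ReD ReM; ring.
have EI : (fun x => Im (a * f x + g x)) =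
   (fun x => Re a * Im (f x) + (Im a * Re (f x) + Im (g x))).
  by apply/funext => x; rewrite ImD ImM; ring.
have [s1 d1] := smooth_linear (- Im a) fi gr.
have [s2 d2] := smooth_linear (Im a) fr gi.
have [s3 d3] := smooth_linear (Re a) fr s1.
have [s4 d4] := smooth_linear (Re a) fi s2.
split=> [|s]; first by split; rewrite ?ER ?EI.
apply/funext => x; rewrite /Cpderiv ER EI d3 d1 d4 d2.
by apply: complex_eq; rewrite ?ReD ?ReM ?ImD ?ImM/=; ring.
Qed.

Lemma Csmooth_affine (c : R) (b : Rd) f : smooth f ->
  smooth (fun x => f (c *: x + b)) /\
  forall s, Cpderiv s (fun x => f (c *: x + b)) =
            (fun x => (c ^+ size s)%:C * Cpderiv s f (c *: x + b)).
Proof.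
move=> [fr fi]; have [s1 d1] := smooth_affine c b fr; have [s2 d2] := smooth_affine c b fi.
split=> // s; apply/funext => x; rewrite /Cpderiv d1 d2.
by apply: complex_eq; rewrite ?ReMr ?ImMr.
Qed.

Lemma Cpderiv_nil f : Cpderiv [::] f = f.
Proof. by apply/funext => x; exact: complex_eq. Qed.

Lemma Csmooth0 : smooth (fun _ : Rd => 0 : C) /\
  forall s, Cpderiv s (fun _ : Rd => 0 : C) = (fun=> 0).
Proof.
have [s0 d0] := @smooth0 R d; split=> // s; apply/funext => x.
by rewrite /Cpderiv !d0.
Qed.

Lemma Csmooth_scale a f : smooth f ->
  smooth (fun x => a * f x) /\
  forall s, Cpderiv s (fun x => a * f x) = (fun x => a * Cpderiv s f x).
Proof.
move=> sf; have [s1 d1] := Csmooth_linear a sf Csmooth0.1.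
have E : (fun x => a * f x + 0) = (fun x => a * f x) by apply/funext => x; rewrite addr0.
rewrite E in s1 d1; split=> // s; rewrite d1 Csmooth0.2.
by apply/funext => x; rewrite addr0.
Qed.

Lemma Csmooth_sum (I : Type) (r : seq I) (c : I -> C) (F : I -> Rd -> C) :
  (forall i, smooth (F i)) ->
  smooth (fun x => \sum_(i <- r) c i * F i x) /\
  forall s, Cpderiv s (fun x => \sum_(i <- r) c i * F i x) =
            (fun x => \sum_(i <- r) c i * Cpderiv s (F i) x).
Proof.
move=> sF; elim: r => [|i r [IHs IHd]].
  have E (G : I -> Rd -> C) : (fun x => \sum_(i <- [::]) c i * G i x) = (fun=> 0).
    by apply/funext => x; rewrite big_nil.
  rewrite E; have [s0 d0] := Csmooth0; split=> // s.
  by rewrite d0 (E (fun i => Cpderiv s (F i))).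
have E (G : I -> Rd -> C) : (fun x => \sum_(j <- i :: r) c j * G j x) =
    (fun x => c i * G i x + \sum_(j <- r) c j * G j x).
  by apply/funext => x; rewrite big_cons.
have [s1 d1] := Csmooth_linear (c i) (sF i) IHs.
by rewrite E; split=> // s; rewrite d1 (E (fun i => Cpderiv s (F i))) IHd.
Qed.

Lemma Csmooth_pderiv s f : smooth f -> smooth (Cpderiv s f).
Proof. by move=> [fr fi]; split; exact: smooth_pderiv. Qed.

Lemma Csmooth_limit (U : nat -> Rd -> C) (P : seq 'I_d -> Rd -> C) :
  (forall m, smooth (U m)) ->
  (forall s (eps : R), 0 < eps -> exists m0, forall m x, (m0 <= m)%N ->
     normc (Cpderiv s (U m) x - P s x) <= eps) ->
  smooth (P [::]) /\ forall s, Cpderiv s (P [::]) = P s.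
Proof.
move=> sU UP.
have [||sr dr] := @smooth_limit R d (fun m x => Re (U m x)) (fun s x => Re (P s x)).
- by move=> m; case: (sU m).
- move=> s eps /(UP s)[m0 H]; exists m0 => m x /(H m x).
  by apply: le_trans; rewrite (le_trans _ (Re_le_normc _))// ReD ReN.
have [||si di] := @smooth_limit R d (fun m x => Im (U m x)) (fun s x => Im (P s x)).
- by move=> m; case: (sU m).
- move=> s eps /(UP s)[m0 H]; exists m0 => m x /(H m x).
  by apply: le_trans; rewrite (le_trans _ (Im_le_normc _))// ImD ImN.
split=> // s; apply/funext => x; rewrite /Cpderiv dr di.
exact: complex_eq.
Qed.

Lemma csupp_pderiv N s f : csupp N f -> csupp N (Cpderiv s f).
Proof.
move=> fN x xN; rewrite /Cpderiv.
have nr : supportedR N%:R (fun x => Re (f x)) by move=> y /fN ->.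
have ni : supportedR N%:R (fun x => Im (f x)) by move=> y /fN ->.
by rewrite (supported_pderiv s nr xN) (supported_pderiv s ni xN).
Qed.

Lemma test_lip N k f : smooth f -> csupp N f ->
  exists G l, forall s X, (size s <= k)%N -> lip_on X G l (Cpderiv s f).
Proof.
move=> [fr fi] fN.
have nr : supportedR N%:R (fun x => Re (f x)) by move=> y /fN ->.
have ni : supportedR N%:R (fun x => Im (f x)) by move=> y /fN ->.
(* One order more than [k]: the Lipschitz constant of a derivative is read off from the next
   derivatives. *)
have [B1 H1] := pderiv_bounded k.+1 fr nr; have [B2 H2] := pderiv_bounded k.+1 fi ni.
have B1_ge0 : 0 <= B1 by exact: le_trans (H1 [::] 0 _).
have B2_ge0 : 0 <= B2 by exact: le_trans (H2 [::] 0 _).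
exists (B1 + B2), (d%:R * B1 + d%:R * B2) => s X sk; split.
- by rewrite addr_ge0.
- by rewrite addr_ge0// mulr_ge0.
- move=> x _; rewrite (le_trans (normc_le _))// lerD ?H1 ?H2//; exact: leqW.
move=> x y _ _; rewrite (le_trans (normc_le _))// ReD ReN ImD ImN mulrDl lerD//=.
  apply: smooth_lipschitz; first exact: smooth_pderiv.
  by move=> i z; exact: (H1 (i :: s)).
apply: smooth_lipschitz; first exact: smooth_pderiv.
by move=> i z; exact: (H2 (i :: s)).
Qed.

Lemma test_loc_lip N f : smooth f -> csupp N f -> loc_lip f.
Proof.
move=> sf fN X; have [G [l H]] := test_lip 0 sf fN.
by exists G, l; have := H [::] X isT; rewrite Cpderiv_nil.
Qed.

Lemma csupp_test_fun N f : smooth f -> csupp N f ->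
  test_fun_on [set x | `|x| <= N%:R] f.
Proof.
move=> sf fN; split=> //; rewrite /supp.
have cB : closed [set x : Rd | `|x| <= N%:R].
  exact: compact_closed (@norm_hausdorff _ _) (@compact_ball R d N%:R).
have [/(_ cB) E _] := closure_id [set x : Rd | `|x| <= N%:R].
rewrite E; apply: closure_subset => x /= fx.
by rewrite leNgt; apply/negP => /fN fx0; rewrite fx0 eqxx in fx.
Qed.

Lemma compact_sub_ball (K : set Rd) : compact K ->
  exists N : nat, K `<=` [set x | `|x| <= N%:R].
Proof.
move=> /compact_bounded[M [Mr HM]]; exists (Num.bound `|M|) => x Kx.
exact: (HM _ (le_lt_trans (ler_norm M) (archi_boundP (normr_ge0 M))) x Kx).
Qed.

Lemma test_fun_on_csupp (K : set Rd) N f : K `<=` [set x | `|x| <= N%:R] ->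
  test_fun_on K f -> smooth f /\ csupp N f.
Proof.
move=> KN [sf fK]; split=> // x Nx; apply: contrapT => /eqP fx.
have /fK/KN /= : supp f x by exact: subset_closure.
by rewrite leNgt Nx.
Qed.

Lemma test_funP f : test_fun f <-> smooth f /\ exists N, csupp N f.
Proof.
split=> [[sf /[dup] cf /compact_sub_ball[N KN]]|[sf [N fN]]].
  split=> //; exists N.
  by have [] := @test_fun_on_csupp (supp f) N f KN (conj sf (fun x sx => sx)).
split=> //; have [_ sub] := csupp_test_fun sf fN.
have H := subclosed_compact (@closed_closure _ [set x | f x != 0]) (@compact_ball R d N%:R) sub.
exact: H.
Qed.

End smooth_complex.

(** * Convolution with a test function, and dilations *)

Section convolutions.
Context {R : realType} {d : nat}.
Local Notation Rd := 'rV[R]_d.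
Local Notation C := R[i].
Local Notation normc := Normc.normc.
Implicit Types (f g phi psi : Rd -> C) (a z : C) (x y : Rd) (s : seq 'I_d).
Local Notation vol N := (@box_vol R d N).

Lemma le_natinv_eq0 (K r : R) : 0 <= r -> (forall m : nat, r <= K / m.+1%:R) -> r = 0.
Proof.
move=> r0 H; apply/eqP; rewrite eq_le r0 andbT leNgt; apply/negP => r_gt0.
have := archi_boundP (ltW (divr_gt0 (lt_le_trans r_gt0 (H 0%N)) r_gt0)).
set m := Num.bound _; rewrite divr1 ltr_pdivrMr// => Km.
have := H m; rewrite ler_pdivlMr// leNgt mulrC (lt_le_trans Km)//.
by rewrite ler_pM2r// ler_nat.
Qed.

Lemma Cintegral0 : Cintegral (fun _ : Rd => 0 : C) = 0.
Proof. by apply: complex_eq => /=; rewrite Rintegral_cst// mul0r. Qed.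

Lemma csupp_convolution N M f g : csupp N f -> csupp M g -> csupp (N + M) (convolution f g).
Proof.
move=> fN gM x Nx; rewrite /convolution -[RHS]Cintegral0; congr Cintegral.
apply/funext => y; have [yN|/fN->] := leP `|y| N%:R; last by rewrite mul0r.
rewrite gM ?mulr0//; move: Nx; rewrite natrD => Nx.
have := ler_normD (x - y) y; rewrite subrK; lra.
Qed.

Lemma Csmooth_shift (b : Rd) f : smooth f -> smooth (fun x => f (x - b)) /\
  forall s, Cpderiv s (fun x => f (x - b)) = (fun x => Cpderiv s f (x - b)).
Proof.
move=> sf; have [s1 d1] := Csmooth_affine 1 (- b) sf.
have E (u : Rd -> C) : (fun x => u (1 *: x - b)) = (fun x => u (x - b)).
  by apply/funext => x; rewrite scale1r.
rewrite E in s1 d1; split=> // s; rewrite d1; apply/funext => x.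
by rewrite expr1n mul1r scale1r.
Qed.

Lemma Csmooth_reflect x f : smooth f -> smooth (fun y => f (x - y)) /\
  forall s, Cpderiv s (fun y => f (x - y)) =
    (fun y => ((-1) ^+ size s)%:C * Cpderiv s f (x - y)).
Proof.
move=> sf; have [s1 d1] := Csmooth_affine (-1) x sf.
rewrite reflectE; split=> // s; rewrite d1; apply/funext => y.
by rewrite scaleN1r addrC.
Qed.

Lemma normc_signM n z : normc (((-1) ^+ n)%:C * z) = normc z.
Proof. by rewrite Normc.normcM normcR normrX normrN1 expr1n mul1r. Qed.

Lemma csupp_reflect (N N' : nat) x f : csupp N f -> `|x| + N%:R <= N'%:R ->
  csupp N' (fun y => f (x - y)).
Proof.
move=> fN xN y Ny; apply: fN.
have := ler_normD (y - x) x; rewrite subrK distrC; lra.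
Qed.

(** A sequence of quadratures with mesh tending to 0, fixed once so that the same sums approximate a
    convolution, its derivatives and its image under a distribution. *)
Definition nodes N (S : nat -> seq (R * Rd)) := forall m,
  [/\ forall p, p \in S m -> 0 <= p.1 /\ `|p.2| <= N.+1%:R,
      \sum_(p <- S m) p.1 = vol N.+1 &
   forall f g A la X G l x, loc_lip f -> csupp N f -> lip_on N.+1%:R A la f ->
     loc_lip g -> lip_on (X + N.+1%:R) G l g -> `|x| <= X ->
     normc (convolution f g x - \sum_(p <- S m) p.1%:C * (f p.2 * g (x - p.2)))
       <= 2 * vol N.+1 * ((A * l + la * G) / m.+1%:R)].

Lemma nodes_exist N : exists S, nodes N S.
Proof. by have /choice[S HS] := @conv_approx R d N; exists S. Qed.

(** The Riemann sum of f * g, a finite combination of translates of [g]: smooth as soon as [g] is,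
    whatever the regularity of [f]. *)
Definition conv_sum (S : seq (R * Rd)) f g x :=
  \sum_(p <- S) (p.1%:C * f p.2) * g (x - p.2).

Lemma conv_sum_smooth S f g : smooth g -> smooth (conv_sum S f g) /\
  forall s, Cpderiv s (conv_sum S f g) = conv_sum S f (Cpderiv s g).
Proof.
move=> sg; rewrite /conv_sum.
have sh (p : R * Rd) := Csmooth_shift p.2 sg.
have [s1 d1] := Csmooth_sum S (fun p => p.1%:C * f p.2) (fun p => (sh p).1).
split=> // s; rewrite d1; apply/funext => x; apply: eq_bigr => p _.
by rewrite (sh p).2.
Qed.

Lemma csupp_conv_sum N M (S : seq (R * Rd)) f g :
  (forall p, p \in S -> 0 <= p.1 /\ `|p.2| <= N%:R) ->
  csupp M g -> csupp (N + M) (conv_sum S f g).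
Proof.
move=> SN gM x Nx; rewrite /conv_sum big_seq big1// => p /SN[_ pN].
rewrite gM ?mulr0//; move: Nx; rewrite natrD => Nx.
have := ler_normD (x - p.2) p.2; rewrite subrK; lra.
Qed.

(** [K] depends neither on x nor on the derivative s, because the constants of [test_lip] are
    global; the Riemann sums thus converge uniformly with all derivatives up to order [k]. *)
Lemma conv_sum_approx N M S f g : nodes N S -> loc_lip f -> csupp N f ->
  smooth g -> csupp M g -> forall k, exists2 K : R, 0 <= K &
  forall m s x, (size s <= k)%N ->
    normc (convolution f (Cpderiv s g) x - conv_sum (S m) f (Cpderiv s g) x) <= K / m.+1%:R.
Proof.
move=> HS Lf fN sg gM k; have [G [l Hg]] := test_lip k sg gM.
have [A [la fA]] := Lf N.+1%:R.
have [A0 la0 _ _] := fA; have [G0 l0 _ _] := Hg [::] 0 isT.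
have v0 : 0 <= vol N.+1 by exact: box_vol_ge0.
exists (2 * vol N.+1 * (A * l + la * G)).
  by rewrite !mulr_ge0// addr_ge0// mulr_ge0.
move=> m s x sk; have [_ _ H] := HS m.
have Lg : loc_lip (Cpderiv s g) by move=> X; exists G, l; exact: Hg.
rewrite /conv_sum.
have -> : \sum_(p <- S m) (p.1)%:C * f p.2 * Cpderiv s g (x - p.2) =
   \sum_(p <- S m) (p.1)%:C * (f p.2 * Cpderiv s g (x - p.2)).
  by apply: eq_bigr => p _; rewrite mulrA.
rewrite -mulrA; apply: (H f (Cpderiv s g) A la `|x| G l x) => //.
exact: Hg.
Qed.

(** The derivatives of the Riemann sums fall on [g] and converge uniformly, so [Csmooth_limit]
    applies. *)
Lemma convolution_smooth N M f g : loc_lip f -> csupp N f -> smooth g -> csupp M g ->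
  smooth (convolution f g) /\
  forall s, Cpderiv s (convolution f g) = convolution f (Cpderiv s g).
Proof.
move=> Lf fN sg gM; have [S HS] := nodes_exist N.
have := @Csmooth_limit R d (fun m => conv_sum (S m) f g)
  (fun s => convolution f (Cpderiv s g)).
rewrite Cpderiv_nil; apply.
  by move=> m; exact: (conv_sum_smooth _ _ sg).1.
move=> s eps eps0; have [K K0 HK] := conv_sum_approx HS Lf fN sg gM (size s).
exists (Num.bound (K / eps)) => m x Km.
rewrite (conv_sum_smooth _ _ sg).2 -normcN opprB (le_trans (HK m s x (leqnn _)))//.
rewrite ler_pdivrMr// mulrC -ler_pdivrMr// (le_trans (ltW (archi_boundP _)))//.
  by rewrite divr_ge0// ltW.
by rewrite ler_nat ltnW.
Qed.

Lemma CintegralZ N a f : loc_lip f -> csupp N f ->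
  Cintegral (fun x => a * f x) = a * Cintegral f.
Proof.
move=> Lf fN; have [If _] := Cintegrable_csupp Lf fN.
have [I0 _] := @Cintegrable_csupp R d 0 (fun=> 0) (@loc_lip_cst R d 0) (fun _ _ => erefl).
have [_] := Cintegral_linear a If I0; rewrite Cintegral0 addr0 => <-.
by congr Cintegral; apply/funext => x; rewrite addr0.
Qed.

Lemma real2X n : (2 ^+ n : C) = (2 ^+ n : R)%:C.
Proof. by rewrite rmorphXn/= rmorphMn. Qed.

Lemma norm_scale2 j x : `|x| <= `|(2 ^+ j : R) *: x|.
Proof. by rewrite normrZ normrX ger0_norm// ler_peMl// exprn_ege1// ler1n. Qed.

(** As 2^j >= 1, all dilations of a test function stay in one and the same D(K). Both directions of
    the theorem rely on this. *)
Lemma csupp_dilate N j f : csupp N f -> csupp N (dilate f j).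
Proof.
move=> fN x Nx; rewrite /dilate fN ?mulr0//.
exact: lt_le_trans Nx (norm_scale2 j x).
Qed.

Lemma loc_lip_dilate j f : loc_lip f -> loc_lip (dilate f j).
Proof.
move=> Lf; apply: loc_lip_mul; first exact: loc_lip_cst.
have := loc_lip_affine (2 ^+ j) 0 Lf.
by rewrite (_ : (fun x => _) = (fun x => f (2 ^+ j *: x)))//; apply/funext => x; rewrite addr0.
Qed.

Lemma Csmooth_dilate j f : smooth f -> smooth (dilate f j) /\
  forall s, Cpderiv s (dilate f j) = (fun x => (2 ^+ (j * size s)) * dilate (Cpderiv s f) j x).
Proof.
move=> sf; have [s1 d1] := Csmooth_affine (2 ^+ j) 0 sf.
have [s2 d2] := Csmooth_scale (2 ^+ (j * d)) s1.
have E (u : Rd -> C) : dilate u j = (fun x => 2 ^+ (j * d) * u (2 ^+ j *: x + 0)).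
  by apply/funext => x; rewrite addr0.
rewrite {1 2}E; split=> // s; rewrite d2 d1 E; apply/funext => x.
by rewrite -exprM -real2X mulrCA.
Qed.

Lemma Cintegral_dilate j f : Cmeasurable f ->
  2 ^+ (j * d) * Cintegral (fun x => f (2 ^+ j *: x)) = Cintegral f.
Proof.
move=> mf; have c0 : (2 ^+ j : R) != 0 by rewrite expf_neq0.
rewrite -(Cintegral_affine 0 c0 mf) normrX ger0_norm// -exprM real2X.
by congr (_ * Cintegral _); apply/funext => x; rewrite addr0.
Qed.

(** The substitution y -> 2^j y supplies the second factor 2^(jd). This is what turns the
    factorization of psi into one of psi_j through chi_j. *)
Lemma convolution_dilate N j f g : loc_lip f -> csupp N f -> loc_lip g ->
  dilate (convolution f g) j = convolution (dilate f j) (dilate g j).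
Proof.
move=> Lf fN Lg; apply/funext => x; rewrite {1}/dilate /convolution.
pose h y := f y * g (2 ^+ j *: x - y).
have Lh : loc_lip h by apply: loc_lip_mul => //; exact: loc_lip_reflect.
have hN : csupp N h by move=> y /fN fy; rewrite /h fy mul0r.
rewrite -(Cintegral_dilate j (loc_lip_measurable Lh)).
have Lh2 : loc_lip (fun y => h (2 ^+ j *: y)).
  have := loc_lip_affine (2 ^+ j) 0 Lh.
  by rewrite (_ : (fun x => _) = (fun x => h (2 ^+ j *: x)))//; apply/funext => y; rewrite addr0.
have h2N : csupp N (fun y => h (2 ^+ j *: y)).
  by move=> y Ny; apply: hN; exact: lt_le_trans Ny (norm_scale2 j y).
rewrite mulrA -(CintegralZ _ Lh2 h2N); congr Cintegral; apply/funext => y.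
by rewrite /dilate /h scalerBr; ring.
Qed.

End convolutions.

(** * Distributions *)

Section distributions.
Context {R : realType} {d : nat}.
Local Notation Rd := 'rV[R]_d.
Local Notation C := R[i].
Local Notation normc := Normc.normc.
Context (F : (Rd -> C) -> C) (hF : is_distribution F).
Implicit Types (f g phi psi : Rd -> C) (a : C) (x y : Rd) (s : seq 'I_d).

Lemma distribution0 : F (fun=> 0) = 0.
Proof.
have t0 : test_fun (fun _ : Rd => 0 : C).
  by apply/test_funP; split; [exact: Csmooth0.1|exists 0%N].
have := distribution_linear hF 1 t0 t0.
rewrite (_ : (fun x => _) = (fun=> 0)); last by apply/funext => x; rewrite mulr0 addr0.
by rewrite mul1r -[X in X = _]addr0 => /addrI.
Qed.

Lemma distribution_sum (I : eqType) (r : seq I) (c : I -> C) (G : I -> Rd -> C) :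
  (forall i, i \in r -> test_fun (G i)) ->
  test_fun (fun x => \sum_(i <- r) c i * G i x) /\
  F (fun x => \sum_(i <- r) c i * G i x) = \sum_(i <- r) c i * F (G i).
Proof.
elim: r => [|i r IH] tG.
  rewrite (_ : (fun x => _) = (fun=> 0)); last by apply/funext => x; rewrite big_nil.
  rewrite big_nil distribution0; split => //.
  by apply/test_funP; split; [exact: Csmooth0.1|exists 0%N].
have [] := IH; first by move=> j jr; apply: tG; rewrite in_cons jr orbT.
have tGi : test_fun (G i) by apply: tG; rewrite mem_head.
move=> tr Er.
rewrite (_ : (fun x => _) = (fun x => c i * G i x + \sum_(j <- r) c j * G j x)); last first.
  by apply/funext => x; rewrite big_cons.
rewrite distribution_linear// Er big_cons; split=> //.
move: tGi tr => /test_funP[s1 [N1 H1]] /test_funP[s2 [N2 H2]].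
apply/test_funP; split; first exact: (Csmooth_linear _ s1 s2).1.
exists (maxn N1 N2) => x; rewrite natr_max gt_max => /andP[/H1 -> /H2 ->].
by rewrite mulr0 addr0.
Qed.

Lemma distributionB phi psi : test_fun phi -> test_fun psi ->
  F (fun x => phi x - psi x) = F phi - F psi.
Proof.
move=> tphi tpsi; have := distribution_linear hF (-1) tpsi tphi.
rewrite mulN1r addrC => <-; congr F.
by apply/funext => x; rewrite mulN1r addrC.
Qed.

Lemma distribution_bound (N : nat) : exists2 M : R, 0 <= M &
  exists k, forall phi (B : R), smooth phi -> csupp N phi ->
    (forall s x, (size s <= k)%N -> normc (Cpderiv s phi x) <= B) ->
    normc (F phi) <= M * B.
Proof.
have [M [k HM]] := distribution_continuous hF (@compact_ball R d N%:R).
exists `|M| => //; exists k => phi B sphi Nphi HB.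
have B0 : 0 <= B by exact: le_trans (normc_ge0 _) (HB [::] 0 isT).
rewrite (le_trans (HM phi B (csupp_test_fun sphi Nphi) HB))//.
by rewrite ler_wpM2r// ler_norm.
Qed.

(** F is bounded by finitely many derivatives on the ball of radius [N'], which contains the
    supports of all y |-> phi(x - y) with |x| <= X; and those derivatives are Lipschitz in x. *)
Lemma dconv_loc_lip N phi : smooth phi -> csupp N phi -> loc_lip (dconv F phi).
Proof.
move=> sphi Nphi X.
pose N' := Num.bound (`|X| + N%:R).
have N'E x : `|x| <= X -> `|x| + N%:R <= N'%:R.
  move=> xX; rewrite (@le_trans _ _ (`|X| + N%:R))//.
    by rewrite lerD2r (le_trans xX)// ler_norm.
  by rewrite ltW// archi_boundP// addr_ge0.
have [M M0 [k HM]] := distribution_bound N'.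
have [G [l Hphi]] := test_lip k sphi Nphi.
have [G0 l0 _ _] := Hphi [::] 0 isT.
exists (M * G), (M * l); split.
- exact: mulr_ge0.
- exact: mulr_ge0.
- move=> x /N'E xN; have [s1 d1] := Csmooth_reflect x sphi.
  apply: HM => //; first exact: csupp_reflect xN.
  move=> s y sk; rewrite d1 normc_signM.
  by have [_ _ + _] := Hphi s `|x - y| sk; exact.
move=> x y xX yX.
have [s1 d1] := Csmooth_reflect x sphi; have [s2 d2] := Csmooth_reflect y sphi.
have N1 : csupp N' (fun z => phi (x - z)) by exact: csupp_reflect (N'E _ xX).
have N2 : csupp N' (fun z => phi (y - z)) by exact: csupp_reflect (N'E _ yX).
rewrite /dconv -distributionB; [|by apply/test_funP; split=> //; exists N'..].
have [s3 d3] := Csmooth_linear (-1) s2 s1.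
have E : (fun z => phi (x - z) - phi (y - z)) = (fun z => -1 * phi (y - z) + phi (x - z)).
  by apply/funext => z; rewrite mulN1r addrC.
rewrite E -mulrA; apply: HM => //.
  by move=> z Nz; rewrite N1// N2// mulr0 addr0.
move=> s z sk; rewrite d3 d1 d2 mulN1r addrC -mulrBr normc_signM.
have [_ _ _ H] := Hphi s (`|x - z| + `|y - z|) sk.
rewrite (le_trans (H _ _ _ _)) ?lerDl ?lerDr//.
by rewrite opprB addrA subrK.
Qed.

(* Riemann sums of the convolution converge in D, so that F can be applied
   termwise. *)
Lemma dconv_convolution N M f phi : loc_lip f -> csupp N f ->
  smooth phi -> csupp M phi ->
  dconv F (convolution f phi) = convolution f (dconv F phi).
Proof.
move=> Lf fN sphi Mphi; apply/funext => x.
have [S HS] := @nodes_exist R d N.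
pose N' := Num.bound (`|x| + (N.+1 + M)%N%:R).
have xN' : `|x| + (N.+1 + M)%N%:R <= N'%:R by rewrite ltW// archi_boundP// addr_ge0.
have [Mc Mc0 [k HM]] := distribution_bound N'.
have [K K0 HK] := conv_sum_approx HS Lf fN sphi Mphi k.
have [sc dc] := convolution_smooth Lf fN sphi Mphi.
have [A [la fA]] := Lf N.+1%:R.
have LF : loc_lip (dconv F phi) by exact: dconv_loc_lip sphi Mphi.
have [G [l FG]] := LF (`|x| + N.+1%:R).
pose K2 := 2 * @box_vol R d N.+1 * (A * l + la * G).
suff: normc (dconv F (convolution f phi) x - convolution f (dconv F phi) x) = 0.
  by move/Normc.eq0_normc/eqP; rewrite subr_eq0 => /eqP.
apply: (@le_natinv_eq0 _ (Mc * K + K2)) => [|m]; first exact: normc_ge0.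
have [Sm _ Happ] := HS m.
have T1 : smooth (convolution f phi) /\ csupp (N.+1 + M) (convolution f phi).
  split => // y Ny; apply: (csupp_convolution fN Mphi); apply: lt_trans Ny.
  by rewrite ltr_nat.
have [sU dU] := conv_sum_smooth (S m) f sphi.
have NU := csupp_conv_sum f Sm Mphi.
have [s1 d1] := Csmooth_reflect x sc; have [s2 d2] := Csmooth_reflect x sU.
have N1 := csupp_reflect T1.2 xN'; have N2 := csupp_reflect NU xN'.
have E : dconv F (conv_sum (S m) f phi) x = conv_sum (S m) f (dconv F phi) x.
  rewrite /dconv /conv_sum.
  have [|_ ->] := distribution_sum (r := S m) (fun p => p.1%:C * f p.2)
     (G := fun p y => phi (x - y - p.2)).
    move=> p /Sm[_ pN].
    have Ep : (fun y => phi (x - y - p.2)) = (fun y => phi (x - p.2 - y)).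
      by apply/funext => y; rewrite addrAC.
    rewrite Ep; apply/test_funP; split; first exact: (Csmooth_reflect _ sphi).1.
    exists N'; apply: csupp_reflect Mphi _; apply: le_trans xN'.
    rewrite natrD addrA lerD2r (le_trans (ler_normB _ _))// lerD2l.
    exact: pN.
  apply: eq_bigr => p _; congr (_ * F _); apply/funext => y.
  by rewrite addrAC.
rewrite (le_trans (normc_distD _ (conv_sum (S m) f (dconv F phi) x) _))// mulrDl lerD//.
  rewrite -E /dconv -distributionB; [|by apply/test_funP; split=> //; exists N'..].
  have [s3 d3] := Csmooth_linear (-1) s2 s1.
  have E3 : (fun y => convolution f phi (x - y) - conv_sum (S m) f phi (x - y)) =
     (fun y => -1 * conv_sum (S m) f phi (x - y) + convolution f phi (x - y)).
    by apply/funext => z; rewrite mulN1r addrC.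
  rewrite E3 -mulrA; apply: HM => //.
    by move=> z Nz; rewrite N1// N2// mulr0 addr0.
  move=> s z sk; rewrite d3 d1 d2 mulN1r addrC -mulrBr normc_signM dc dU.
  exact: HK.
rewrite -normcN opprB /K2 -mulrA.
have -> : conv_sum (S m) f (dconv F phi) x =
   \sum_(p <- S m) p.1%:C * (f p.2 * dconv F phi (x - p.2)).
  by apply: eq_bigr => p _; rewrite mulrA.
exact: (Happ f (dconv F phi) A la `|x| G l x).
Qed.

End distributions.

(** * Vanishing moments *)

Section moments.
Context {R : realType} {d : nat}.
Local Notation Rd := 'rV[R]_d.
Local Notation C := R[i].
Local Notation normc := Normc.normc.
Local Notation Re := complex.Re.
Local Notation Im := complex.Im.
Implicit Types (f g phi psi : Rd -> C) (a : C) (x y : Rd) (s : seq 'I_d).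
Local Notation vol N := (@box_vol R d N).

Lemma function_distribution g : loc_lip g ->
  is_distribution (fun phi => Cintegral (fun x => g x * phi x)).
Proof.
move=> Lg; split.
  move=> a phi psi /test_funP[sphi [N1 H1]] /test_funP[spsi [N2 H2]].
  have [i1 _] := Cintegrable_csupp (N := N1) (loc_lip_mul Lg (test_loc_lip sphi H1))
     (fun x Nx => eq_trans (congr1 (fun z => g x * z) (H1 x Nx)) (mulr0 _)).
  have [i2 _] := Cintegrable_csupp (N := N2) (loc_lip_mul Lg (test_loc_lip spsi H2))
     (fun x Nx => eq_trans (congr1 (fun z => g x * z) (H2 x Nx)) (mulr0 _)).
  have [_ <-] := Cintegral_linear a i1 i2.
  by congr Cintegral; apply/funext => x; rewrite mulrDr mulrCA.
move=> K /compact_sub_ball[N KN]; have [G [l [G0 _ gG _]]] := Lg N%:R.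
exists (5 * vol N.+1 * G), 0%N => phi B /(test_fun_on_csupp KN)[sphi Nphi] HB.
have gN : csupp N (fun x => g x * phi x) by move=> x /Nphi ->; rewrite mulr0.
have [_ H] := Cintegrable_csupp (loc_lip_mul Lg (test_loc_lip sphi Nphi)) gN.
have HB0 x : normc (phi x) <= B by have := HB [::] x isT; rewrite Cpderiv_nil.
rewrite -mulrA; apply: H => x; have [xN|/gN->] := leP `|x| N%:R.
  by rewrite Normc.normcM ler_pM ?normc_ge0 ?gG.
by rewrite Normc.normc0 mulr_ge0// (le_trans _ (HB0 0))// normc_ge0.
Qed.

(* Associativity of the convolution of functions is the termwise application of
   the distribution phi |-> int g phi. *)
Lemma convolution_swap N M g f phi : loc_lip g -> loc_lip f -> csupp N f ->
  smooth phi -> csupp M phi ->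
  convolution g (convolution f phi) = convolution f (convolution g phi).
Proof.
move=> Lg Lf fN sphi Mphi.
exact: (dconv_convolution (function_distribution Lg) Lf fN sphi Mphi).
Qed.

(** Brings chi next to the distribution, where the hypothesis on f * chi_j can be used, and gathers
    the rest in one kernel. By commutativity the factors eta and psi are peeled off one at a time
    with [dconv_convolution]. *)
Lemma dconv_convolution3 (F : (Rd -> C) -> C) N M L chi psi eta : is_distribution F ->
  smooth chi -> csupp N chi -> smooth psi -> csupp M psi -> smooth eta -> csupp L eta ->
  dconv F (convolution (convolution chi psi) eta) =
  convolution (dconv F chi) (convolution psi eta).
Proof.
move=> hF sc Nc sp Mp se Le.
have lc := test_loc_lip sc Nc; have lp := test_loc_lip sp Mp; have le := test_loc_lip se Le.
have [spc _] := convolution_smooth lp Mp sc Nc; have Npc := csupp_convolution Mp Nc.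
have lpc := test_loc_lip spc Npc.
have lF : loc_lip (dconv F chi) by exact: (dconv_loc_lip hF sc Nc).
rewrite [convolution chi psi]convolutionC// [convolution _ eta]convolutionC//.
rewrite (dconv_convolution hF le Le spc Npc) (dconv_convolution hF lp Mp sc Nc).
rewrite [convolution psi (dconv _ _)]convolutionC//.
by rewrite -(convolution_swap lF le Le sp Mp) [convolution eta psi]convolutionC.
Qed.

(** After rescaling, psi_j * eta at x is the integral of psi(y) eta(x - y/2^j), so eta may be
    replaced by any model [u] of it on the ball of radius N/2^j around x. The model is a constant
    for approximate identities and a Taylor polynomial for vanishing moments. *)
Lemma convolution_dilate_bound N psi : loc_lip psi -> csupp N psi ->
  exists2 K : R, 0 <= K & forall j x eta (u : Rd -> C) (B : R),
    loc_lip eta -> loc_lip u -> 0 <= B ->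
    (forall h, `|h| <= N%:R / 2 ^+ j -> normc (eta (x + h) - u h) <= B) ->
    normc (convolution (dilate psi j) eta x -
       Cintegral (fun y => psi y * u (- (2 ^+ j)^-1 *: y))) <= K * B.
Proof.
move=> Lp pN; have [A [_ [A0 _ pA _]]] := Lp N%:R.
exists (5 * vol N.+1 * A); first by rewrite !mulr_ge0// box_vol_ge0.
move=> j x eta u B Le Lu B0 HB.
have k0 : (2 ^+ j : R) != 0 by rewrite expf_neq0.
have k_gt0 : 0 < 2 ^+ j :> R by rewrite exprn_gt0.
pose h y := psi y * eta (- (2 ^+ j)^-1 *: y + x).
have Lh : loc_lip h by apply: loc_lip_mul => //; exact: loc_lip_affine.
have hN : csupp N h by move=> y /pN; rewrite /h => ->; rewrite mul0r.
have Lk : loc_lip (fun y => h (2 ^+ j *: y)).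
  have := loc_lip_affine (2 ^+ j) 0 Lh.
  by rewrite (_ : (fun x => _) = (fun x => h (2 ^+ j *: x)))//; apply/funext => y; rewrite addr0.
have kN : csupp N (fun y => h (2 ^+ j *: y)).
  by move=> y Ny; apply: hN; exact: lt_le_trans Ny (norm_scale2 j y).
have -> : convolution (dilate psi j) eta x = Cintegral h.
  rewrite -(Cintegral_dilate j (loc_lip_measurable Lh)) -(CintegralZ _ Lk kN).
  rewrite /convolution; congr Cintegral; apply/funext => y; rewrite /dilate /h -mulrA.
  by rewrite scaleNr scalerA mulVf// scale1r addrC.
have Lq : loc_lip (fun y => psi y * u (- (2 ^+ j)^-1 *: y)).
  apply: loc_lip_mul => //; have := loc_lip_affine (- (2 ^+ j)^-1) 0 Lu.
  by rewrite (_ : (fun x => _) = (fun y => u (- (2 ^+ j)^-1 *: y)))//;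
    apply/funext => y; rewrite addr0.
have qN : csupp N (fun y => psi y * u (- (2 ^+ j)^-1 *: y)).
  by move=> y /pN ->; rewrite mul0r.
have [ih _] := Cintegrable_csupp Lh hN; have [iq _] := Cintegrable_csupp Lq qN.
have [_ E] := Cintegral_linear (-1) iq ih.
rewrite addrC -mulN1r -E -mulrA.
pose D y := -1 * (psi y * u (- (2 ^+ j)^-1 *: y)) + h y.
have LD : loc_lip D by exact: loc_lip_lin.
have DN : csupp N D by move=> y Ny; rewrite /D hN// qN// mulr0 addr0.
have [_ HD] := Cintegrable_csupp LD DN; apply: HD => y.
have [yN|/DN->] := leP `|y| N%:R; last by rewrite Normc.normc0 mulr_ge0.
rewrite /D /h mulN1r addrC -mulrBr Normc.normcM ler_pM ?normc_ge0 ?pA//.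
rewrite [_ *: y + x]addrC; apply: HB; rewrite normrZ normrN normfV (ger0_norm (ltW k_gt0)).
by rewrite mulrC ler_wpM2r// invr_ge0 ltW.
Qed.

Lemma convolution_dilate_id N psi : loc_lip psi -> csupp N psi -> Cintegral psi = 1 ->
  exists2 K : R, 0 <= K & forall j x eta (l : R), loc_lip eta -> 0 <= l ->
    (forall y y', normc (eta y - eta y') <= l * `|y - y'|) ->
    normc (convolution (dilate psi j) eta x - eta x) <= K * l / 2 ^+ j.
Proof.
move=> Lp pN p1; have [K K0 HK] := convolution_dilate_bound Lp pN.
exists (K * N%:R); first exact: mulr_ge0.
move=> j x eta l Le l0 etal.
have := HK j x eta (fun=> eta x) (l * (N%:R / 2 ^+ j)) Le (loc_lip_cst _).
have -> : Cintegral (fun y => psi y * eta x) = eta x.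
  rewrite -[RHS]mulr1 -p1 -(CintegralZ _ Lp pN).
  by congr Cintegral; apply/funext => y; rewrite mulrC.
have -> : K * (l * (N%:R / 2 ^+ j)) = K * N%:R * l / 2 ^+ j by ring.
apply; first by rewrite !mulr_ge0// invr_ge0 exprn_ge0.
move=> h hN; rewrite (le_trans (etal _ _))// ler_wpM2l//.
by rewrite [x + h]addrC addrK.
Qed.

Lemma loc_lip_monomial (al : {ffun 'I_d -> nat}) : loc_lip (fun h : Rd => (monomial al h)%:C).
Proof.
have coord i : loc_lip (fun h : Rd => (h 0 i)%:C).
  move=> X; exists `|X|, 1; split=> //.
    by move=> x xX; rewrite normcR (le_trans (coord_le_norm _ _))// (le_trans xX)// ler_norm.
  move=> x y _ _; have -> : (x 0 i)%:C - (y 0 i)%:C = (x 0 i - y 0 i)%:C :> C by rewrite rmorphB.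
  rewrite normcR mul1r.
  by have := coord_le_norm (x - y) i; rewrite !mxE.
have powr i n : loc_lip (fun h : Rd => (h 0 i ^+ n)%:C).
  elim: n => [|n IH].
    rewrite (_ : (fun h : Rd => _) = (fun=> 1)); first exact: loc_lip_cst.
    by apply/funext => h; rewrite expr0.
  rewrite (_ : (fun h : Rd => _) = (fun h : Rd => (h 0 i)%:C * (h 0 i ^+ n)%:C)).
    exact: loc_lip_mul.
  by apply/funext => h; rewrite exprS rmorphM.
rewrite /monomial; elim: (index_enum _) => [|i r IH].
  rewrite (_ : (fun h : Rd => _) = (fun=> 1)); first exact: loc_lip_cst.
  by apply/funext => h; rewrite big_nil.
rewrite (_ : (fun h : Rd => _) =
  (fun h : Rd => (h 0 i ^+ al i)%:C * (\prod_(i <- r) h 0 i ^+ al i)%:C)).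
  exact: loc_lip_mul.
by apply/funext => h; rewrite big_cons rmorphM.
Qed.

Lemma loc_lip_poly L (p : Rd -> R) : poly_lt L p -> loc_lip (fun h => (p h)%:C).
Proof.
elim=> [|c al {}p _ _ IH]; first exact: loc_lip_cst.
rewrite (_ : (fun h : Rd => _) = (fun h => c%:C * (monomial al h)%:C + (p h)%:C)).
  by apply: loc_lip_lin => //; exact: loc_lip_monomial.
by apply/funext => h; rewrite rmorphD rmorphM.
Qed.

Lemma monomialZ (t : R) (al : {ffun 'I_d -> nat}) h :
  monomial al (t *: h) = t ^+ (\sum_i al i) * monomial al h.
Proof.
rewrite /monomial (big_morph _ (exprD t) (expr0 t)) -big_split/=.
by apply: eq_bigr => i _; rewrite mxE exprMn.
Qed.

Lemma moments_poly N L psi (p : Rd -> R) (t : R) : loc_lip psi -> csupp N psi ->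
  vanishing_moments L psi -> poly_lt L p ->
  Cintegral (fun y => psi y * (p (t *: y))%:C) = 0.
Proof.
move=> Lp pN vm; elim=> [|c al {}p al_lt Lq IH].
  by rewrite -[RHS](@Cintegral0 R d); congr Cintegral; apply/funext => y; rewrite mulr0.
have lm : loc_lip (fun y => (monomial al y)%:C * psi y).
  by apply: loc_lip_mul => //; exact: loc_lip_monomial.
have mN : csupp N (fun y => (monomial al y)%:C * psi y) by move=> y /pN ->; rewrite mulr0.
have lp : loc_lip (fun y => psi y * (p (t *: y))%:C).
  apply: loc_lip_mul => //; have := loc_lip_affine t 0 (loc_lip_poly Lq).
  by rewrite (_ : (fun x => _) = (fun y => (p (t *: y))%:C))//;
    apply/funext => y; rewrite addr0.
have ppN : csupp N (fun y => psi y * (p (t *: y))%:C) by move=> y /pN ->; rewrite mul0r.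
have [i1 _] := Cintegrable_csupp lm mN; have [i2 _] := Cintegrable_csupp lp ppN.
have [_] := Cintegral_linear (c * t ^+ (\sum_i al i))%:C i1 i2.
rewrite IH (vm al al_lt : Cintegral (fun y => (monomial al y)%:C * psi y) = 0) mulr0 addr0 => <-.
congr Cintegral; apply/funext => y; rewrite monomialZ !rmorphD !rmorphM/=; ring.
Qed.

(** The Taylor polynomial of eta at x, of degree below [L], is annihilated by psi; the remainder is
    of order (N/2^j)^L, with constants independent of x. *)
Lemma convolution_moments N M L psi eta : loc_lip psi -> csupp N psi ->
  vanishing_moments L psi -> smooth eta -> csupp M eta ->
  exists2 K : R, 0 <= K & forall j x,
    normc (convolution (dilate psi j) eta x) <= K / 2 ^+ (j * L).
Proof.
move=> Lp pN vm se eM; have [K K0 HK] := convolution_dilate_bound Lp pN.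
have le := test_loc_lip se eM.
have nr : supportedR M%:R (fun x => Re (eta x)) by move=> y /eM ->.
have ni : supportedR M%:R (fun x => Im (eta x)) by move=> y /eM ->.
have br : smooth_bounded (fun x => Re (eta x)).
  split; first by case: se.
  move=> s; have [B HB] := pderiv_bounded (size s) se.1 nr.
  by exists B => x; exact: HB.
have bi : smooth_bounded (fun x => Im (eta x)).
  split; first by case: se.
  move=> s; have [B HB] := pderiv_bounded (size s) se.2 ni.
  by exists B => x; exact: HB.
have [Cr Hr] := taylor L br; have [Ci Hi] := taylor L bi.
exists (K * (`|Cr| + `|Ci|) * N%:R ^+ L); first by rewrite !mulr_ge0// addr_ge0.
move=> j x; have [p Pp pH] := Hr x; have [q Pq qH] := Hi x.
pose u h := 'i * (q h)%:C + (p h)%:C.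
have := HK j x eta u ((`|Cr| + `|Ci|) * (N%:R / 2 ^+ j) ^+ L) le.
have -> : Cintegral (fun y => psi y * u (- (2 ^+ j)^-1 *: y)) = 0.
  have lp (r : Rd -> R) : poly_lt L r ->
     Cintegrable (fun y => psi y * (r (- (2 ^+ j)^-1 *: y))%:C).
    move=> Pr; apply: (Cintegrable_csupp (N := N) _ _).1; last by move=> y /pN ->; rewrite mul0r.
    apply: loc_lip_mul => //; have := loc_lip_affine (- (2 ^+ j)^-1) 0 (loc_lip_poly Pr).
    by rewrite (_ : (fun x => _) = (fun y => (r (- (2 ^+ j)^-1 *: y))%:C))//;
      apply/funext => y; rewrite addr0.
  have [_] := Cintegral_linear 'i (lp _ Pq) (lp _ Pp).
  rewrite !(moments_poly _ Lp pN vm)// mulr0 addr0 => <-.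
  by congr Cintegral; apply/funext => y; rewrite /u mulrDr mulrCA.
rewrite subr0 expr_div_n -exprM => H.
have -> : K * (`|Cr| + `|Ci|) * N%:R ^+ L / 2 ^+ (j * L) =
    K * ((`|Cr| + `|Ci|) * (N%:R ^+ L / 2 ^+ (j * L))) by ring.
apply: H.
- by apply: loc_lip_lin; [exact: (loc_lip_poly Pq)|exact: (loc_lip_poly Pp)].
- by apply: mulr_ge0; [exact: addr_ge0|apply: divr_ge0; exact: exprn_ge0].
move=> h hN; rewrite (le_trans (normc_le _))// ReD ImD ReN ImN /u.
rewrite ReD ImD [Re (_ * _)]ReM [Im (_ * _)]ImM/= !mul0r !mul1r subr0 !addr0 !add0r.
have hL : `|h| ^+ L <= N%:R ^+ L / 2 ^+ (j * L).
  rewrite exprM -expr_div_n lerXn2r ?nnegrE//.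
have CL (c : R) : c * `|h| ^+ L <= `|c| * (N%:R ^+ L / 2 ^+ (j * L)).
  apply: (@le_trans _ _ (`|c| * `|h| ^+ L)); last by rewrite ler_wpM2l.
  by rewrite ler_wpM2r ?exprn_ge0// ler_norm.
by rewrite mulrDl lerD//; [exact: le_trans (pH h) (CL Cr)|exact: le_trans (qH h) (CL Ci)].
Qed.

End moments.

(** * Convergence and convolution in E *)

Section banach_space.
Context {R : realType} {d : nat}.
Local Notation Rd := 'rV[R]_d.
Local Notation C := R[i].
Local Notation leb := (@lebesgue_rV R d).
Local Notation normc := Normc.normc.
Local Notation Re := complex.Re.
Local Notation Im := complex.Im.
Context (E : completeNormedModType C) (rep : E -> Rd -> C).
Context (hE : TIBF_bounded rep).
Implicit Types (f g : Rd -> C) (a : C) (x y : Rd) (u v : E).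

Lemma aeE (T : Type) (f g : Rd -> T) :
  (f = g %[ae leb]) <-> (\forall x \ae leb, f x = g x).
Proof. by split; apply: filterS => x; [exact|move=> ? _]. Qed.

(** The norm of a normed module over [R[i]] is itself an element of [R[i]]; this is the real number
    behind it. *)
Definition normE u : R := Re `|u|.

Lemma normEE u : `|u| = (normE u)%:C.
Proof. by apply: complex_eq => //=; rewrite ger0_Im. Qed.

Lemma normE_ge0 u : 0 <= normE u.
Proof. by rewrite -(ler0c (normE u)) -normEE. Qed.

Lemma normED u v : normE (u + v) <= normE u + normE v.
Proof. by rewrite -lecR rmorphD/= -!normEE ler_normD. Qed.

Lemma normEZ a u : normE (a *: u) = normc a * normE u.
Proof.
apply: complexI; rewrite rmorphM/= -!normEE normrZ; congr (_ * _).
Qed.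

Lemma normEN u : normE (- u) = normE u. Proof. by rewrite /normE normrN. Qed.

Lemma rep_linear a u v : \forall x \ae leb, rep (a *: u + v) x = a * rep u x + rep v x.
Proof. exact/aeE/(TIBF_linear hE). Qed.

Lemma rep0 : \forall x \ae leb, rep 0 x = 0.
Proof.
apply: filterS (rep_linear 1 0 0) => x; rewrite scaler0 addr0 mul1r.
by move/eqP; rewrite -subr_eq0 opprD addrA subrr add0r oppr_eq0 => /eqP.
Qed.

Lemma repZ a u : \forall x \ae leb, rep (a *: u) x = a * rep u x.
Proof. by apply: filterS2 (rep_linear a u 0) rep0 => x; rewrite !addr0 => -> ->; rewrite addr0. Qed.

Lemma rep_sum (w : nat -> E) n :
  \forall x \ae leb, rep (\sum_(i < n) w i) x = \sum_(i < n) rep (w i) x.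
Proof.
elim: n => [|n IH].
  by apply: filterS rep0 => x; rewrite !big_ord0.
apply: filterS2 (rep_linear 1 (w n) (\sum_(i < n) w i)) IH => x.
by rewrite !big_ord_recr/= scale1r mul1r addrC => -> ->; rewrite addrC.
Qed.

Lemma rep_inj u v : (\forall x \ae leb, rep u x = rep v x) -> u = v.
Proof.
move=> uv; apply/eqP; rewrite -subr_eq0; apply/eqP/(TIBF_injective hE)/aeE.
apply: filterS2 (rep_linear (-1) v u) uv => x; rewrite scaleN1r addrC => -> ->.
by rewrite mulN1r addNr.
Qed.

Lemma normc_measurable f : Cmeasurable f -> measurable_fun setT (fun x => normc (f x)).
Proof.
move=> [mr mi].
rewrite (_ : (fun x => _) = (fun x => Num.sqrt (Re (f x) ^+ 2 + Im (f x) ^+ 2))).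
  apply: (measurableT_comp (continuous_measurable_fun (@sqrt_continuous R))).
  by apply: measurable_funD; exact: measurable_funX.
by apply/funext => x; case: (f x).
Qed.

Lemma rep_ball_bound (N : nat) : exists2 M : R, 0 <= M & forall u,
  (\int[leb]_(x in [set x | (`|x| <= N%:R)%R]) (normc (rep u x))%:E <= (M * normE u)%:E)%E.
Proof.
have cK := @compact_ball R d N%:R; have [M HM] := TIBF_continuous hE cK.
exists `|M| => // u; have [mu /(_ _ cK) fu] := TIBF_L1loc hE u.
rewrite -[leLHS]fineK; last first.
  rewrite ge0_fin_numE//; apply: integral_ge0 => x _; rewrite lee_fin; exact: normc_ge0.
rewrite lee_fin; have := HM u; rewrite normEE -rmorphM lecR => /le_trans; apply.
by rewrite ler_wpM2r ?normE_ge0// ler_norm.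
Qed.

Lemma measurable_ball (N : R) : measurable [set x : Rd | `|x| <= N].
Proof.
rewrite (_ : mkset _ = ~` [set x | N < `|x|]).
  apply: measurableC; apply: open_measurable_rV.
  apply: (@open_comp _ _ (fun x : Rd => `|x|) [set r | N < r]).
    by move=> x _; exact: norm_continuous.
  exact: open_gt.
by apply/seteqP; split=> x /=; [move=> xN; apply/negP; rewrite -leNgt|move/negP; rewrite -leNgt].
Qed.

Lemma geometric_small (B eps : R) : 0 <= B -> 0 < eps ->
  exists n0, forall n, (n0 <= n)%N -> B / 2 ^+ n < eps.
Proof.
move=> B0 eps0; exists (Num.bound (B / eps)) => n nb.
have b0 : 0 <= B / eps by rewrite divr_ge0// ltW.
rewrite ltr_pdivrMr ?exprn_gt0// [eps * _]mulrC -ltr_pdivrMr//.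
rewrite (lt_le_trans (archi_boundP b0))// -natrX ler_nat (leq_trans nb)//.
by rewrite ltnW// ltn_expl.
Qed.

Lemma sumr_geo (B : R) n m : 0 <= B -> (n <= m)%N ->
  \sum_(n <= i < m) B / 2 ^+ i <= 2 * B / 2 ^+ n.
Proof.
move=> B0 nm.
suff: \sum_(n <= i < m) B / 2 ^+ i = 2 * B / 2 ^+ n - 2 * B / 2 ^+ m.
  by move=> ->; rewrite lerBlDr lerDl divr_ge0 ?mulr_ge0 ?exprn_ge0.
elim: m nm => [|m IH]; first by rewrite leqn0 => /eqP ->; rewrite big_geq// subrr.
rewrite leq_eqVlt => /orP[/eqP ->|]; first by rewrite big_geq// subrr.
rewrite ltnS => nm; rewrite big_nat_recr//= IH// exprS; field.
by rewrite !expf_neq0.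
Qed.

Lemma sum_normE (w : nat -> E) (B : R) n m : 0 <= B ->
  (forall i, normE (w i) <= B / 2 ^+ i) -> (n <= m)%N ->
  normE (\sum_(n <= i < m) w i) <= 2 * B / 2 ^+ n.
Proof.
move=> B0 wB nm; apply: le_trans (sumr_geo B0 nm).
elim: m nm => [|m IH]; first by rewrite leqn0 => /eqP ->; rewrite !big_geq// /normE normr0.
rewrite leq_eqVlt => /orP[/eqP ->|]; first by rewrite !big_geq// /normE normr0.
rewrite ltnS => nm; rewrite !big_nat_recr//= (le_trans (normED _ _))//.
by rewrite lerD// IH.
Qed.

(** Completeness of [E] enters here. The explicit tail bound is what later makes the integrals in
    Fatou's lemma tend to 0. *)
Lemma series_limit (w : nat -> E) (B : R) : 0 <= B ->
  (forall i, normE (w i) <= B / 2 ^+ i) ->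
  exists v, forall n, normE (v - \sum_(i < n) w i) <= 2 * B / 2 ^+ n.
Proof.
move=> B0 wB.
have /cauchy_cvgP/cvg_ex[v Hv] : cauchy (series w @ \oo).
  apply/cauchy_seriesP => e e0.
  have eE : e = (Re e)%:C by apply: complex_eq => //=; rewrite ger0_Im// ltW.
  have [|n0 Hn0] := @geometric_small (2 * B) (Re e) (mulr_ge0 (ler0n _ 2) B0).
    by rewrite -ltcR -eE.
  exists ([set n | (n0 <= n)%N], [set n | (n0 <= n)%N]).
    by split; exists n0.
  move=> [n m] /= [nn0 mn0]; rewrite normEE eE ltcR.
  have [mn|/ltnW nm] := leqP m n; first by rewrite big_geq// /normE normr0/= -ltcR -eE.
  exact: le_lt_trans (sum_normE B0 wB nm) (Hn0 _ nn0).
exists v => n; apply/ler_addgt0Pr => eps eps0.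
move/cvgrPdist_lt : Hv => /(_ eps%:C); rewrite ltcR => /(_ eps0) [k _ Hk].
have := Hk (maxn k n) (leq_maxl _ _); rewrite /= normEE ltcR => /ltW H1.
have -> : v - \sum_(i < n) w i = (v - series w (maxn k n)) + \sum_(n <= i < maxn k n) w i.
  rewrite /series/= (big_cat_nat (n := n) (leq0n n) (leq_maxr k n))/= big_mkord.
  by rewrite opprD addrA subrK.
by rewrite (le_trans (normED _ _))// addrC lerD// sum_normE// leq_maxr.
Qed.

Lemma normc_dist (z z' : C) : `|normc z - normc z'| <= normc (z - z').
Proof.
have h1 := le_normcD (z - z') z'; have h2 := le_normcD (z' - z) z.
rewrite !subrK -[z' - z]opprB normcN in h1 h2.
by rewrite ler_norml; move: h1 h2; lra.
Qed.

(* E embeds continuously in L^1 of each ball, so Fatou's lemma identifies the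
   limit in E with the pointwise one. *)
Lemma E_limit (w : nat -> E) (g : nat -> Rd -> C) (G : Rd -> C) (B : R) : 0 <= B ->
  (forall i, normE (w i) <= B / 2 ^+ i) ->
  (forall i, \forall x \ae leb, rep (w i) x = g i x) ->
  (forall x (eps : R), 0 < eps -> exists n0, forall n, (n0 <= n)%N ->
     normc (\sum_(i < n) g i x - G x) <= eps) ->
  exists2 v, (\forall x \ae leb, rep v x = G x) & normE v <= 2 * B.
Proof.
move=> B0 wB wg gG; have [v Hv] := series_limit B0 wB.
exists v; last first.
  by have := Hv 0%N; rewrite big_ord0 subr0 expr0 divr1.
pose U n := v - \sum_(i < n) w i.
pose h n x : \bar R := (normc (rep (U n) x))%:E.
have hE0 : \forall x \ae leb, forall n, rep (U n) x = rep v x - \sum_(i < n) g i x.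
  apply/ae_foralln => n.
  have wg' : \forall x \ae leb, forall i, rep (w i) x = g i x by exact/ae_foralln.
  apply: filterS3 (rep_linear (-1) (\sum_(i < n) w i) v) (rep_sum w n) wg'.
  move=> x; rewrite scaleN1r addrC -/(U n) => -> -> Hx.
  by rewrite mulN1r addrC; congr (_ - _); apply: eq_bigr => i _; exact: Hx.
have mh n : measurable_fun setT (h n).
  have [mU _] := TIBF_L1loc hE (U n).
  have H := normc_measurable mU.
  exact/measurable_EFinP.
have h0 n x : (0 <= h n x)%E by rewrite lee_fin normc_ge0.
have main N : \forall x \ae leb, `|x| <= N%:R -> limn_einf (h ^~ x) = 0%E.
  set K := [set x : Rd | `|x| <= N%:R].
  have mK : measurable K by exact: measurable_ball.
  have [M M0 HM] := rep_ball_bound N.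
  have mlim : measurable_fun K (fun x => limn_einf (h ^~ x)).
    apply: (emeasurable_fun_cvg (fun n x => einfs (h ^~ x) n)) => [n|x _].
      by apply: measurable_fun_einfs => k; exact: measurable_funTS.
    by rewrite limn_einf_lim; exact: is_cvg_einfs.
  have lim0 x : (0 <= limn_einf (h ^~ x))%E.
    rewrite limn_einf_lim; apply: lime_ge; first exact: is_cvg_einfs.
    by apply: nearW => n; apply: le_ereal_inf_tmp => _ [m _ <-]; exact: h0.
  have := fatou leb mK (fun n => measurable_funTS (mh n)) (fun n x _ => h0 n x).
  have -> : limn_einf (fun n => (\int[leb]_(x in K) h n x)%E) = 0%E.
    suff : (fun n => (\int[leb]_(x in K) h n x)%E) @ \oo --> (0 : \bar R).
      by case/cvg_limn_einf_sup.
    have gB n : (0 <= \int[leb]_(x in K) h n x <= (geometric (M * (2 * B)) 2^-1 n)%:E)%E.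
      apply/andP; split; first exact: integral_ge0.
      rewrite (le_trans (HM _))// lee_fin /= exprVn -mulrA ler_wpM2l//; exact: Hv.
    have g0 : (geometric (M * (2 * B)) 2^-1 n)%:E @[n --> \oo] --> (0 : R)%:E.
      apply: cvg_EFin; first exact: nearW.
      by apply: cvg_geometric; rewrite ger0_norm// invf_lt1 ?ltr1n.
    exact: (squeeze_cvge (nearW _ gB) (cvg_cst _) g0).
  move=> I0.
  have /(ae_eq_integral_abs _ mK mlim) : (\int[leb]_(x in K) `|limn_einf (h ^~ x)| = 0)%E.
    apply/eqP; rewrite eq_le; apply/andP; split; last exact: integral_ge0.
    apply: le_trans I0; rewrite le_eqVlt; apply/orP; left; apply/eqP.
    by apply: eq_integral => x _; rewrite gee0_abs.
  by apply: filterS => x.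
have {}main : \forall x \ae leb, forall N : nat, `|x| <= N%:R -> limn_einf (h ^~ x) = 0%E.
  exact/ae_foralln.
apply: filterS2 main hE0 => x mx hx.
have xN : `|x| <= (Num.bound `|x|)%:R by rewrite ltW// archi_boundP.
have {}mx := mx _ xN.
suff : normc (rep v x - G x) = 0 by move/Normc.eq0_normc/eqP; rewrite subr_eq0 => /eqP.
have cv : normc (rep v x - \sum_(i < n) g i x) @[n --> \oo] --> normc (rep v x - G x).
  apply/cvgrPdist_le => /= eps eps0; have [n0 Hn0] := gG x eps eps0.
  exists n0 => // n /= n0n; rewrite (le_trans (normc_dist _ _))//.
  by rewrite (_ : _ - _ = \sum_(i < n) g i x - G x) ?Hn0//; ring.
have /cvg_limn_einf_sup[] : h ^~ x @ \oo --> (normc (rep v x - G x))%:E.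
  rewrite (_ : h ^~ x = (fun n => (normc (rep v x - \sum_(i < n) g i x))%:E)).
    by apply: cvg_EFin => //; exact: nearW.
  by apply/funext => n; rewrite /h hx.
by rewrite mx => -[].
Qed.

End banach_space.

(** * The weighted convolution estimate in E *)

Section weighted_estimate.
Context {R : realType} {d : nat}.
Local Notation Rd := 'rV[R]_d.
Local Notation C := R[i].
Local Notation leb := (@lebesgue_rV R d).
Local Notation normc := Normc.normc.
Local Notation Re := complex.Re.
Local Notation Im := complex.Im.
Implicit Types (f g phi psi : Rd -> C) (a : C) (x y : Rd) (s : seq 'I_d).
Context (E : completeNormedModType C) (rep : E -> Rd -> C).
Context (hE : TIBF_bounded rep).
Context (hsolid : solid rep).

Lemma loc_lip_normc g : loc_lip g -> loc_lip (fun x => (normc (g x))%:C).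
Proof.
move=> Lg X; have [G [l [G0 l0 gG gl]]] := Lg X; exists G, l; split=> //.
  by move=> x xX; rewrite normcR ger0_norm ?normc_ge0 ?gG.
move=> x y xX yX; apply: le_trans (gl x y xX yX).
have -> : (normc (g x))%:C - (normc (g y))%:C = (normc (g x) - normc (g y))%:C :> C.
  by rewrite rmorphB.
by rewrite normcR normc_dist.
Qed.

Lemma compact_measure (K : set Rd) : compact K -> measurable K /\ (leb K < +oo)%E.
Proof.
move=> cK; have mK : measurable K.
  rewrite -(setCK K); apply: measurableC; apply: open_measurable_rV.
  by apply: closed_openC; apply: compact_closed => //; exact: norm_hausdorff.
split=> //; have [N KN] := compact_sub_ball cK.
apply: le_lt_trans (@rV_box_lty R d N.+1); apply: le_measure; rewrite ?inE//.
  exact: measurable_rV_boxN.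
move=> x /KN /= xN; apply: norm_rV_box; apply: le_lt_trans xN _.
by rewrite ltr_nat.
Qed.

Lemma Cmeasurable_mulR f (v : Rd -> R) : Cmeasurable f -> measurable_fun setT v ->
  Cmeasurable (weighted f v).
Proof.
move=> [mr mi] mv; split.
  rewrite (_ : (fun x => _) = (fun x => Re (f x) * v x)); first exact: measurable_funM.
  by apply/funext => x; rewrite /weighted ReM/= mulr0 subr0.
rewrite (_ : (fun x => _) = (fun x => Im (f x) * v x)); first exact: measurable_funM.
by apply/funext => x; rewrite /weighted ImM/= mulr0 add0r.
Qed.

Lemma weighted_L1loc f (w v : Rd -> R) : loc_lip f -> weight w ->
  measurable_fun setT v -> (\forall x \ae leb, w x = v x) -> L1loc (weighted f v).
Proof.
move=> Lf [w1 wb _] mv wv.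
have mT : Cmeasurable (weighted f v).
  by apply: Cmeasurable_mulR => //; exact: loc_lip_measurable.
split=> // K cK; have [mK Kfin] := compact_measure cK.
have [N KN] := compact_sub_ball cK; have [G [l [G0 _ fG _]]] := Lf N%:R.
have [M HM] := wb K cK.
apply: (@le_lt_trans _ _ (\int[leb]_(x in K) (G * `|M|)%:E)%E).
  apply: ae_ge0_le_integral => //.
  - by move=> x _; rewrite lee_fin normc_ge0.
  - by apply/measurable_EFinP; apply: measurable_funTS; exact: normc_measurable mT.
  - by move=> x _; rewrite lee_fin mulr_ge0.
  apply: filterS wv => x wvx Kx; rewrite lee_fin /weighted -wvx Normc.normcM normcR.
  rewrite ler_pM ?normc_ge0 ?fG//; first exact: KN.
  rewrite ger0_norm; first by rewrite (le_trans (HM x Kx))// ler_norm.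
  exact: le_trans (w1 x).
by rewrite integral_cst// lte_mul_pinfty ?lee_fin ?mulr_ge0.
Qed.

(** Shifting the weight under the integral costs [c] and turns [wn x] into [wm y]. The result is
    dominated by |rep u| * 1_B, which lies in E by solidity and the module property, and a second
    use of solidity brings the bound back to (g * theta) wn. [K] depends only on c and N; of theta
    only the supremum is seen. *)
Lemma E_convolution (N : nat) (c : R) (wn wm : Rd -> R) : 0 <= c -> weight wn ->
  (forall x y, `|x - y| <= N%:R -> wn x <= c * wm y) ->
  exists2 K : R, 0 <= K & forall g theta (A : R) (u : E),
    loc_lip g -> loc_lip theta -> csupp N theta -> loc_lip (convolution g theta) ->
    0 <= A -> (forall x, normc (theta x) <= A) ->
    (\forall x \ae leb, rep u x = weighted g wm x) ->
    exists2 v, (\forall x \ae leb, rep v x = weighted (convolution g theta) wn x) &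
      normE v <= K * A * normE u.
Proof.
move=> c0 wwn wnm.
have wn1 := weight_ge1 wwn.
have wm0 y : 0 <= wm y.
  have := wnm y y; rewrite subrr normr0 => /(_ (ler0n _ _)) H.
  have cw : 0 < c * wm y by rewrite (lt_le_trans _ (le_trans (wn1 y) H)).
  rewrite leNgt; apply/negP => /ltW wneg.
  by have := mulr_ge0_le0 c0 wneg; rewrite leNgt cw.
pose B : set Rd := [set x | `|x| <= N%:R].
have mB : measurable B by exact: measurable_ball.
(* The indicator of the ball replaces |theta| up to the factor A: one L^1 kernel for all theta. *)
pose phi : Rd -> C := fun x => (\1_B x)%:C.
have phiE x : normc (phi x) = \1_B x by rewrite normcR ger0_norm.
have Lphi : L1 phi.
  split; first by split; [exact: measurable_indic|exact: measurable_cst].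
  under eq_integral do rewrite phiE.
  by rewrite integral_indic// setIT; have [] := compact_measure (@compact_ball R d N%:R).
have nphi : 0 <= L1norm phi by apply: Rintegral_ge0 => x _; exact: normc_ge0.
exists (2 * c * L1norm phi); first by rewrite !mulr_ge0.
move=> g theta A u Lg Lt tN Lc A0 tA ru.
have [mu lu] := TIBF_L1loc hE u.
have nmu : measurable_fun setT (fun x => normc (rep u x)) by exact: normc_measurable.
have Lnu : L1loc (fun x => (normc (rep u x))%:C).
  split; first by split; [exact: nmu|exact: measurable_cst].
  move=> K cK; under eq_integral do rewrite normcR ger0_norm ?normc_ge0//.
  exact: lu.
have [u1 /aeE ru1 u1u] : exists2 v : E, rep v = (fun x => (normc (rep u x))%:C) %[ae leb] & `|v| <= `|u|.
  apply: hsolid => //; apply: aeW => x; by rewrite normcR ger0_norm ?normc_ge0.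
have [v1 /aeE rv1 v1u] := TIBF_module hE u1 Lphi.
have key x : normc (convolution g theta x) * wn x <=
     2 * c * A * normc (convolution (rep u1) phi x).
  pose q y := normc (g y) * normc (theta (x - y)).
  (* Written with [rep u], a Borel function, rather than with g and [wm], which agree with it only
     almost everywhere. *)
  pose p y := normc (rep u y) * \1_B (x - y).
  have q0 y : 0 <= q y by rewrite mulr_ge0 ?normc_ge0.
  have p0 y : 0 <= p y by rewrite mulr_ge0 ?normc_ge0.
  have mpx : measurable_fun setT (fun y => \1_B (x - y) : R).
    rewrite reflectE; apply: (measurableT_comp (measurable_indic mB)).
    exact: measurable_affine.
  have mp : measurable_fun setT p by exact: measurable_funM.
  pose N' := Num.bound (`|x| + N%:R).
  have ltx := loc_lip_reflect x Lt.
  have ntx : csupp N' (fun y => theta (x - y)).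
    by apply: csupp_reflect tN _; rewrite ltW// archi_boundP// addr_ge0.
  have iq : leb.-integrable setT (EFin \o q).
    have [[iq _] _] := Cintegrable_csupp (N := N')
      (loc_lip_mul (loc_lip_normc Lg) (loc_lip_normc ltx))
      (fun y Ny => eq_trans (congr1 (fun z => (normc (g y))%:C * (normc z)%:C) (ntx y Ny))
        (eq_trans (congr1 (fun z => (normc (g y))%:C * z%:C) (Normc.normc0 _)) (mulr0 _))).
    apply: eq_integrable iq => // y _ /=; congr EFin.
    by rewrite /q mul0r subr0.
  have ip : leb.-integrable setT (EFin \o p).
    apply/integrableP; split; first exact/measurable_EFinP.
    have cK := @compact_ball R d N'%:R; have [mK _] := compact_measure cK.
    apply: le_lt_trans (lu _ cK); rewrite [leRHS]integral_mkcond.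
    apply: ge0_le_integral => //.
    - by apply/measurable_EFinP; exact: measurableT_comp.
    - apply/(measurable_restrictT _ mK); apply/measurable_EFinP; exact: measurable_funTS.
    move=> y _ /=; rewrite patchE ger0_norm//.
    case: ifPn => [_|/negP yK].
      by rewrite lee_fin ler_piMr ?normc_ge0// indicE; case: (_ \in _).
    rewrite lee_fin /p indicE memNset ?mulr0//= => xyN; apply: yK; rewrite inE /=.
    have : `|y| <= `|x| + `|x - y| by rewrite -{1}[y](subKr x) ler_normB.
    move=> /le_trans; apply; apply: le_trans (ltW (archi_boundP _)).
      by rewrite lerD2l.
    exact: addr_ge0.
  have a1 : normc (convolution g theta x) <= 2 * \int[leb]_y q y.
    have [[ir ii] _] := Cintegrable_csupp (N := N') (loc_lip_mul Lg ltx)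
      (fun y Ny => eq_trans (congr1 (fun z => g y * z) (ntx y Ny)) (mulr0 _)).
    rewrite (le_trans (normc_le _))// mulr_natl mulr2n lerD//=.
      rewrite (le_trans (le_normr_Rintegral measurableT ir))//.
      apply: le_Rintegral => //; first exact: integrable_norm ir.
      by move=> y _; rewrite /q -Normc.normcM Re_le_normc.
    rewrite (le_trans (le_normr_Rintegral measurableT ii))//.
    apply: le_Rintegral => //; first exact: integrable_norm ii.
    by move=> y _; rewrite /q -Normc.normcM Im_le_normc.
  have a2 : wn x * \int[leb]_y q y <= c * A * \int[leb]_y p y.
    rewrite -RintegralZl// -[leRHS]RintegralZl//.
    have iwq : leb.-integrable setT (EFin \o (fun y => wn x * q y)).
      by have := integrableZl measurableT (wn x) iq.
    have icp : leb.-integrable setT (EFin \o (fun y => c * A * p y)).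
      by have := integrableZl measurableT (c * A) ip.
    apply: fine_le; [exact: integrable_fin_num|exact: integrable_fin_num|].
    apply: ae_ge0_le_integral => //.
    - by move=> y _ /=; rewrite lee_fin mulr_ge0//; exact: le_trans (wn1 x).
    - by case/integrableP: iwq.
    - by move=> y _ /=; rewrite lee_fin mulr_ge0// mulr_ge0.
    - by case/integrableP: icp.
    apply: filterS ru => y ruy _; rewrite lee_fin /q /p ruy /weighted Normc.normcM normcR.
    rewrite (ger0_norm (wm0 y)); have [xyN|Nxy] := leP `|x - y| N%:R; last first.
      by rewrite tN// Normc.normc0 !mulr0 !mulr_ge0 ?normc_ge0.
    rewrite indicE mem_set//= mulr1.
    have h1 : wn x * normc (theta (x - y)) <= c * wm y * A.
      by rewrite ler_pM ?normc_ge0 ?(le_trans _ (wn1 x)) ?wnm.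
    have -> : c * A * (normc (g y) * wm y) = normc (g y) * (c * wm y * A) by ring.
    by rewrite mulrCA ler_wpM2l ?normc_ge0.
  have a3 : \int[leb]_y p y <= normc (convolution (rep u1) phi x).
    apply: le_trans (Re_le_normc _); apply: le_trans (ler_norm _).
    rewrite le_eqVlt; apply/orP; left; apply/eqP; rewrite /convolution /Cintegral /=.
    congr fine; apply: ae_eq_integral => //.
    - exact/measurable_EFinP.
    - apply/measurable_EFinP.
      rewrite (_ : (fun y => _) = (fun y => Re (rep u1 y) * \1_B (x - y))).
        by apply: measurable_funM => //; case: (TIBF_L1loc hE u1) => -[].
      by apply/funext => y; rewrite ReM /= mulr0 subr0.
    apply: filterS ru1 => y -> _; rewrite /p; congr EFin.
    by rewrite ReM /= mulr0 subr0.
  rewrite (le_trans (ler_wpM2r _ a1)) ?(le_trans _ (wn1 x))//.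
  rewrite -!mulrA ler_wpM2l// mulrC (le_trans a2)// -mulrA ler_wpM2l// ler_wpM2l//.
(* Solidity asks for a function in [L1loc], hence for a Borel version [vn] of the weight. *)
have [vn mvn /aeE wvn] := weight_measurable wwn.
pose v2 := (2 * c * A)%:C *: v1.
have [v /aeE rv vv2] : exists2 v : E, rep v = weighted (convolution g theta) vn %[ae leb] & `|v| <= `|v2|.
  apply: hsolid; first exact: weighted_L1loc Lc wwn mvn wvn.
  apply: filterS3 (repZ hE (2 * c * A)%:C v1) rv1 wvn => x; rewrite -/v2 => -> -> wvx.
  rewrite /weighted -wvx !Normc.normcM !normcR ger0_norm; last exact: le_trans (wn1 x).
  by rewrite (le_trans (key x))// ger0_norm// !mulr_ge0.
exists v.
  by apply: filterS2 rv wvn => x -> wvx; rewrite /weighted wvx.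
have h1 : normE v <= normE v2 by rewrite -lecR -!normEE.
have h2 : normE u1 <= normE u by rewrite -lecR -!normEE.
have h3 : normE v1 <= normE u1 * L1norm phi by rewrite -lecR rmorphM/= -!normEE.
rewrite (le_trans h1)// /v2 normEZ normcR ger0_norm ?mulr_ge0//.
have -> : 2 * c * L1norm phi * A * normE u = 2 * c * A * (normE u * L1norm phi) by ring.
by rewrite ler_wpM2l ?mulr_ge0// (le_trans h3)// ler_wpM2r.
Qed.

End weighted_estimate.

(** * From (iii) to (i) *)

Section telescoping.
Context {R : realType} {d : nat}.
Local Notation Rd := 'rV[R]_d.
Local Notation C := R[i].
Implicit Types (f g phi psi : Rd -> C) (a : C) (x y : Rd) (s : seq 'I_d).

Lemma convolution_linr N a f g h : loc_lip f -> csupp N f -> loc_lip g -> loc_lip h ->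
  convolution f (fun x => a * g x + h x) =
  (fun x => a * convolution f g x + convolution f h x).
Proof.
move=> Lf fN Lg Lh; apply/funext => x; rewrite /convolution.
have I (k : Rd -> C) : loc_lip k -> Cintegrable (fun y => f y * k (x - y)).
  move=> Lk; apply: (Cintegrable_csupp (N := N) _ _).1.
    by apply: loc_lip_mul => //; exact: loc_lip_reflect.
  by move=> y /fN ->; rewrite mul0r.
have [_ <-] := Cintegral_linear a (I g Lg) (I h Lh).
by congr Cintegral; apply/funext => y; rewrite mulrDr mulrCA.
Qed.

Lemma convolutionZr N a f g : loc_lip f -> csupp N f -> loc_lip g ->
  convolution f (fun x => a * g x) = (fun x => a * convolution f g x).
Proof.
move=> Lf fN Lg; have := convolution_linr a Lf fN Lg (loc_lip_cst 0).
rewrite (_ : (fun x => a * g x + 0) = (fun x => a * g x)); last first.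
  by apply/funext => x; rewrite addr0.
move=> ->; apply/funext => x; rewrite [X in _ + X](_ : _ = 0) ?addr0//.
by rewrite /convolution -[RHS](@Cintegral0 R d); congr Cintegral; apply/funext => y; rewrite mulr0.
Qed.

Lemma convolution_sumr N (I : Type) (r : seq I) f (G : I -> Rd -> C) :
  loc_lip f -> csupp N f -> (forall i, loc_lip (G i)) ->
  loc_lip (fun x => \sum_(i <- r) G i x) /\
  convolution f (fun x => \sum_(i <- r) G i x) =
  (fun x => \sum_(i <- r) convolution f (G i) x).
Proof.
move=> Lf fN LG; elim: r => [|i r [IH1 IH2]].
  rewrite (_ : (fun x => _) = (fun=> 0)); last by apply/funext => x; rewrite big_nil.
  split; first exact: loc_lip_cst.
  apply/funext => x; rewrite big_nil /convolution -[RHS](@Cintegral0 R d).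
  by congr Cintegral; apply/funext => y; rewrite mulr0.
rewrite (_ : (fun x => _) = (fun x => 1 * G i x + \sum_(j <- r) G j x)); last first.
  by apply/funext => x; rewrite big_cons mul1r.
split; first exact: loc_lip_lin.
rewrite (convolution_linr 1 Lf fN)// IH2; apply/funext => x.
by rewrite big_cons mul1r.
Qed.

Lemma laplacian_test N f : smooth f -> csupp N f ->
  smooth (laplacian f) /\ csupp N (laplacian f).
Proof.
move=> sf fN; split.
  have [+ _] := Csmooth_sum (index_enum 'I_d) (fun=> 1)
     (fun i => Csmooth_pderiv [:: i; i] sf).
  rewrite (_ : (fun x => _) = laplacian f)//; apply/funext => x.
  by apply: eq_bigr => i _; rewrite mul1r.
move=> x Nx; rewrite /laplacian big1// => i _.
exact: (csupp_pderiv [:: i; i] fN Nx).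
Qed.

Lemma laplacian_convolution N M f g : smooth f -> csupp N f -> smooth g -> csupp M g ->
  laplacian (convolution f g) = convolution f (laplacian g).
Proof.
move=> sf fN sg gM; have Lf := test_loc_lip sf fN.
have LG i : loc_lip (Cpderiv [:: i; i] g).
  exact: test_loc_lip (Csmooth_pderiv [:: i; i] sg) (csupp_pderiv [:: i; i] gM).
have [_ ->] := convolution_sumr (index_enum 'I_d) Lf fN LG.
have [_ dc] := convolution_smooth Lf fN sg gM.
by apply/funext => x; apply: eq_bigr => i _; rewrite dc.
Qed.

Lemma laplacian_dilate j f : smooth f ->
  laplacian (dilate f j) = (fun x => 2 ^+ (j * 2) * dilate (laplacian f) j x).
Proof.
move=> sf; have [_ dd] := Csmooth_dilate j sf; apply/funext => x.
rewrite /laplacian /dilate !mulr_sumr; apply: eq_bigr => i _.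
by rewrite dd /dilate.
Qed.

(** Since Delta(psi_j) = 2^(2j) (Delta psi)_j, moving the Laplacian over to phi leaves the factor
    2^(-2j) and lets the moments of psi act on the fixed function Delta phi. *)
Lemma convolution_laplacian_dilate N M j psi phi : smooth psi -> csupp N psi ->
  smooth phi -> csupp M phi ->
  convolution (dilate (laplacian psi) j) phi =
  (fun x => 2 ^- (j * 2) * convolution (dilate psi j) (laplacian phi) x).
Proof.
move=> sp pN sphi phiM.
have [sd _] := Csmooth_dilate j sp; have dN := csupp_dilate j pN.
have [sl lN] := laplacian_test sd dN.
have Ld := test_loc_lip sd dN; have Lphi := test_loc_lip sphi phiM.
rewrite -(laplacian_convolution sd dN sphi phiM) [convolution (dilate psi j) phi]convolutionC//.
rewrite (laplacian_convolution sphi phiM sd dN) (laplacian_dilate j sp).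
have [slp lpN] := laplacian_test sp pN.
have Llp := loc_lip_dilate j (test_loc_lip slp lpN).
rewrite (convolutionZr _ Lphi phiM Llp) convolutionC//.
by apply/funext => x; rewrite mulrA mulVf ?mul1r// expf_neq0// pnatr_eq0.
Qed.

Lemma dconv_linear (F : (Rd -> C) -> C) a N M f g : is_distribution F ->
  smooth f -> csupp N f -> smooth g -> csupp M g ->
  dconv F (fun x => a * f x + g x) = (fun x => a * dconv F f x + dconv F g x).
Proof.
move=> hF sf fN sg gM; apply/funext => x; rewrite /dconv -(distribution_linear hF)//.
  apply/test_funP; split; first exact: (Csmooth_reflect x sf).1.
  exists (Num.bound (`|x| + N%:R)); apply: csupp_reflect fN _.
  by rewrite ltW// archi_boundP// addr_ge0.
apply/test_funP; split; first exact: (Csmooth_reflect x sg).1.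
exists (Num.bound (`|x| + M%:R)); apply: csupp_reflect gM _.
by rewrite ltW// archi_boundP// addr_ge0.
Qed.

(** Serves twice: with the factorization of phi^0 for the initial term of the telescoping sum, and
    with the dilated factorization of psi^0 for the differences. *)
Lemma dconv_decomposition (F : (Rd -> C) -> C) N0 N1 N M f0 f1 chi0 chi1 phi g :
  is_distribution F -> smooth chi0 -> csupp N0 chi0 -> smooth chi1 -> csupp N1 chi1 ->
  smooth f0 -> csupp N f0 -> smooth f1 -> csupp N f1 -> smooth phi -> csupp M phi ->
  (forall x, g x = convolution chi0 f0 x + convolution chi1 f1 x) ->
  dconv F (convolution g phi) =
   (fun x => convolution (dconv F chi0) (convolution f0 phi) x
           + convolution (dconv F chi1) (convolution f1 phi) x).
Proof.
move=> hF sc0 cN0 sc1 cN1 sf0 fN0 sf1 fN1 sphi phiM gE.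
have L0 := test_loc_lip sc0 cN0; have L1 := test_loc_lip sc1 cN1.
have Lphi := test_loc_lip sphi phiM.
have [s0 _] := convolution_smooth L0 cN0 sf0 fN0.
have [s1 _] := convolution_smooth L1 cN1 sf1 fN1.
have n0 := csupp_convolution cN0 fN0; have n1 := csupp_convolution cN1 fN1.
have l0 := test_loc_lip s0 n0; have l1 := test_loc_lip s1 n1.
have [s0' _] := convolution_smooth l0 n0 sphi phiM.
have [s1' _] := convolution_smooth l1 n1 sphi phiM.
have n0' := csupp_convolution n0 phiM; have n1' := csupp_convolution n1 phiM.
have E : convolution g phi =
   (fun x => 1 * convolution (convolution chi0 f0) phi x
             + convolution (convolution chi1 f1) phi x).
  have -> : g = (fun x => 1 * convolution chi0 f0 x + convolution chi1 f1 x).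
    by apply/funext => x; rewrite mul1r.
  rewrite convolutionC//; last exact: loc_lip_lin.
  rewrite (convolution_linr 1 Lphi phiM l0 l1).
  by rewrite [convolution phi (convolution chi0 _)]convolutionC// [convolution phi _]convolutionC.
rewrite E (dconv_linear 1 hF s0' n0' s1' n1'); apply/funext => x; rewrite mul1r.
rewrite (dconv_convolution3 hF sc0 cN0 sf0 fN0 sphi phiM).
by rewrite (dconv_convolution3 hF sc1 cN1 sf1 fN1 sphi phiM).
Qed.

Lemma dilateD j f g h : (forall x, f x = g x + h x) ->
  forall x, dilate f j x = dilate g j x + dilate h j x.
Proof. by move=> E x; rewrite /dilate E mulrDr. Qed.

Lemma dilateS j f g : (forall x, 2 ^+ d * f (2 *: x) - f x = g x) ->
  forall x, dilate f j.+1 x = 1 * dilate g j x + dilate f j x.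
Proof.
move=> E x; rewrite /dilate -E mul1r mulrBr subrK mulrA -exprD addnC -mulSn.
by rewrite scalerA -exprS.
Qed.

Lemma dconv_step (F : (Rd -> C) -> C) N0 N1 N M j f0 p0 p1 chi0 chi1 phi :
  is_distribution F -> smooth chi0 -> csupp N0 chi0 -> smooth chi1 -> csupp N1 chi1 ->
  smooth f0 -> csupp N f0 -> smooth p0 -> csupp N p0 -> smooth p1 -> csupp N p1 ->
  smooth phi -> csupp M phi ->
  (forall x, 2 ^+ d * f0 (2 *: x) - f0 x = laplacian p0 x) ->
  (forall x, p0 x = convolution chi0 p0 x + convolution chi1 p1 x) ->
  forall x,
  dconv F (convolution (dilate f0 j.+1) phi) x - dconv F (convolution (dilate f0 j) phi) x =
  2 ^- (j * 2) *
    (convolution (dconv F (dilate chi0 j)) (convolution (dilate p0 j) (laplacian phi)) x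
   + convolution (dconv F (dilate chi1 j)) (convolution (dilate p1 j) (laplacian phi)) x).
Proof.
move=> hF sc0 cN0 sc1 cN1 sf0 fN0 sp0 pN0 sp1 pN1 sphi phiM fE pE x.
have [sl lN] := laplacian_test sp0 pN0; have [seta etaM] := laplacian_test sphi phiM.
have Lphi := test_loc_lip sphi phiM.
have D f K : smooth f -> csupp K f -> [/\ smooth (dilate f j), csupp K (dilate f j) & loc_lip (dilate f j)].
  move=> sf fK; split; [exact: (Csmooth_dilate j sf).1|exact: csupp_dilate|].
  exact/loc_lip_dilate/(test_loc_lip sf fK).
have [s1 n1 l1] := D _ _ sf0 fN0; have [s2 n2 l2] := D _ _ sl lN.
have [s3 n3 l3] := D _ _ sp0 pN0; have [s4 n4 l4] := D _ _ sp1 pN1.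
have [s5 n5 l5] := D _ _ sc0 cN0; have [s6 n6 l6] := D _ _ sc1 cN1.
have E1 : convolution (dilate f0 j.+1) phi = (fun x =>
    2 ^- (j * 2) * convolution (dilate p0 j) (laplacian phi) x + convolution (dilate f0 j) phi x).
  rewrite (funext (dilateS j fE)) convolutionC//; last exact: loc_lip_lin.
  rewrite (convolution_linr 1 Lphi phiM l2 l1).
  apply/funext => y; rewrite mul1r [convolution phi (dilate (laplacian _) _)]convolutionC//.
  by rewrite (convolution_laplacian_dilate j sp0 pN0 sphi phiM) [convolution phi _]convolutionC.
have [s7 _] := convolution_smooth l3 n3 seta etaM; have n7 := csupp_convolution n3 etaM.
have [s8 _] := convolution_smooth l1 n1 sphi phiM; have n8 := csupp_convolution n1 phiM.
rewrite E1 (dconv_linear _ hF s7 n7 s8 n8) addrK; congr (_ * _).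
rewrite (dconv_decomposition hF s5 n5 s6 n6 s3 n3 s4 n4 seta etaM)// => y.
rewrite (dilateD j pE).
rewrite (convolution_dilate j (test_loc_lip sc0 cN0) cN0 (test_loc_lip sp0 pN0)).
by rewrite (convolution_dilate j (test_loc_lip sc1 cN1) cN1 (test_loc_lip sp1 pN1)).
Qed.

End telescoping.

Section sufficiency.
Context {R : realType} {d : nat}.
Local Notation Rd := 'rV[R]_d.
Local Notation C := R[i].
Local Notation leb := (@lebesgue_rV R d).
Local Notation normc := Normc.normc.
Implicit Types (f g phi psi : Rd -> C) (a : C) (x y : Rd) (s : seq 'I_d).

(** (wM) uses the Euclidean norm, the matrix norm is the supremum norm. Each of the d squares is at
    most 1/(d+1); the denominator d + 1 also covers d = 0. *)
Lemma euclidean_norm_small (y : Rd) : `|y| <= d.+1%:R^-1 -> euclidean_norm y <= 1.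
Proof.
move=> yd; rewrite /euclidean_norm -[leRHS]sqrtr1 ler_wsqrtr//.
have d0 : 0 < d.+1%:R :> R by [].
apply: (@le_trans _ _ (\sum_(i < d) d.+1%:R^-1)); last first.
  by rewrite sumr_const card_ord -[leLHS]mulr_natr mulrC ler_pdivrMr// mul1r ler_nat.
apply: ler_sum => i _; rewrite -real_normK ?num_real// expr2.
have yi : `|y 0 i| <= d.+1%:R^-1 by apply: le_trans yd; exact: coord_le_norm.
apply: (@le_trans _ _ (1 * d.+1%:R^-1)); last by rewrite mul1r.
by apply: ler_pM => //; rewrite (le_trans yi)// invf_le1 ?ler1n ?ltr0n.
Qed.

(** A shift of length N is made in N(d+1) equal steps, each short enough for (wM); every step raises
    the index and multiplies the constants. *)
Lemma wM_iter (w : nat -> Rd -> R) : wM w -> forall (N n : nat),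
  exists m (c : R), 0 < c /\ forall x y, `|y| <= N%:R -> w n (x + y) <= c * w m x.
Proof.
move=> hw N n.
suff H k : exists m (c : R), 0 < c /\
    forall x y, `|y| <= k%:R / d.+1%:R -> w n (x + y) <= c * w m x.
  have [m [c [c0 Hc]]] := H (N * d.+1)%N; exists m, c; split=> // x y yN.
  by apply: Hc; rewrite natrM mulfK.
elim: k n => [|k IH] n.
  exists n, 1; split=> // x y; rewrite mul0r normr_le0 => /eqP ->.
  by rewrite addr0 mul1r.
have [m [c [_ c0 Hm]]] := hw n; have [m' [c' [c'0 Hm']]] := IH m.
exists m', (c * c'); split; first exact: mulr_gt0.
move=> x y yk; set t : R := k.+1%:R^-1.
have t0 : 0 <= t by rewrite invr_ge0.
have kt : k.+1%:R * t = 1 by rewrite mulfV.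
have d0 : 0 < d.+1%:R :> R by [].
have yE : x + y = (x + (k%:R * t) *: y) + t *: y.
  rewrite -addrA -scalerDl; congr (_ + _).
  have -> : k%:R * t + t = k.+1%:R * t by rewrite -natr1; ring.
  by rewrite kt scale1r.
rewrite yE (le_trans (Hm _ _ _))//.
  apply: euclidean_norm_small; rewrite normrZ (ger0_norm t0).
  rewrite (le_trans (ler_wpM2l t0 yk))// mulrA [t * _]mulrC kt mul1r.
  exact: lexx.
rewrite -mulrA (ler_wpM2l (ltW c0))// Hm'// normrZ ger0_norm ?mulr_ge0//.
have kt0 : 0 <= k%:R * t by rewrite mulr_ge0.
rewrite (le_trans (ler_wpM2l kt0 yk))// le_eqVlt; apply/orP; left; apply/eqP.
by rewrite -mulrA [t * _]mulrA [t * _]mulrC kt mul1r.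
Qed.

(** The f_j form an approximate identity, so f_j * phi tends to phi in D at rate 2^(-j), and F is
    continuous. [K] may depend on x, as the limit in E is identified pointwise. *)
Lemma dconv_dilate_cvg (F : (Rd -> C) -> C) N M f phi : is_distribution F ->
  smooth f -> csupp N f -> Cintegral f = 1 -> smooth phi -> csupp M phi ->
  forall x, exists2 K : R, 0 <= K & forall j,
    normc (dconv F (convolution (dilate f j) phi) x - dconv F phi x) <= K / 2 ^+ j.
Proof.
move=> hF sf fN f1 sphi phiM x; have Lf := test_loc_lip sf fN.
pose N' := Num.bound (`|x| + (N + M)%N%:R).
have xN' : `|x| + (N + M)%N%:R <= N'%:R by rewrite ltW// archi_boundP// addr_ge0.
have [Mc Mc0 [k HM]] := distribution_bound hF N'.
have [K K0 HK] := convolution_dilate_id Lf fN f1.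
have [G [l Hl]] := test_lip k sphi phiM; have [_ l0 _ _] := Hl [::] 0 isT.
exists (Mc * (K * l)) => [|j]; first by rewrite !mulr_ge0.
have [sd _] := Csmooth_dilate j sf; have dN := csupp_dilate j fN.
have Ld := test_loc_lip sd dN.
have [sc dc] := convolution_smooth Ld dN sphi phiM; have cN := csupp_convolution dN phiM.
have [s1 d1] := Csmooth_reflect x sc; have [s2 d2] := Csmooth_reflect x sphi.
have n1 := csupp_reflect cN xN'.
have n2 : csupp N' (fun y => phi (x - y)).
  apply: csupp_reflect phiM _; apply: le_trans xN'.
  by rewrite lerD2l ler_nat leq_addl.
rewrite /dconv -(distributionB hF); [|by apply/test_funP; split=> //; exists N'..].
have [s3 d3] := Csmooth_linear (-1) s2 s1.
have E3 : (fun y => convolution (dilate f j) phi (x - y) - phi (x - y)) =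
   (fun y => -1 * phi (x - y) + convolution (dilate f j) phi (x - y)).
  by apply/funext => z; rewrite mulN1r addrC.
rewrite E3 -mulrA; apply: HM => //.
  by move=> z Nz; rewrite n1// n2// mulr0 addr0.
move=> s z sk; rewrite d3 d1 d2 mulN1r addrC -mulrBr normc_signM dc.
apply: HK => //.
  by move=> X; exists G, l; exact: Hl.
move=> y y'; have [_ _ _ H] := Hl s (`|y| + `|y'|) sk.
by apply: H; rewrite ?lerDl ?lerDr.
Qed.

Context (E : completeNormedModType C) (rep : E -> Rd -> C).
Context (hE : TIBF_bounded rep).
Context (hsolid : solid rep).

Lemma dconv_L1loc (F : (Rd -> C) -> C) N phi : is_distribution F ->
  smooth phi -> csupp N phi -> L1loc (dconv F phi).
Proof.
move=> hF sphi phiN.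
have w1 : weight (fun _ : Rd => 1 : R).
  split=> //; first by move=> K _; exists 1.
  by exists (fun=> 1) => //; exact: aeW.
have := @weighted_L1loc R d _ _ (fun=> 1) (dconv_loc_lip hF sphi phiN) w1 (measurable_cst _).
rewrite (_ : weighted _ _ = dconv F phi); first by apply; exact: aeW.
by apply/funext => x; rewrite /weighted mulr1.
Qed.

(** Replaces the real exponent r by a natural number above it, which can be compared with a number
    of vanishing moments. *)
Lemma bounded_growth (F : (Rd -> C) -> C) (chi0 chi1 : Rd -> C) (r : R) (wm : Rd -> R) :
  bounded_in_E rep [set g | exists (j : nat) (chi : Rd -> C),
        (chi = chi0 \/ chi = chi1) /\
        g = (fun x => (2 `^ (- (r * j%:R)))%:C * weighted (dconv F (dilate chi j)) wm x)] ->
  exists (L : nat) (M : R), 0 <= M /\ forall j chi, chi = chi0 \/ chi = chi1 ->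
    exists2 u, (\forall x \ae leb, rep u x = weighted (dconv F (dilate chi j)) wm x) &
      normE u <= M * 2 ^+ (j * L).
Proof.
move=> [M HM]; exists (Num.bound `|r|), `|M|; split=> // j chi hchi.
have [u /aeE ru uM] := HM _ (ex_intro _ j (ex_intro _ chi (conj hchi erefl))).
exists ((2 `^ (r * j%:R))%:C *: u).
  apply: filterS2 (repZ hE (2 `^ (r * j%:R))%:C u) ru => x -> ->.
  by rewrite mulrA -rmorphM/= powRN mulfV ?mul1r// gt_eqF// powR_gt0.
rewrite normEZ normcR ger0_norm ?powR_ge0// mulrC.
have uM' : normE u <= `|M|.
  by rewrite (le_trans _ (ler_norm M))// -lecR -normEE.
rewrite ler_pM ?normE_ge0 ?powR_ge0//.
rewrite -powR_mulrn// ler_powR ?ler1n// natrM mulrC ler_wpM2l//.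
by rewrite (le_trans (ler_norm r))// ltW// archi_boundP.
Qed.

Lemma sufficiency (w : nat -> Rd -> R) (hw : weight_system w) (hwM : wM w)
    (chi0 chi1 : Rd -> C) (hchi0 : test_fun chi0) (hchi1 : test_fun chi1)
    (hMDFP : MDFP chi0 chi1) (F : (Rd -> C) -> C) (hF : is_distribution F) :
  (forall n : nat, exists2 r : R, 0 < r &
      bounded_in_E rep [set g | exists (j : nat) (chi : Rd -> C),
        (chi = chi0 \/ chi = chi1) /\
        g = (fun x => (2 `^ (- (r * j%:R)))%:C
                      * weighted (dconv F (dilate chi j)) (w n) x)]) ->
  OC' rep w F.
Proof.
move=> H3; split=> // phi /test_funP[sphi [M phiM]].
split=> [|n]; first exact: dconv_L1loc hF sphi phiM.
have [K0 /compact_sub_ball[N K0N] [ph0 [ph1 [ps0 [ps1 HL]]]]] := hMDFP.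
have [sc0 [N0 c0N]] := (test_funP chi0).1 hchi0.
have [sc1 [N1 c1N]] := (test_funP chi1).1 hchi1.
have [m [c [c_gt0 wnm]]] := wM_iter hwM (N + M) n.
have wnm' x y : `|x - y| <= (N + M)%N%:R -> w n x <= c * w m y.
  by move=> xy; rewrite -[x](subrK y) [_ + y]addrC wnm.
have [K K_ge0 HK] := E_convolution hE hsolid (ltW c_gt0) (weight_system_weight hw n) wnm'.
have [r r_gt0 /bounded_growth[L [Mb [Mb0 HM]]]] := H3 m.
(* One moment more than the growth exponent: the decay 2^(-j(L+1)) against the growth 2^(jL) leaves
   2^(-j), and the series is geometric. *)
have [_ [T0 T1 T2 T3] [v0 v1] [dE i1] [fE pE]] := HL L.+1.
have [sf0 f0N] := test_fun_on_csupp K0N T0; have [sf1 f1N] := test_fun_on_csupp K0N T1.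
have [sp0 p0N] := test_fun_on_csupp K0N T2; have [sp1 p1N] := test_fun_on_csupp K0N T3.
have [seta etaM] := laplacian_test sphi phiM.
(* Bound for one product (f * chi_j) * (psi * eta): the first factor is controlled in E with the
   weight [w m], the second by its supremum [A]. *)
have piece j chi psi eta A : chi = chi0 \/ chi = chi1 -> smooth psi -> csupp N psi ->
    smooth eta -> csupp M eta -> 0 <= A -> (forall x, normc (convolution psi eta x) <= A) ->
    exists2 v, (\forall x \ae leb, rep v x =
       weighted (convolution (dconv F (dilate chi j)) (convolution psi eta)) (w n) x) &
     normE v <= K * A * (Mb * 2 ^+ (j * L)).
  move=> hchi sp pN se eM A0 HA.
  have [u ru uM] := HM j chi hchi.
  have [Nc [sc cN]] : exists Nc, smooth chi /\ csupp Nc chi.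
    by case: hchi => ->; [exists N0|exists N1].
  have [sd _] := Csmooth_dilate j sc; have dN := csupp_dilate j cN.
  have [spe _] := convolution_smooth (test_loc_lip sp pN) pN se eM.
  have peN := csupp_convolution pN eM.
  have Lg : loc_lip (dconv F (dilate chi j)) by exact: (dconv_loc_lip hF sd dN).
  have Lc : loc_lip (convolution (dconv F (dilate chi j)) (convolution psi eta)).
    rewrite -(dconv_convolution3 hF sd dN sp pN se eM).
    have [s1 _] := convolution_smooth (test_loc_lip sd dN) dN sp pN.
    have n1 := csupp_convolution dN pN.
    have [s2 _] := convolution_smooth (test_loc_lip s1 n1) n1 se eM.
    exact: (dconv_loc_lip hF s2 (csupp_convolution n1 eM)).
  have [v rv vK] := HK _ _ A u Lg (test_loc_lip spe peN) peN Lc A0 HA ru.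
  exists v => //; rewrite (le_trans vK)// ler_wpM2l//; exact: mulr_ge0.
have [Q0 Q0_ge0 HQ0] := convolution_moments (test_loc_lip sp0 p0N) p0N v0 seta etaM.
have [Q1 Q1_ge0 HQ1] := convolution_moments (test_loc_lip sp1 p1N) p1N v1 seta etaM.
have test_bd psi : smooth psi -> csupp N psi ->
    exists2 A : R, 0 <= A & forall x, normc (convolution psi phi x) <= A.
  move=> sp pN; have [s1 _] := convolution_smooth (test_loc_lip sp pN) pN sphi phiM.
  have n1 := csupp_convolution pN phiM; have [G [l HG]] := test_lip 0 s1 n1.
  exists G; first by case: (HG [::] 0 isT).
  by move=> x; have [_ _ + _] := HG [::] `|x| isT; rewrite Cpderiv_nil; apply.
have [A0 A0_ge0 HA0] := test_bd _ sf0 f0N; have [A1 A1_ge0 HA1] := test_bd _ sf1 f1N.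
pose T j := dconv F (convolution (dilate (ph0 L.+1) j) phi).
pose t i := if i is j.+1 then (fun x => T j.+1 x - T j x) else T 0%N.
have tsum n' x : \sum_(i < n'.+1) t i x = T n' x.
  elim: n' => [|n' IH]; first by rewrite big_ord_recl big_ord0 addr0.
  by rewrite big_ord_recr/= IH addrC subrK.
(* The first summand is for the initial term, the second for the differences; its factor 2 appears
   because the difference of index j, of size 2^(-j), is the term number j + 1 of the series. *)
pose B := (K * A0 * Mb + K * A1 * Mb) + 2 * (K * Q0 * Mb + K * Q1 * Mb).
have B1 : 0 <= K * A0 * Mb + K * A1 * Mb by rewrite addr_ge0// !mulr_ge0.
have B2 : 0 <= 2 * (K * Q0 * Mb + K * Q1 * Mb) by rewrite mulr_ge0// addr_ge0// !mulr_ge0.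
have /choice[u Hu] : forall i, exists u, normE u <= B / 2 ^+ i /\
   \forall x \ae leb, rep u x = weighted (t i) (w n) x.
  move=> [|j].
    have [v rv vK] := piece 0%N _ _ _ _ (or_introl erefl) sf0 f0N sphi phiM A0_ge0 HA0.
    have [v' rv' vK'] := piece 0%N _ _ _ _ (or_intror erefl) sf1 f1N sphi phiM A1_ge0 HA1.
    exists (1 *: v + v'); split.
      rewrite expr0 divr1 (le_trans (normED _ _))// normEZ Normc.normc1 mul1r.
      rewrite (le_trans (lerD vK vK'))// mul0n expr0 !mulr1 /B lerDl//.
    apply: filterS3 (rep_linear hE 1 v v') rv rv' => x -> -> ->.
    rewrite mul1r /weighted -mulrDl; congr (_ * _); rewrite /t /T.
    have dil0 g : dilate g 0 = g.
      by apply/funext => y; rewrite /dilate mul0n !expr0 mul1r scale1r.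
    by rewrite !dil0 (dconv_decomposition hF sc0 c0N sc1 c1N sf0 f0N sf1 f1N sphi phiM fE).
  have Qj (Q : R) : 0 <= Q -> 0 <= Q / 2 ^+ (j * L.+1) by move=> ?; rewrite divr_ge0// exprn_ge0.
  have [sd0 _] := Csmooth_dilate j sp0; have dN0 := csupp_dilate j p0N.
  have [sd1 _] := Csmooth_dilate j sp1; have dN1 := csupp_dilate j p1N.
  have [v rv vK] := piece j _ _ _ _ (or_introl erefl) sd0 dN0 seta etaM (Qj _ Q0_ge0) (HQ0 j).
  have [v' rv' vK'] := piece j _ _ _ _ (or_intror erefl) sd1 dN1 seta etaM (Qj _ Q1_ge0) (HQ1 j).
  exists (2 ^- (j * 2) *: (1 *: v + v')); split.
    have QE Q : K * (Q / 2 ^+ (j * L.+1)) * (Mb * 2 ^+ (j * L)) = K * Q * Mb / 2 ^+ j.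
      by rewrite mulnS exprD; field; rewrite !expf_neq0.
    rewrite normEZ.
    (* The gain 2^(-2j) from the Laplacian is given away; the additional moment suffices. *)
    have n1 : normc (2 ^- (j * 2) : C) <= 1.
      rewrite Normc.normcV real2X normcR ger0_norm ?exprn_ge0//.
      by rewrite invf_le1 ?exprn_gt0// exprn_ege1// ler1n.
    rewrite (le_trans (ler_wpM2r (normE_ge0 _) n1))// mul1r.
    rewrite (le_trans (normED _ _))// normEZ Normc.normc1 mul1r.
    rewrite (le_trans (lerD vK vK'))// !QE -mulrDl.
    have -> : (K * Q0 * Mb + K * Q1 * Mb) / 2 ^+ j =
       2 * (K * Q0 * Mb + K * Q1 * Mb) / 2 ^+ j.+1.
      by rewrite exprS; field; rewrite expf_neq0.
    by rewrite ler_wpM2r ?invr_ge0 ?exprn_ge0// /B lerDr.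
  apply: filterS3 (repZ hE (2 ^- (j * 2)) (1 *: v + v')) (rep_linear hE 1 v v')
    (filterI rv rv') => x -> -> [-> ->].
  rewrite mul1r /weighted -mulrDl mulrA; congr (_ * _).
  rewrite /t /T.
  by rewrite (dconv_step j hF sc0 c0N sc1 c1N sf0 f0N sp0 p0N sp1 p1N sphi phiM dE pE).
have [x eps eps0|v rv _] := E_limit hE (addr_ge0 B1 B2) (fun i => (Hu i).1) (fun i => (Hu i).2)
  (G := weighted (dconv F phi) (w n)).
  have [D D0 HD] := dconv_dilate_cvg hF sf0 f0N i1 sphi phiM x.
  have wn0 : 0 <= w n x by exact: le_trans (weight_ge1 (weight_system_weight hw n) x).
  have [k0 Hk0] := geometric_small (mulr_ge0 D0 wn0) eps0.
  exists k0.+1 => -[//|k]; rewrite ltnS => kk0.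
  rewrite /weighted -mulr_suml tsum -mulrBl Normc.normcM normcR (ger0_norm wn0).
  by rewrite (le_trans (ler_wpM2r wn0 (HD k)))// mulrAC ltW// Hk0.
by exists v; apply/aeE.
Qed.


End sufficiency.

(** * The closed graph theorem on D(K) *)

Section test_space.
Context {R : realType} {d : nat}.
Local Notation Rd := 'rV[R]_d.
Local Notation C := R[i].
Local Notation normc := Normc.normc.
Local Notation Re := complex.Re.
Local Notation Im := complex.Im.
Implicit Types (f g phi psi : Rd -> C) (a : C) (x y : Rd) (s : seq 'I_d).

Lemma geometric_tail (u : nat -> R) m (D : R) : 0 <= D ->
  (forall i, `|u (m + i)%N| <= D / 2 ^+ i) ->
  cvgn (series u) /\ `|limn (series u) - \sum_(i < m) u i| <= 2 * D.
Proof.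
move=> D0 uD.
have bound p q : (p <= q)%N -> `|\sum_(m + p <= i < m + q) u i| <= 2 * D / 2 ^+ p.
  move=> pq; apply: le_trans (sumr_geo D0 pq).
  elim: q pq => [|q IH]; first by rewrite leqn0 => /eqP ->; rewrite !big_geq ?normr0.
  rewrite leq_eqVlt => /orP[/eqP ->|]; first by rewrite !big_geq ?normr0.
  rewrite ltnS => pq; rewrite addnS !big_nat_recr ?leq_add2l//=.
  by rewrite (le_trans (ler_normD _ _))// lerD ?IH.
have cu : cvgn (series u).
  apply/cauchy_cvgP/cauchy_seriesP => eps eps0.
  have [n0 Hn0] := geometric_small (mulr_ge0 (ler0n R 2) D0) eps0.
  exists ([set k | (m + n0 <= k)%N], [set k | (m + n0 <= k)%N]).
    by split; exists (m + n0)%N.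
  move=> [k l] /= [kn ln].
  have [lk|/ltnW kl] := leqP l k; first by rewrite big_geq// normr0.
  have mk : (m <= k)%N by apply: leq_trans kn; exact: leq_addr.
  have ml : (m <= l)%N by apply: leq_trans kl.
  rewrite -(subnKC mk) -(subnKC ml) (le_lt_trans (bound _ _ _)) ?leq_sub2r//.
  by rewrite Hn0// leq_subRL.
split=> //; apply/ler_addgt0Pr => eps eps0.
have /cvgrPdist_lt/(_ _ eps0)[k _ Hk] := cu.
have := Hk (maxn k m) (leq_maxl _ _); rewrite /= => /ltW H1.
have -> : limn (series u) - \sum_(i < m) u i =
   (limn (series u) - series u (maxn k m)) + \sum_(m <= i < maxn k m) u i.
  rewrite /series/= [X in _ - X + _](big_cat_nat (n := m) (leq0n m) (leq_maxr k m))/= big_mkord.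
  by rewrite opprD addrA subrK.
rewrite (le_trans (ler_normD _ _))// addrC lerD//.
have := bound 0%N (maxn k m - m)%N (leq0n _).
by rewrite addn0 subnKC ?leq_maxr// expr0 divr1.
Qed.

Lemma CsmoothB f g : smooth f -> smooth g -> smooth (fun x => f x - g x) /\
  forall s, Cpderiv s (fun x => f x - g x) = (fun x => Cpderiv s f x - Cpderiv s g x).
Proof.
move=> sf sg; have [s1 d1] := Csmooth_linear (-1) sg sf.
have E (h k : Rd -> C) : (fun x => h x - k x) = (fun x => -1 * k x + h x).
  by apply/funext => x; rewrite mulN1r addrC.
by rewrite E; split=> // s; rewrite d1 E.
Qed.

Definition testN N f := smooth f /\ csupp N f.

(** The seminorms of D(K), expressed through upper bounds so that suprema need not be formed. *)
Definition Ck_le k f (B : R) := forall s x, (size s <= k)%N -> normc (Cpderiv s f x) <= B.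

Lemma testN0 N : testN N (fun=> 0).
Proof. by split; [exact: Csmooth0.1|]. Qed.

Lemma testNB N f g : testN N f -> testN N g -> testN N (fun x => f x - g x).
Proof.
move=> [sf fN] [sg gN]; split; first exact: (CsmoothB sf sg).1.
by move=> x Nx; rewrite fN// gN// subr0.
Qed.

Lemma testNZ N a f : testN N f -> testN N (fun x => a * f x).
Proof.
move=> [sf fN]; split; first exact: (Csmooth_scale a sf).1.
by move=> x Nx; rewrite fN// mulr0.
Qed.

Lemma Ck_leW k k' f (B B' : R) : (k' <= k)%N -> B <= B' -> Ck_le k f B -> Ck_le k' f B'.
Proof. by move=> kk BB H s x sk; apply: le_trans BB; apply: H; exact: leq_trans kk. Qed.

Lemma Ck_leB k f g (B B' : R) : smooth f -> smooth g -> Ck_le k f B -> Ck_le k g B' ->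
  Ck_le k (fun x => f x - g x) (B + B').
Proof.
move=> sf sg fB gB s x sk; rewrite (CsmoothB sf sg).2.
by rewrite (le_trans (le_normcD _ _))// normcN lerD ?fB ?gB.
Qed.

Lemma Ck_leZ k a f (B : R) : smooth f -> Ck_le k f B ->
  Ck_le k (fun x => a * f x) (normc a * B).
Proof.
move=> sf fB s x sk; rewrite (Csmooth_scale a sf).2 Normc.normcM.
by rewrite ler_wpM2l ?normc_ge0// fB.
Qed.

(** Completeness of D(K) for series whose bounds halve while the number of controlled derivatives
    grows. In 4 D m one factor 2 is the geometric sum, the other comes from the real and imaginary
    parts. *)
Lemma testN_complete N (th : nat -> Rd -> C) (K : nat -> nat) (D : nat -> R) :
  (forall i, testN N (th i)) -> (forall i, (i <= K i)%N) ->
  {homo K : i j / (i <= j)%N} -> (forall i, 0 <= D i) ->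
  (forall i, D i.+1 <= D i / 2) -> (forall i, Ck_le (K i) (th i) (D i)) ->
  exists2 f, testN N f & forall m, Ck_le (K m) (fun x => f x - \sum_(i < m) th i x) (4 * D m).
Proof.
move=> tth Ki Kmono D0 DS thD.
have Dgeo m i : D (m + i)%N <= D m / 2 ^+ i.
  elim: i => [|i IH]; first by rewrite addn0 expr0 divr1.
  rewrite addnS (le_trans (DS _))// exprS invfM mulrCA mulrC ler_wpM2l//.
have sum_smooth m := Csmooth_sum (index_enum 'I_m) (fun=> 1) (fun i : 'I_m => (tth i).1).
pose U m x := \sum_(i < m) th i x.
have UE m : (fun x => \sum_(i < m) 1 * th i x) = U m.
  by apply/funext => x; apply: eq_bigr => i _; rewrite mul1r.
have sU m : smooth (U m) by have := (sum_smooth m).1; rewrite UE.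
have dU m s x : Cpderiv s (U m) x = \sum_(i < m) Cpderiv s (th i) x.
  have [_ /(_ s)] := sum_smooth m; rewrite UE => ->.
  by apply: eq_bigr => i _; rewrite mul1r.
pose ar s x i := Re (Cpderiv s (th i) x); pose ai s x i := Im (Cpderiv s (th i) x).
pose P s x := limn (series (ar s x)) +i* limn (series (ai s x)).
have tail m s x : (size s <= K m)%N -> normc (P s x - Cpderiv s (U m) x) <= 4 * D m.
  move=> sK.
  have thb i : normc (Cpderiv s (th (m + i)%N) x) <= D m / 2 ^+ i.
    apply: le_trans (Dgeo m i); apply: thD; apply: leq_trans sK _.
    exact/Kmono/leq_addr.
  have [|_ Hr] := @geometric_tail (ar s x) m (D m) (D0 m).
    by move=> i; apply: le_trans (thb i); exact: Re_le_normc.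
  have [|_ Hi] := @geometric_tail (ai s x) m (D m) (D0 m).
    by move=> i; apply: le_trans (thb i); exact: Im_le_normc.
  rewrite (le_trans (normc_le _))// dU ReD ImD ReN ImN Re_sum Im_sum /=.
  by rewrite (le_trans (lerD Hr Hi))//; lra.
have Deps (eps : R) : 0 < eps -> exists m, 4 * D m <= eps.
  move=> eps0; have [m Hm] := geometric_small (mulr_ge0 (ler0n R 4) (D0 0%N)) eps0.
  exists m; rewrite (le_trans _ (ltW (Hm m (leqnn m))))// -mulrA ler_wpM2l//.
  exact: (Dgeo 0%N m).
have Dmono m m' : (m <= m')%N -> D m' <= D m.
  move=> mm; rewrite -(subnKC mm) (le_trans (Dgeo _ _))//.
  by rewrite ler_pdivrMr ?exprn_gt0// ler_peMr// exprn_ege1// ler1n.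
have [||sP dP] := @Csmooth_limit R d U P.
- exact: sU.
- move=> s eps eps0; have [m0 Hm0] := Deps _ eps0.
  exists (maxn m0 (size s)) => m x; rewrite geq_max => /andP[m0m sm].
  rewrite -normcN opprB (le_trans (tail m s x _)) ?(leq_trans sm)//.
  by rewrite (le_trans _ Hm0)// ler_wpM2l// Dmono.
exists (P [::]).
  split=> // x Nx; have z m : Cpderiv [::] (U m) x = 0.
    by rewrite Cpderiv_nil /U big1// => i _; have [_ ->] := tth i.
  apply: Normc.eq0_normc; apply/eqP; rewrite eq_le normc_ge0 andbT.
  apply/ler_addgt0Pr => eps eps0; have [m Hm] := Deps _ eps0.
  by have := tail m [::] x (leq0n _); rewrite z subr0 add0r => /le_trans; exact.
move=> m s x sK; rewrite (CsmoothB sP (sU m)).2 dP; exact: tail.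
Qed.

End test_space.

(** * The operator phi |-> (f * phi) w_n from D(K) to E *)

Section closed_graph.
Context {R : realType} {d : nat}.
Local Notation Rd := 'rV[R]_d.
Local Notation C := R[i].
Local Notation leb := (@lebesgue_rV R d).
Local Notation normc := Normc.normc.
Implicit Types (f g phi psi : Rd -> C) (a : C) (x y : Rd) (s : seq 'I_d).
Context (E : completeNormedModType C) (rep : E -> Rd -> C).
Context (hE : TIBF_bounded rep).
Context (F : (Rd -> C) -> C) (wn : Rd -> R) (N : nat) (T : (Rd -> C) -> E).
Context (hF : is_distribution F).
Context (hT : forall phi, testN N phi ->
  \forall x \ae leb, rep (T phi) x = weighted (dconv F phi) wn x).

Let dconv_linearN a phi psi : testN N phi -> testN N psi ->
  dconv F (fun x => a * phi x + psi x) = (fun x => a * dconv F phi x + dconv F psi x).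
Proof. by move=> [s1 n1] [s2 n2]; exact: dconv_linear hF s1 n1 s2 n2. Qed.

Let subE phi psi : (fun x => phi x - psi x) = (fun x => -1 * psi x + phi x :> C).
Proof. by apply/funext => x; rewrite mulN1r addrC. Qed.

Let dconvB phi psi : testN N phi -> testN N psi ->
  dconv F (fun x => phi x - psi x) = (fun x => dconv F phi x - dconv F psi x).
Proof. by move=> t1 t2; rewrite subE dconv_linearN// -subE. Qed.

Let dconvZ a phi : testN N phi -> dconv F (fun x => a * phi x) = (fun x => a * dconv F phi x).
Proof.
move=> t1; apply/funext => x; have t0 := @testN0 R d N.
have := congr1 (fun u => u x) (dconv_linearN a t1 t0) => /=.
have -> : dconv F (fun=> 0) x = 0 by rewrite /dconv; exact: distribution0.
rewrite addr0 => <-; congr (dconv F _ x).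
by apply/funext => y; rewrite addr0.
Qed.

(** [T] comes from a mere choice of elements of E; it is linear because [rep] determines an
    element. *)
Lemma closed_graphB phi psi : testN N phi -> testN N psi ->
  T (fun x => phi x - psi x) = T phi - T psi.
Proof.
move=> t1 t2; apply: (rep_inj hE).
apply: filterS3 (hT (testNB t1 t2)) (rep_linear hE (-1) (T psi) (T phi))
  (filterI (hT t1) (hT t2)) => x -> + [e1 e2].
rewrite scaleN1r addrC => ->; rewrite e1 e2 dconvB// /weighted mulrBl mulN1r addrC.
by [].
Qed.

Lemma closed_graphZ a phi : testN N phi -> T (fun x => a * phi x) = a *: T phi.
Proof.
move=> t1; apply: (rep_inj hE).
apply: filterS3 (hT (testNZ a t1)) (repZ hE a (T phi)) (hT t1) => x -> -> ->.
by rewrite dconvZ// /weighted mulrA.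
Qed.

(* D(K) is a Frechet space and not a normed one: Baire's argument is carried out
   on nested seminorm balls. *)
Lemma closed_graph_baire : exists (M : nat) (phi0 : Rd -> C) (k : nat) (del : R),
  [/\ testN N phi0, 0 < del & forall phi, testN N phi ->
     Ck_le k (fun x => phi x - phi0 x) del ->
     forall k' (eps : R), 0 < eps -> exists th, [/\ testN N th, normE (T th) <= M%:R &
        Ck_le k' (fun x => th x - phi x) eps]].
Proof.
apply: contrapT => Hno.
(* A seminorm ball: its centre, the order of the derivatives that are controlled, and its radius. *)
pose state := ((Rd -> C) * nat * R)%type.
have stepP (p : nat * state) : exists st' : state,
    testN N p.2.1.1 -> 0 < p.2.2 ->
    [/\ testN N st'.1.1, Ck_le p.2.1.2 (fun x => st'.1.1 x - p.2.1.1 x) p.2.2,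
        [/\ (p.2.1.2 <= st'.1.2)%N, (p.1 < st'.1.2)%N, 0 < st'.2 & st'.2 <= p.2.2 / 2] &
        forall th, testN N th -> Ck_le st'.1.2 (fun x => th x - st'.1.1 x) (4 * st'.2) ->
          p.1%:R < normE (T th)].
  case: p => [M [[phi0 k] del]] /=.
  have [t0|] := pselect (testN N phi0); last by exists (phi0, k, del).
  have [d0|] := boolP (0 < del); last by exists (phi0, k, del).
  apply: contrapT => Hst; apply: Hno; exists M, phi0, k, del; split=> // phi tphi pk k' eps eps0.
  apply: contrapT => Hth; apply: Hst.
  (* The radius eps/4 is fitted to the constant 4 of [testN_complete], del/2 makes the radii halve,
     and [M.+1] forces the orders to tend to infinity. *)
  exists (phi, maxn k (maxn k' M.+1), Num.min (eps / 4) (del / 2)) => _ _ /=; split=> //.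
    split; [exact: leq_maxl|by rewrite !leq_max leqnn !orbT| |by rewrite ge_min lexx orbT].
    by rewrite lt_min !divr_gt0.
  move=> th tth th4; rewrite ltNge; apply/negP => thM; apply: Hth; exists th; split=> //.
  apply: Ck_leW th4; first by rewrite !leq_max leqnn orbT.
  by rewrite -ler_pdivlMl// mulrC ge_min lexx.
have /choice[step Hstep] := stepP.
pose s := fix s (i : nat) : state := if i is j.+1 then step (j, s j) else (fun=> 0, 0%N, 1).
have s_inv i : testN N (s i).1.1 /\ 0 < (s i).2.
  elim: i => [|i [IH1 IH2]] /=; first by split=> //; exact: testN0.
  by have [? _ [_ _ ? _] _] := Hstep (i, s i) IH1 IH2.
have Hs i := Hstep (i, s i) (s_inv i).1 (s_inv i).2.
pose th i x := (s i.+1).1.1 x - (s i).1.1 x.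
have [] := @testN_complete R d N th (fun i => (s i).1.2) (fun i => (s i).2).
- by move=> i; apply: testNB; [exact: (s_inv i.+1).1|exact: (s_inv i).1].
- by case=> // i; have [_ _ [_ + _ _] _] := Hs i.
- apply: homo_leq => [//|i j k|i]; first exact: leq_trans.
  by have [_ _ [+ _ _ _] _] := Hs i.
- by move=> i; apply/ltW; exact: (s_inv i).2.
- by move=> i; have [_ _ [_ _ _ +] _] := Hs i.
- by move=> i; have [_ + _ _] := Hs i.
move=> f tf Hf.
have sumE m x : \sum_(i < m) th i x = (s m).1.1 x.
  elim: m => [|m IH]; first by rewrite big_ord0.
  by rewrite big_ord_recr/= IH /th addrC subrK.
(* The limit f is close to every centre, so [normE (T f)] exceeds every natural number, in
   particular this one. *)
pose m := Num.bound (normE (T f)).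
have [_ _ _ /(_ f tf)] := Hs m.
have -> : (fun x => f x - (step (m, s m)).1.1 x) = (fun x => f x - \sum_(i < m.+1) th i x).
  by apply/funext => x; rewrite sumE.
move=> /(_ (Hf m.+1)) /=; rewrite ltNge => /negP; apply.
by rewrite ltW// archi_boundP// normE_ge0.
Qed.

(** Recentres the ball of the Baire step at 0: phi/t is the difference of phi0 + phi/t and phi0,
    both of which are approximated with bound M. The difference gives 2M, and homogeneity the factor
    t. *)
Lemma closed_graph_approx : exists (M : R) (k : nat) (del : R),
  [/\ 0 <= M, 0 < del & forall phi (t : R), 0 < t -> testN N phi -> Ck_le k phi (t * del) ->
     forall k' (eps : R), 0 < eps -> exists th, [/\ testN N th, normE (T th) <= t * M &
        Ck_le k' (fun x => phi x - th x) eps]].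
Proof.
have [M [phi0 [k [del [t0 del0 H]]]]] := closed_graph_baire.
exists (M%:R + M%:R), k, del; split=> // phi t tpos tphi pk k' eps eps0.
have t1 : testN N (fun x => t^-1%:C * phi x) by exact: testNZ.
have e2 : 0 < eps / t / 2 by rewrite !divr_gt0.
have [|th2 [tth2 th2M th2k]] := H phi0 t0 _ k' _ e2.
  move=> s x sk; rewrite (_ : (fun x => phi0 x - phi0 x) = (fun=> 0)); last first.
    by apply/funext => y; rewrite subrr.
  by rewrite Csmooth0.2 Normc.normc0 ltW.
pose phi1 x := t^-1%:C * phi x - (0 - phi0 x).
have t1' : testN N phi1 by apply: testNB => //; exact: testNB (@testN0 R d N) t0.
have [|th1 [tth1 th1M th1k]] := H phi1 t1' _ k' _ e2.
  rewrite (_ : (fun x => phi1 x - phi0 x) = (fun x => t^-1%:C * phi x)); last first.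
    by apply/funext => y; rewrite /phi1 sub0r opprK addrK.
  have := Ck_leZ t^-1%:C tphi.1 pk; rewrite normcR ger0_norm ?invr_ge0 ?ltW//.
  by rewrite mulrA mulVf ?gt_eqF// mul1r.
exists (fun x => t%:C * (th1 x - th2 x)); split.
- exact/testNZ/testNB.
- rewrite closed_graphZ; last exact: testNB.
  rewrite closed_graphB// normEZ normcR gtr0_norm// (ler_wpM2l (ltW tpos))//.
  by rewrite (le_trans (normED _ _))// normEN lerD.
have -> : (fun x => phi x - t%:C * (th1 x - th2 x)) =
   (fun x => (- t)%:C * ((th1 x - phi1 x) - (th2 x - phi0 x))).
  apply/funext => x; rewrite /phi1 rmorphN/=.
  have tt : t%:C * t^-1%:C = 1 :> C by rewrite -rmorphM/= mulfV// gt_eqF.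
  have tp : phi x = t%:C * (t^-1%:C * phi x) by rewrite mulrA tt mul1r.
  by rewrite {1}tp; ring.
have sB1 := (CsmoothB tth1.1 t1'.1).1; have sB2 := (CsmoothB tth2.1 t0.1).1.
have := Ck_leZ (- t)%:C (CsmoothB sB1 sB2).1 (Ck_leB sB1 sB2 th1k th2k).
rewrite normcR normrN gtr0_norm//; apply: Ck_leW => //.
by rewrite -splitr mulrC divfK// gt_eqF.
Qed.

(** Successive approximation: the error left by one approximant is approximated at half the scale.
    The approximants sum to T phi in E with norm at most 2 t M, where t = B/del. *)
Lemma closed_graph : exists (k : nat) (K : R), 0 <= K /\
  forall phi (B : R), testN N phi -> 0 < B -> Ck_le k phi B -> normE (T phi) <= K * B.
Proof.
have [M [k [del [M0 del0 H]]]] := closed_graph_approx.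
exists k, (2 * M / del); split; first by rewrite !mulr_ge0// invr_ge0 ltW.
move=> phi B tphi B0 pB; pose t := B / del; have t0 : 0 < t by rewrite divr_gt0.
have tdel : t * del = B by rewrite /t divfK// gt_eqF.
have ti i : 0 < t / 2 ^+ i by rewrite divr_gt0// exprn_gt0.
have stepP (p : nat * (Rd -> C)) : exists th, testN N p.2 -> Ck_le k p.2 (t / 2 ^+ p.1 * del) ->
   [/\ testN N th, normE (T th) <= t / 2 ^+ p.1 * M &
     (* Order [k] keeps the iteration going; order [p.1], growing with the step, makes the
        remainders tend to 0 in D(K), so that F applied to them tends to 0. *)
     Ck_le (maxn k p.1) (fun x => p.2 x - th x) (t / 2 ^+ p.1.+1 * del)].
  case: p => [i rho] /=; have [tr|] := pselect (testN N rho); last by exists rho.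
  have [rk|] := pselect (Ck_le k rho (t / 2 ^+ i * del)); last by exists rho.
  have [th [? ? ?]] := H rho _ (ti i) tr rk (maxn k i) _ (mulr_gt0 (ti i.+1) del0).
  by exists th.
have /choice[step Hstep] := stepP.
pose rho := fix rho (i : nat) : Rd -> C :=
  if i is j.+1 then (fun x => rho j x - step (j, rho j) x) else phi.
have inv i : testN N (rho i) /\ Ck_le k (rho i) (t / 2 ^+ i * del).
  elim: i => [|i [IH1 IH2]] /=; first by split=> //; rewrite expr0 divr1 tdel.
  have [h1 _ h2] := Hstep (i, rho i) IH1 IH2; split; first exact: testNB.
  exact: Ck_leW (leq_maxl _ _) (lexx _) h2.
have Hs i := Hstep (i, rho i) (inv i).1 (inv i).2.
pose th i := step (i, rho i).
have tth i : testN N (th i) by have [] := Hs i.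
have tM0 : 0 <= t * M by rewrite mulr_ge0// ltW.
have rhoE n x : dconv F (rho n) x = dconv F phi x - \sum_(i < n) dconv F (th i) x.
  elim: n => [|n IH]; first by rewrite big_ord0 subr0.
  rewrite /= (dconvB (inv n).1 (tth n)) IH big_ord_recr/= opprD addrA.
  by [].
have [i|x eps eps0|v rv vM] := E_limit hE tM0 _ (fun i => hT (tth i))
   (G := weighted (dconv F phi) wn).
- by have [_ + _] := Hs i; rewrite mulrAC.
- pose N' := Num.bound (`|x| + N%:R).
  have xN' : `|x| + N%:R <= N'%:R by rewrite ltW// archi_boundP// addr_ge0.
  have [Mc Mc0 [kF HM]] := distribution_bound hF N'.
  pose Q := Mc * (t * del) * `|wn x|.
  have Q0 : 0 <= Q by rewrite mulr_ge0// mulr_ge0// ltW// mulr_gt0.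
  have [n0 Hn0] := geometric_small Q0 eps0.
  exists (maxn kF n0).+1 => -[//|n]; rewrite ltnS geq_max => /andP[kn n0n].
  rewrite /weighted -mulr_suml -mulrBl -opprB -rhoE mulNr normcN Normc.normcM normcR.
  have rb : normc (dconv F (rho n.+1) x) <= Mc * (t / 2 ^+ n.+1 * del).
    have [sr rN] := (inv n.+1).1; have [s1 d1] := Csmooth_reflect x sr.
    apply: HM => //; first exact: csupp_reflect rN xN'.
    move=> s y sk; rewrite d1 normc_signM.
    have [_ _ h2] := Hs n; apply: h2; apply: leq_trans sk _.
    exact: leq_trans kn (leq_maxr _ _).
  rewrite (le_trans (ler_wpM2r (normr_ge0 _) rb))//.
  have -> : Mc * (t / 2 ^+ n.+1 * del) * `|wn x| = Q / 2 ^+ n.+1.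
    by rewrite /Q; ring.
  by rewrite ltW// Hn0// leqW.
have <- : v = T phi.
  by apply: (rep_inj hE); apply: filterS2 rv (hT tphi) => x -> ->.
by rewrite (le_trans vM)// /t le_eqVlt; apply/orP; left; apply/eqP; ring.
Qed.

End closed_graph.

(** * From (i) to (ii), and the common exponent in (iii) *)

Section necessity.
Context {R : realType} {d : nat}.
Local Notation Rd := 'rV[R]_d.
Local Notation C := R[i].
Local Notation leb := (@lebesgue_rV R d).
Implicit Types (f g phi psi : Rd -> C) (a : C) (x y : Rd) (s : seq 'I_d).
Context (E : completeNormedModType C) (rep : E -> Rd -> C).
Context (hE : TIBF_bounded rep).

Lemma necessity (w : nat -> Rd -> R) (F : (Rd -> C) -> C) : OC' rep w F ->
  forall phi n, test_fun phi -> exists2 r : R, 0 < r &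
    bounded_in_E rep [set g | exists j : nat,
        g = (fun x => (2 `^ (- (r * j%:R)))%:C
                      * weighted (dconv F (dilate phi j)) (w n) x)].
Proof.
move=> [hF HF] phi n /test_funP[sphi [N phiN]].
have /choice[T hT] : forall f, exists u, testN N f ->
    \forall x \ae leb, rep u x = weighted (dconv F f) (w n) x.
  move=> f; have [[sf fN]|] := pselect (testN N f); last by exists 0.
  have [|_ /(_ n)[u /aeE ru]] := HF f; first by apply/test_funP; split=> //; exists N.
  by exists u.
have [k [K [K0 HK]]] := closed_graph hE hF hT.
have [G [l Hphi]] := test_lip k sphi phiN; have [G0 _ _ _] := Hphi [::] 0 isT.
(* Up to k derivatives of phi_j cost 2^(jk) and the normalisation 2^(jd); the successor makes r
   positive even if k + d = 0. *)
exists (k + d).+1%:R => //; exists (K * (G + 1)) => _ [j ->].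
have [sd dd] := Csmooth_dilate j sphi.
have tj : testN N (dilate phi j) by split=> //; exact: csupp_dilate.
(* G + 1 instead of G, as [closed_graph] wants a positive bound also for phi = 0. *)
have B0 : 0 < 2 ^+ (j * (k + d)) * (G + 1) :> R by rewrite mulr_gt0 ?exprn_gt0// ltr_wpDl.
have Tb : normE (T (dilate phi j)) <= K * (2 ^+ (j * (k + d)) * (G + 1)).
  apply: HK => // s x sk; rewrite dd /dilate mulrA -exprD Normc.normcM real2X normcR.
  rewrite ger0_norm ?exprn_ge0// ler_pM ?exprn_ge0 ?normc_ge0//.
    by rewrite ler_weXn2l ?ler1n// mulnDr leq_add2r leq_mul2l sk orbT.
  have [_ _ + _] := Hphi s `|2 ^+ j *: x| sk => /(_ _ (lexx _)) /le_trans; apply.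
  by rewrite lerDl.
exists ((2 `^ (- ((k + d).+1%:R * j%:R)))%:C *: T (dilate phi j)).
  by apply/aeE; apply: filterS2 (repZ hE (2 `^ (- ((k + d).+1%:R * j%:R)))%:C
    (T (dilate phi j))) (hT _ tj) => x -> ->.
rewrite normEE lecR normEZ normcR ger0_norm ?powR_ge0//.
rewrite (le_trans (ler_wpM2l (powR_ge0 _ _) Tb))// mulrCA ler_wpM2l// mulrA.
rewrite ler_piMl ?addr_ge0// powRN -natrM powR_mulrn// mulrC ler_pdivrMr ?exprn_gt0// mul1r.
by rewrite ler_weXn2l ?ler1n// mulnC leq_mul2r leqnSn orbT.
Qed.

(** (ii) yields a separate exponent for each chi; passing to the larger one multiplies by 2^(-(m -
    r) j) <= 1. *)
Lemma bounded_pair (w : Rd -> R) (F : (Rd -> C) -> C) (chi0 chi1 : Rd -> C) (r0 r1 : R) :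
  (forall i : bool, bounded_in_E rep [set g | exists j : nat,
        g = (fun x => (2 `^ (- ((if i then r1 else r0) * j%:R)))%:C
               * weighted (dconv F (dilate (if i then chi1 else chi0) j)) w x)]) ->
  bounded_in_E rep [set g | exists (j : nat) (chi : Rd -> C),
        (chi = chi0 \/ chi = chi1) /\
        g = (fun x => (2 `^ (- (Num.max r0 r1 * j%:R)))%:C
                      * weighted (dconv F (dilate chi j)) w x)].
Proof.
move=> H; have /choice[M HM] := H; exists (`|M false| + `|M true|) => _ [j [chi [hchi ->]]].
have [i ichi] : exists i : bool, chi = if i then chi1 else chi0.
  by case: hchi => ->; [exists false|exists true].
have [u /aeE ru uM] := HM i _ (ex_intro _ j erefl).
set r := if i then r1 else r0 in ru; set m := Num.max r0 r1.
have rm : r <= m by rewrite /r /m le_max; case: (i); rewrite lexx ?orbT.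
exists ((2 `^ (- ((m - r) * j%:R)))%:C *: u).
  apply/aeE; apply: filterS2 (repZ hE (2 `^ (- ((m - r) * j%:R)))%:C u) ru => x -> ->.
  rewrite ichi mulrA -rmorphM/= -powRD ?pnatr_eq0 ?implybT//.
  by congr ((_ `^ _)%:C * _); ring.
rewrite normEE lecR normEZ normcR ger0_norm ?powR_ge0//.
have p1 : 2 `^ (- ((m - r) * j%:R)) <= 1 :> R.
  rewrite powRN invf_le1 ?powR_gt0// -[leLHS](powRr0 2) ler_powR ?ler1n//.
  by rewrite mulr_ge0// subr_ge0.
rewrite (le_trans (ler_wpM2r (normE_ge0 _) p1))// mul1r.
have uM' : normE u <= M i by rewrite -lecR -normEE.
rewrite (le_trans uM')// (le_trans (ler_norm _))//.
by case: (i); rewrite ?lerDl ?lerDr.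
Qed.

End necessity.
Theorem theorem6p13 (R : realType) (d : nat)
    (E : completeNormedModType R[i]) (rep : E -> 'rV[R]_d -> R[i])
    (hE : TIBF_bounded rep) (hsolid : solid rep)
    (w : nat -> 'rV[R]_d -> R) (hw : weight_system w) (hwM : wM w)
    (chi0 chi1 : 'rV[R]_d -> R[i])
    (hchi0 : test_fun chi0) (hchi1 : test_fun chi1)
    (hMDFP : MDFP chi0 chi1)
    (f : ('rV[R]_d -> R[i]) -> R[i]) (hf : is_distribution f) :
  (OC' rep w f <->
    (forall (phi : 'rV[R]_d -> R[i]) (n : nat), test_fun phi ->
      exists2 r : R, 0 < r &
      bounded_in_E rep [set g | exists j : nat,
        g = (fun x => (2 `^ (- (r * j%:R)))%:C
                      * weighted (dconv f (dilate phi j)) (w n) x)])) /\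
  (OC' rep w f <->
    (forall n : nat, exists2 r : R, 0 < r &
      bounded_in_E rep [set g | exists (j : nat) (chi : 'rV[R]_d -> R[i]),
        (chi = chi0 \/ chi = chi1) /\
        g = (fun x => (2 `^ (- (r * j%:R)))%:C
                      * weighted (dconv f (dilate chi j)) (w n) x)])).
Proof.
have i_ii := @necessity R d E rep hE w f.
have ii_iii : (forall (phi : 'rV[R]_d -> R[i]) (n : nat), test_fun phi ->
      exists2 r : R, 0 < r &
      bounded_in_E rep [set g | exists j : nat,
        g = (fun x => (2 `^ (- (r * j%:R)))%:C
                      * weighted (dconv f (dilate phi j)) (w n) x)]) ->
    (forall n : nat, exists2 r : R, 0 < r &
      bounded_in_E rep [set g | exists (j : nat) (chi : 'rV[R]_d -> R[i]),
        (chi = chi0 \/ chi = chi1) /\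
        g = (fun x => (2 `^ (- (r * j%:R)))%:C
                      * weighted (dconv f (dilate chi j)) (w n) x)]).
  move=> H n; have [r0 r0_gt0 H0] := H _ n hchi0; have [r1 r1_gt0 H1] := H _ n hchi1.
  exists (Num.max r0 r1); first by rewrite lt_max r0_gt0.
  by apply: (bounded_pair hE) => -[].
have iii_i := sufficiency hE hsolid hw hwM hchi0 hchi1 hMDFP hf.
by split; split=> //; first [move=> /ii_iii/iii_i|move=> /i_ii/ii_iii].
Qed.
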